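(* Assume Hypotheses D, $R_0$, $R_1$ and $\overline{R}$ (listed in the context). Let $U_\varepsilon(t)$ be the unitary evolution defined by $$i\varepsilon\frac{\partial}{\partial t}U_\varepsilon(t)=\overline{\left(H_0(t)+\varepsilon H_1(t)\right)}\,U_\varepsilon(t),\qquad U_\varepsilon(0)=\mathbf 1,$$ and let $V(t)$ be the unitary evolution defined by $$i\varepsilon V'(t)=\left(\overline{H_0(t)+\varepsilon H_1(t)}-\varepsilon H_1^a(t)+\varepsilon K_0(t)\right)V(t),\qquad V(0)=\mathbf 1.$$ Then the unitary $V(t)$, which enjoys the intertwining property $V(t)P_0(0)=P_0(t)V(t)$ for all $t\in[0,1]$, is such that, as $\varepsilon\to 0$, $$\sup_{t\in[0,1]}\|U_\varepsilon(t)-V(t)\|=\mathcal O(\varepsilon).$$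
   Context: $\mathcal H$ is a separable Hilbert space, $\mathbf 1$ is the identity, $\varepsilon>0$, and a prime denotes the (strong) derivative with respect to $t$. An operator family $A(t)$ is strongly $C^k$ on a domain $\mathcal D$ if $t\mapsto A(t)\varphi$ is $C^k$ on $[0,1]$ for each $\varphi\in\mathcal D$. Hypothesis D: For $t\in[0,1]$, $H_0(t)$ and $H_1(t)$ are self-adjoint operators in $\mathcal H$ with dense, $t$-independent domains $D_0$ and $D_1$ respectively. For every $\varepsilon>0$ the operator $H(t,\varepsilon)=H_0(t)+\varepsilon H_1(t)$ on $D_0\cap D_1$ is essentially self-adjoint on some dense domain $D\subseteq D_0\cap D_1$. Thus its closure $\overline{H(t,\varepsilon)}=\overline{H_0(t)+\varepsilon H_1(t)}$ is self-adjoint on a dense domain $D'\supseteq D_0\cap D_1\supseteq D$, and $D'$ is assumed independent of $t$. Hypothesis $R_0$: $H_0(t)$ is strongly $C^2$ on $D_0$, and its spectrum $\sigma_0(t)$ is divided into two parts $\sigma_0^a(t)$, $\sigma_0^b(t)$ separated by a finite gap for all $t\in[0,1]$, with $\sigma_0^b(t)$ bounded. $P_0(t)$ is the spectral projector associated with $\sigma_0^b(t)$, $P_0(t)=-\frac{1}{2\pi i}\oint_\Gamma R_0(t,\lambda)\,d\lambda$, where $R_0(t,\lambda)=(H_0(t)-\lambda)^{-1}$ and $\Gamma$ is a path which, for all $t\in[0,1]$, lies in the resolvent set of $H_0(t)$ and encircles $\sigma_0^b(t)$ (and not $\sigma_0^a(t)$). (Then $R_0(t,\lambda)$, $\lambda\in\Gamma$,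 and $P_0(t)$ are strongly $C^2$ on $\mathcal H$.) Moreover, for any $t\in[0,1]$, $\mathrm{Ran}\,P_0(t)\subseteq D_1$ and $\mathrm{Ran}\,P_0'(t)\subseteq D_1$. Hypothesis $R_1$: $H_1(t)$ is strongly $C^1$ on $D_1$ and $H_1(0)P_0'(t)$ is strongly $C^0$ on $\mathcal H$. Moreover, for all $(\lambda,t)\in\Gamma\times[0,1]$, $\mathrm{Ran}\,R_0(t,\lambda)H_1(t)P_0(t)\subseteq D_1$ and $\mathrm{Ran}\,R_0(t,\lambda)P_0'(t)P_0(t)\subseteq D_1$, and there is $b<\infty$ with $\sup_{(\lambda,t)\in\Gamma\times[0,1]}\|H_1(0)R_0(t,\lambda)H_1(t)P_0(t)\|<b$ and $\sup_{(\lambda,t)\in\Gamma\times[0,1]}\|H_1(0)R_0(t,\lambda)P_0'(t)P_0(t)\|<b$. Hypothesis $\overline R$: the self-adjoint operator $\overline{H(t,\varepsilon)}$ is strongly $C^1$ on $D'$ and bounded from below for all $t\in[0,1]$. Notation: $Q_0(t)=\mathbf 1-P_0(t)$; $H_1^a(t)=Q_0(t)H_1(t)P_0(t)+P_0(t)H_1(t)Q_0(t)$, where $P_0(t)H_1(t)$, densely defined on $D_1$, is identified with its bounded extension to $\mathcal H$; $K_0(t)=i[P_0'(t),P_0(t)]$. Under these hypotheses $H_1^a(t)$ and $K_0(t)$ are bounded, self-adjoint and strongly $C^1$ on $\mathcal H$. The evolutions $U_\varepsilon(t)$ and $V(t)$ (the latter also depends on $\varepsilon$) are the unitary operators which, together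 with their inverses, map $D'$ to $D'$, are strongly differentiable on $D'$, and satisfy the stated equations on $D'$. *)

(* Defs.v *)
From HB Require Import structures.
From mathcomp Require Import all_boot all_order all_algebra.
From mathcomp Require Import complex.
From mathcomp Require Import all_classical all_reals all_analysis.
Import Order.TTheory GRing.Theory Num.Theory.
Import numFieldNormedType.Exports.

Set Implicit Arguments.
Unset Strict Implicit.
Unset Printing Implicit Defensive.

Local Open Scope classical_set_scope.
Local Open Scope ring_scope.
Local Open Scope complex_scope.

Definition I01 {R : realType} : set R := `[0, 1]%classic.

Section Calculus.
Variables (R : realType) (V : normedModType R[i]).

Definition diff_quot (f : R -> V) (t s : R) : V :=
  ((s - t)^-1)%:C *: (f s - f t).

Definition is_deriv01 (f : R -> V) (t : R) (v : V) : Prop :=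
  diff_quot f t @ within I01 t^' --> v.

Definition deriv01 (f : R -> V) (t : R) : V :=
  lim (diff_quot f t @ within I01 t^').

Fixpoint Ck01 (k : nat) (f : R -> V) : Prop :=
  match k with
  | 0%N => {within I01, continuous f}
  | k.+1 => exists2 g : R -> V,
      (forall t, I01 t -> is_deriv01 f t (g t)) & Ck01 k g
  end.

End Calculus.

Section ScalarIntegral.
Variable R : realType.

Definition cint01 (g : R -> R[i]) : R[i] :=
  (\int[lebesgue_measure]_(s in I01) complex.Re (g s)) +i*
  (\int[lebesgue_measure]_(s in I01) complex.Im (g s)).

Definition two_pi_i : R[i] := 0 +i* (2 * pi).

(* [gamma'] may vanish, so every piecewise C^1 closed path has such a
   parametrization. *)
Definition closed_path (gamma : R -> R[i]) : Prop :=
  Ck01 1 (gamma : R -> R[i]^o) /\ gamma 0 = gamma 1.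

Definition velocity (gamma : R -> R[i]) : R -> R[i] :=
  deriv01 (gamma : R -> R[i]^o).

Definition winding (gamma : R -> R[i]) (z : R[i]) : R[i] :=
  two_pi_i^-1 * cint01 (fun s => velocity gamma s / (gamma s - z)).

End ScalarIntegral.

(* The values of [app] outside of [dom] are irrelevant. *)
Record operator (T : Type) := Operator { dom : set T; app :> T -> T }.

Section Hilbert.
Variables (R : realType) (H : completeNormedModType R[i]).
Variable dot : {dot H for Num.conj}.  (* linear in the first argument *)

Definition separable_hilbert : Prop :=
  (forall x : H, `|x| ^+ 2 = dot x x) /\
  (exists2 A : set H, countable A & dense A).

Definition linear_op (A : operator H) : Prop :=
  forall (a : R[i]) (x y : H), dom A x -> dom A y ->
    dom A (a *: x + y) /\ A (a *: x + y) = a *: A x + A y.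

Definition graph (A : operator H) : set (H * H) :=
  [set p | dom A p.1 /\ p.2 = A p.1].

(* For densely defined [A] this is the graph of the adjoint of [A]. *)
Definition adjoint_graph (A : operator H) : set (H * H) :=
  [set p | forall x, dom A x -> dot (A x) p.1 = dot x p.2].

Definition self_adjoint (A : operator H) : Prop :=
  [/\ dense (dom A), linear_op A & adjoint_graph A = graph A].

Definition op_of_graph (G : set (H * H)) : operator H :=
  Operator [set x | exists y, G (x, y)] (fun x => xget 0 [set y | G (x, y)]).

Definition op_closure (A : operator H) : operator H :=
  op_of_graph (closure (graph A)).

Definition op_restrict (A : operator H) (D : set H) : operator H :=
  Operator D A.

Definition essentially_self_adjoint_on (A : operator H) (D : set H) : Prop :=
  [/\ D `<=` dom A, linear_op (op_restrict A D) &
      self_adjoint (op_closure (op_restrict A D))].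

Definition bounded_below (A : operator H) : Prop :=
  exists c : R, forall x, dom A x -> c%:C * dot x x <= dot (A x) x.

Definition resolvent_set (A : operator H) : set R[i] :=
  [set z | (forall y, exists! x, dom A x /\ A x - z *: x = y) /\
    exists M : R, forall x, dom A x -> `|x| <= M%:C * `|A x - z *: x|].

Definition spectrum (A : operator H) : set R[i] := ~` resolvent_set A.

Definition resolvent (A : operator H) (z : R[i]) (y : H) : H :=
  xget 0 [set x | dom A x /\ A x - z *: x = y].

Definition opnorm (A : H -> H) : \bar R :=
  ereal_sup [set (complex.Re `|A x|)%:E | x in [set x : H | `|x| <= 1]].

Definition unitary (U : H -> H) : Prop :=
  [/\ linear U, forall x y, dot (U x) (U y) = dot x y &
      forall y, exists x, U x = y].

(* Extension by continuity of a map given on the dense set [D]. *)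
Definition cont_ext (D : set H) (f : H -> H) (x : H) : H :=
  lim (f @ within D (nbhs x)).

(* Weak (Pettis) integral; for continuous [f] it is the Riemann integral. *)
Definition int01 (f : R -> H) : H :=
  xget 0 [set v | forall y, dot v y = cint01 (fun s => dot (f s) y)].

Definition contour_int (gamma : R -> R[i]) (f : R[i] -> H) : H :=
  int01 (fun s => velocity gamma s *: f (gamma s)).

Section Family.
Variables (H0 H1 : R -> operator H) (gamma : R -> R[i]).

Definition Heps (eps t : R) : operator H :=
  Operator (dom (H0 t) `&` dom (H1 t)) (fun x => H0 t x + eps%:C *: H1 t x).

Definition Hbar (eps t : R) : operator H := op_closure (Heps eps t).

Definition R0 (t : R) (z : R[i]) : H -> H := resolvent (H0 t) z.

Definition P0 (t : R) (x : H) : H :=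
  - (two_pi_i R)^-1 *: contour_int gamma (fun z => R0 t z x).

Definition dP0 (t : R) (x : H) : H := deriv01 (fun s => P0 s x) t.

Definition Q0 (t : R) (x : H) : H := x - P0 t x.

Definition P0H1 (t : R) : H -> H :=
  cont_ext (dom (H1 t)) (fun x => P0 t (H1 t x)).

Definition H1a (t : R) (x : H) : H :=
  Q0 t (H1 t (P0 t x)) + P0H1 t (Q0 t x).

Definition K0 (t : R) (x : H) : H :=
  'i *: (dP0 t (P0 t x) - P0 t (dP0 t x)).

Record hypothesis_D (D0 D1 : set H) (D' : R -> set H) : Prop := {
  hD_H0 : forall t, I01 t -> self_adjoint (H0 t) /\ dom (H0 t) = D0;
  hD_H1 : forall t, I01 t -> self_adjoint (H1 t) /\ dom (H1 t) = D1;
  (* The core [D] may depend on [eps] and [t]; the closure does not depend on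
     the choice of [D]. *)
  hD_esa : forall eps t : R, 0 < eps -> I01 t ->
    exists D : set H, [/\ dense D, D `<=` D0 `&` D1 &
      essentially_self_adjoint_on (Heps eps t) D];
  hD_dom : forall eps t : R, 0 < eps -> I01 t -> dom (Hbar eps t) = D' eps
}.

Record hypothesis_R0 (D0 D1 : set H) (sigma_a sigma_b : R -> set R[i]) :
    Prop := {
  hR0_C2 : forall x, D0 x -> Ck01 2 (fun t => H0 t x);
  hR0_spec : forall t, I01 t -> spectrum (H0 t) = sigma_a t `|` sigma_b t;
  hR0_gap : forall t, I01 t -> exists2 g : R, 0 < g &
    forall z w, sigma_a t z -> sigma_b t w -> g%:C <= `|z - w|;
  hR0_bounded : forall t, I01 t -> bounded_set (sigma_b t : set R[i]^o);
  hR0_path : closed_path gamma;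
  hR0_path_resolvent : forall t s, I01 t -> I01 s ->
    resolvent_set (H0 t) (gamma s);
  hR0_encircles_b : forall t z, I01 t -> sigma_b t z -> winding gamma z = 1;
  hR0_encircles_a : forall t z, I01 t -> sigma_a t z -> winding gamma z = 0;
  hR0_ran : forall t x, I01 t -> D1 (P0 t x);
  hR0_ran' : forall t x, I01 t -> D1 (dP0 t x)
}.

Record hypothesis_R1 (D1 : set H) : Prop := {
  hR1_C1 : forall x, D1 x -> Ck01 1 (fun t => H1 t x);
  hR1_C0 : forall x, Ck01 0 (fun t => H1 0 (dP0 t x));
  hR1_ran : forall s t x, I01 s -> I01 t ->
    D1 (R0 t (gamma s) (H1 t (P0 t x)));
  hR1_ran' : forall s t x, I01 s -> I01 t ->
    D1 (R0 t (gamma s) (dP0 t (P0 t x)));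
  hR1_bound : exists b : R,
    (ereal_sup [set opnorm (fun x => H1 0 (R0 p.2 p.1 (H1 p.2 (P0 p.2 x))))
       | p in (gamma @` I01) `*` I01] < b%:E)%E /\
    (ereal_sup [set opnorm (fun x => H1 0 (R0 p.2 p.1 (dP0 p.2 (P0 p.2 x))))
       | p in (gamma @` I01) `*` I01] < b%:E)%E
}.

Record hypothesis_Rbar (D' : R -> set H) : Prop := {
  hRbar_C1 : forall (eps : R) (x : H), 0 < eps -> D' eps x ->
    Ck01 1 (fun t => Hbar eps t x);
  hRbar_below : forall eps t : R, 0 < eps -> I01 t ->
    bounded_below (Hbar eps t)
}.

End Family.

(* As [W t] is bijective, [ev_domain] says that [W t] and its inverse both map
   [D'] into itself. *)
Record evolution (eps : R) (D' : set H) (G : R -> H -> H) (W : R -> H -> H) :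
    Prop := {
  ev_unitary : forall t, I01 t -> unitary (W t);
  ev_domain : forall t x, I01 t -> D' (W t x) <-> D' x;
  ev_init : forall x, W 0 x = x;
  ev_eq : forall t x, I01 t -> D' x ->
    exists2 v : H, is_deriv01 (fun s => W s x) t v &
      ('i * eps%:C) *: v = G t (W t x)
}.

End Hilbert.

(* Main.v *)
(* The spectral projector is handled without a spectral theorem. With [w mu] the
   winding number, [(w mu - P) y] is a contour integral of
   [R(z) (H_0 - mu) y / (z - mu)] for real [mu] in the spectrum; since [w mu] is 0 or
   1 there, [T = P - P^* P] is dominated by [|(H_0 - mu) y|], first on the spectrum
   and then for every real [mu]. Passing to the Cayley transform, a doubling
   argument forces [T = 0], so [P] is an orthogonal projector.

   The intertwining property holds because [t |-> <P(t) V(t) x, V(t) y>] has zero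
   derivative: the generator of [V] is block diagonal up to [eps K_0].

   For the estimate put [Z = (1 - P) H_1 P - i P' P] and
   [F = - (2 pi i)^-1 \oint R Z R], so that [[H_0, F] = Z], and replace [F] by the
   anti-self-adjoint [F - F^*]. Then [t |-> <(1 - eps F) V x, U y>] has difference
   quotients of order [eps], the terms of order [1 / eps] coming from [H_0] being
   cancelled by the commutator; only Lipschitz continuity of [F] in [t] is used. *)

(* The path is only a closed C^1 curve whose winding numbers are prescribed on the spectrum: it need
   not be simple or symmetric about the real axis. The usual proofs that the Riesz integral is an
   orthogonal projector, by a second nested contour and by reflecting the contour, are thus not at
   hand; this is why [T] is tested at spectral points only.

   Regularity is assumed strongly, on a domain. Uniform boundedness turns it into Lipschitz bounds
   relative to the graph norm at time 0, and these pass to resolvents and contour integrals.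

   Since [H_1] is unbounded, the corrector must also map into its domain; for [F] this comes from
   the bounds of $R_1$ along the path, for [F^*] from [F^* = P F^*]. *)
Require Import Defs.
From HB Require Import structures.
From mathcomp Require Import all_boot all_order all_algebra.
From mathcomp Require Import complex ring lra.
From mathcomp Require Import all_classical all_reals all_analysis.
Import Order.TTheory GRing.Theory Num.Theory.
Import numFieldNormedType.Exports.
Local Open Scope classical_set_scope.
Local Open Scope ring_scope.
Local Open Scope complex_scope.

Set Implicit Arguments.
Unset Strict Implicit.
Unset Printing Implicit Defensive.

(** * Norms and inner products *)

Section RealNorm.
Variables (R : realType) (V : normedZmodType R[i]).

(** Norms over [R[i]] are complex-valued; the real part makes them available to [lra], [nra] and
    real suprema. *)
Definition nrm (x : V) : R := complex.Re `|x|.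

Lemma nrmE x : `|x| = (nrm x)%:C.
Proof. by rewrite /nrm RRe_real // normr_real. Qed.

Lemma nrm_ge0 x : 0 <= nrm x.
Proof. by rewrite -lecR -nrmE normr_ge0. Qed.

Lemma nrm0 : nrm 0 = 0.
Proof. by rewrite /nrm normr0. Qed.

Lemma nrm_eq0 x : nrm x = 0 -> x = 0.
Proof. by move=> h; apply/eqP; rewrite -normr_eq0 nrmE h. Qed.

Lemma nrm_gt0 x : x != 0 -> 0 < nrm x.
Proof.
by move=> x0; rewrite lt_neqAle nrm_ge0 andbT eq_sym; apply: contraNneq x0 => /nrm_eq0 ->.
Qed.

Lemma nrmN x : nrm (- x) = nrm x.
Proof. by rewrite /nrm normrN. Qed.

Lemma nrmB x y : nrm (x - y) = nrm (y - x).
Proof. by rewrite /nrm distrC. Qed.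

Lemma nrmD_le x y : nrm (x + y) <= nrm x + nrm y.
Proof. by rewrite -lecR rmorphD /= -!nrmE ler_normD. Qed.

Lemma nrmB_le x y : nrm (x - y) <= nrm x + nrm y.
Proof. by rewrite -(nrmN y); exact: nrmD_le. Qed.

Lemma nrm_tri z x y : nrm (x - y) <= nrm (x - z) + nrm (z - y).
Proof. by rewrite -lecR rmorphD /= -!nrmE ler_distD. Qed.

Lemma nrm_leB x y : nrm x - nrm y <= nrm (x - y).
Proof. by rewrite lerBlDr -{1}(subrK y x) nrmD_le. Qed.

End RealNorm.
Arguments nrm {R V} x.

Section ComplexModulus.
Variable R : realType.
Implicit Types (a b : R[i]) (r : R).

Lemma nrmM a b : nrm (a * b) = nrm a * nrm b.
Proof. by rewrite {1}/nrm normrM !nrmE -rmorphM. Qed.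

Lemma nrmV a : nrm a^-1 = (nrm a)^-1.
Proof. by rewrite {1}/nrm normfV nrmE -fmorphV. Qed.

Lemma nrm1 : nrm (1 : R[i]) = 1.
Proof. by rewrite /nrm normr1. Qed.

Lemma nrm_real r : nrm r%:C = `|r|.
Proof. by rewrite /nrm normc_def /= expr0n /= addr0 sqrtr_sqr. Qed.

Lemma nrm_i : nrm ('i%C : R[i]) = 1.
Proof. by rewrite /nrm normc_def /= expr0n /= add0r expr1n sqrtr1. Qed.

Lemma nrm_conj a : nrm (conjc a) = nrm a.
Proof. by rewrite /nrm normcJ. Qed.

Lemma conjcM a b : conjc (a * b) = conjc a * conjc b.
Proof. exact: rmorphM. Qed.

Lemma conjcB a b : conjc (a - b) = conjc a - conjc b.
Proof. exact: rmorphB. Qed.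

Lemma conjcD a b : conjc (a + b) = conjc a + conjc b.
Proof. exact: rmorphD. Qed.

Lemma conjc_i : conjc ('i%C : R[i]) = - 'i%C.
Proof. by apply/eqP; rewrite eq_complex /= oppr0 !eqxx. Qed.

Lemma conjcNi : conjc (- 'i%C : R[i]) = 'i%C.
Proof. by rewrite -conjc_i conjcK. Qed.

Lemma nrm_Re a : `|complex.Re a| <= nrm a.
Proof. by rewrite -lecR -nrmE normc_ge_Re. Qed.

Lemma nrm_Im a : `|complex.Im a| <= nrm a.
Proof.
have := nrm_Re (a * 'i%C); rewrite nrmM nrm_i mulr1.
by rewrite ReiNIm normrN.
Qed.

Lemma nrm_sqr a : nrm a ^+ 2 = complex.Re a ^+ 2 + complex.Im a ^+ 2.
Proof. by apply: complexI; rewrite rmorphXn /= -nrmE add_Re2_Im2. Qed.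

Lemma nrm_le_ReIm a : nrm a <= `|complex.Re a| + `|complex.Im a|.
Proof.
have h := nrm_sqr a; rewrite -(real_normK (num_real (complex.Re a))) in h.
rewrite -(real_normK (num_real (complex.Im a))) in h.
have := nrm_ge0 a; have := normr_ge0 (complex.Re a).
have := normr_ge0 (complex.Im a); nra.
Qed.

End ComplexModulus.

Section LmodNorm.
Variables (R : realType) (V : normedModType R[i]).

Lemma nrmZ (a : R[i]) (x : V) : nrm (a *: x) = nrm a * nrm x.
Proof. by rewrite {1}/nrm normrZ !nrmE -rmorphM. Qed.

Lemma nrmZr (r : R) (x : V) : nrm (r%:C *: x) = `|r| * nrm x.
Proof. by rewrite nrmZ nrm_real. Qed.

End LmodNorm.

Section InnerProduct.
Variables (R : realType) (H : completeNormedModType R[i]).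
Variable dot : {dot H for Num.conj}.
Hypothesis dotE : forall x : H, `|x| ^+ 2 = dot x x.
Implicit Types (x y z : H) (a : R[i]).

Lemma dotC x y : dot y x = conjc (dot x y).
Proof. by rewrite hermC /= expr0 mul1r. Qed.

Lemma dotDl x y z : dot (x + y) z = dot x z + dot y z.
Proof. exact: linearDl. Qed.
Lemma dotBl x y z : dot (x - y) z = dot x z - dot y z.
Proof. exact: linearBl. Qed.
Lemma dotNl x z : dot (- x) z = - dot x z.
Proof. exact: linearNl. Qed.
Lemma dotZl a x z : dot (a *: x) z = a * dot x z.
Proof. exact: linearZl_LR. Qed.
Lemma dot0l z : dot 0 z = 0.
Proof. exact: linear0l. Qed.
Lemma dotDr x y z : dot z (x + y) = dot z x + dot z y.
Proof. exact: linearDr. Qed.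
Lemma dotBr x y z : dot z (x - y) = dot z x - dot z y.
Proof. exact: linearBr. Qed.
Lemma dotNr x z : dot z (- x) = - dot z x.
Proof. exact: linearNr. Qed.
Lemma dotZr a x z : dot z (a *: x) = conjc a * dot z x.
Proof. exact: linearZr_LR. Qed.
Lemma dot0r z : dot z 0 = 0.
Proof. exact: linear0r. Qed.

(** Vector identities are proved throughout by pairing with an arbitrary vector ([dot_extl]),
    expanding with [dot_lin] and calling [ring] on the scalars. *)
Definition dot_lin := (dotDl, dotBl, dotNl, dotZl, dot0l,
  dotDr, dotBr, dotNr, dotZr, dot0r).

Lemma dotxx x : dot x x = (nrm x ^+ 2)%:C.
Proof. by rewrite -dotE nrmE rmorphXn. Qed.

Lemma dot_extl x y : (forall z, dot x z = dot y z) -> x = y.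
Proof.
move=> h; apply: subr0_eq; apply: nrm_eq0.
have : dot (x - y) (x - y) = 0 by rewrite dotBl h subrr.
by rewrite dotxx => /complexI/eqP; rewrite sqrf_eq0 => /eqP.
Qed.

Lemma nrmD_sqr x y :
  nrm (x + y) ^+ 2 = nrm x ^+ 2 + nrm y ^+ 2 + 2 * complex.Re (dot x y).
Proof.
have e : (2 * complex.Re (dot x y))%:C = dot x y + conjc (dot x y).
  by rewrite addcJ rmorphM /= rmorph_nat.
apply: complexI; rewrite -dotxx !dot_lin !dotxx (dotC x y).
rewrite [RHS]rmorphD /= e rmorphD /=; ring.
Qed.

Lemma nrmB_sqr x y :
  nrm (x - y) ^+ 2 = nrm x ^+ 2 + nrm y ^+ 2 - 2 * complex.Re (dot x y).
Proof. by rewrite nrmD_sqr nrmN dotNr raddfN /= mulrN. Qed.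

Lemma parallelogram x y :
  nrm (x + y) ^+ 2 + nrm (x - y) ^+ 2 = 2 * nrm x ^+ 2 + 2 * nrm y ^+ 2.
Proof. rewrite nrmD_sqr nrmB_sqr; ring. Qed.

(** Cauchy-Schwarz: [c *: y] is the orthogonal projection of [x] on the line of [y], and the squared
    norm of [x - c *: y] is nonnegative. *)
Lemma dot_le x y : nrm (dot x y) <= nrm x * nrm y.
Proof.
have [->|y0] := eqVneq y 0; first by rewrite dot0r !nrm0 mulr0.
have ny := nrm_gt0 y0.
pose c := dot x y * ((nrm y ^+ 2)^-1)%:C.
have h : 0 <= nrm (x - c *: y) ^+ 2 by rewrite sqr_ge0.
move: h; rewrite nrmB_sqr nrmZ dotZr.
have -> : conjc c * dot x y = ((nrm (dot x y)) ^+ 2 * (nrm y ^+ 2)^-1)%:C.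
  rewrite /c conjcM conjc_real mulrAC [RHS](rmorphM (real_complex R))
    (rmorphXn (real_complex R)) /= -nrmE.
  by rewrite sqr_normc [_ * conjc _]mulrC.
rewrite /c nrmM nrm_real /= ger0_norm ?invr_ge0 ?sqr_ge0 //.
set d := nrm (dot x y); set n := nrm y => h.
have {}h : d ^+ 2 <= nrm x ^+ 2 * n ^+ 2.
  rewrite -subr_ge0; have -> : nrm x ^+ 2 * n ^+ 2 - d ^+ 2 =
    n ^+ 2 * (nrm x ^+ 2 + (d / n ^+ 2 * n) ^+ 2 - 2 * (d ^+ 2 / n ^+ 2)).
    by field; rewrite gt_eqF.
  by rewrite mulr_ge0 // sqr_ge0.
rewrite -exprMn in h.
by rewrite -(@ler_pXn2r _ 2) // nnegrE ?mulr_ge0 ?nrm_ge0.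
Qed.

Lemma nrm_le_dot x (C : R) : 0 <= C ->
  (forall y, nrm (dot x y) <= C * nrm y) -> nrm x <= C.
Proof.
move=> C0 h; have := h x; rewrite dotxx nrm_real ger0_norm ?sqr_ge0 //.
have := nrm_ge0 x; rewrite le_eqVlt => /orP[/eqP <- //|n0].
by rewrite expr2 ler_pM2r.
Qed.

End InnerProduct.

(** * Limits, density and derivatives through the real norm *)

Section Topology.
Variables (R : realType).

Lemma pos_complexP (e : R[i]) : 0 < e -> exists2 r : R, 0 < r & e = r%:C.
Proof.
case: e => a b; rewrite ltcE /= => /andP[/eqP -> a0]; by exists a.
Qed.

Variable V : normedModType R[i].

Lemma cvg_nrmP (T : Type) (F : set_system T) (f : T -> V) (v : V) :
  Filter F ->
  (f @ F --> v) <-> (forall e : R, 0 < e -> \forall t \near F, nrm (v - f t) < e).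
Proof.
move=> FF; split=> [/cvgrPdist_lt h e e0|h].
  have e0' : 0 < e%:C by rewrite ltcR.
  by apply: filterS (h _ e0') => t; rewrite nrmE ltcR.
apply/cvgrPdist_lt => _ /pos_complexP[e e0 ->].
by apply: filterS (h _ e0) => t; rewrite nrmE ltcR.
Qed.

Lemma nbhs_nrmP (x : V) (A : set V) :
  nbhs x A <-> exists2 e : R, 0 < e & forall y, nrm (x - y) < e -> A y.
Proof.
split=> [/nbhs_normP[_ /= /pos_complexP[e e0 ->] h]|[e e0 h]].
  by exists e => // y yx; apply: h; rewrite /ball_ /= nrmE ltcR.
apply/nbhs_normP; exists e%:C => /=; first by rewrite ltcR.
by move=> y; rewrite /ball_ /= nrmE ltcR => /h.
Qed.

Lemma dense_nrm (D : set V) (x : V) (e : R) : dense D -> 0 < e ->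
  exists2 y, D y & nrm (x - y) < e.
Proof.
move=> dD e0; pose A := [set y | nrm (x - y) < e].
have oA : open A.
  rewrite openE => y /= yA; apply/nbhs_nrmP; exists (e - nrm (x - y)).
    by rewrite subr_gt0.
  move=> z yz; rewrite /A /=; have := nrm_tri y x z; lra.
have [|y [Ay Dy]] := dD A _ oA; last by exists y.
by exists x; rewrite /A /= subrr nrm0.
Qed.

Lemma dnbhs_I01P (t : R) (A : set R) : I01 t ->
  (\forall s \near within I01 t^', A s) <->
  exists2 d : R, 0 < d & forall s, I01 s -> s != t -> `|s - t| < d -> A s.
Proof.
move=> It; split.
  move=> /nbhs_normP[d /= d0 h]; exists d => // s Is st sd.
  by apply: h => //=; rewrite distrC.
move=> [d d0 h]; apply/nbhs_normP; exists d => //= s.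
by rewrite /ball_ /= distrC => sd st Is; exact: h.
Qed.

(** Uniqueness of [lim], hence of [deriv01], rests on this: from [t] one can move by a small [m] to
    the right if [t <= 1 / 2] and to the left otherwise without leaving the interval. *)
Lemma dnbhs_I01_proper (t : R) : I01 t -> ProperFilter (within I01 t^').
Proof.
move=> It; apply: Build_ProperFilter_ex => A /(dnbhs_I01P _ It)[d d0 h].
move: (It); rewrite /I01 /= in_itv /= => /andP[t0 t1].
pose m := Num.min (d / 2) (1 / 2).
have m0 : 0 < m by rewrite lt_min; apply/andP; split; lra.
have md : m < d by rewrite gt_min; apply/orP; left; lra.
have m1 : m <= 1 / 2 by rewrite ge_min lexx orbT.
have [t2|t2] := leP t (1 / 2).
- exists (t + m); apply: h.
  + rewrite /I01 /= in_itv /=; apply/andP; split; lra.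
  + rewrite -subr_eq0 addrC addrA addNr add0r gt_eqF //.
  + by rewrite addrC addrA addNr add0r gtr0_norm.
- exists (t - m); apply: h.
  + rewrite /I01 /= in_itv /=; apply/andP; split; lra.
  + by rewrite -subr_eq0 addrAC subrr add0r oppr_eq0 gt_eqF.
  + by rewrite addrAC subrr add0r normrN gtr0_norm.
Qed.

(** First-order expansion with a weak inequality, so that [s = t] is allowed and no division
    occurs. *)
Lemma is_deriv01P (f : R -> V) (t : R) (v : V) : I01 t ->
  is_deriv01 f t v <-> forall e : R, 0 < e -> exists2 d : R, 0 < d &
    forall s, I01 s -> `|s - t| < d ->
      nrm (f s - f t - (s - t)%:C *: v) <= e * `|s - t|.
Proof.
move=> It; have PF := dnbhs_I01_proper It.
have key s : s != t -> nrm (v - diff_quot f t s) * `|s - t| =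
    nrm (f s - f t - (s - t)%:C *: v).
  move=> st; have st0 : s - t != 0 by rewrite subr_eq0.
  rewrite mulrC -nrmZr /diff_quot scalerBr scalerA -rmorphM /= divff //.
  by rewrite scale1r nrmB.
split=> [/cvg_nrmP h e e0|h].
  have [d d0 {}h] := (dnbhs_I01P _ It).1 (h _ e0).
  exists d => // s Is sd; have [->|st] := eqVneq s t.
    by rewrite !subrr scale0r subr0 nrm0 normr0 mulr0.
  by rewrite -key // ler_wpM2r // ltW // h.
apply/cvg_nrmP => e e0; apply/(dnbhs_I01P _ It).
have e2 : 0 < e / 2 by lra.
have [d d0 {}h] := h _ e2; exists d => // s Is st sd.
have := h s Is sd; rewrite -key // ler_pM2r ?normr_gt0 ?subr_eq0 //; lra.
Qed.

Lemma deriv01E (f : R -> V) (t : R) (v : V) : I01 t ->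
  is_deriv01 f t v -> deriv01 f t = v.
Proof.
move=> It h; have PF := dnbhs_I01_proper It.
by apply: cvg_lim => //; exact: norm_hausdorff.
Qed.

Lemma continuous_I01P (f : R -> V) :
  {within I01, continuous f} <-> forall t e, I01 t -> 0 < e ->
    exists2 d : R, 0 < d & forall s, I01 s -> `|s - t| < d -> nrm (f s - f t) < e.
Proof.
rewrite subspace_continuousP; split=> [h t e It e0|h t It].
  have /cvg_nrmP/(_ _ e0) := h t It.
  move=> /nbhs_normP[d /= d0 hd]; exists d => // s Is sd.
  by rewrite nrmB; apply: hd => //=; rewrite distrC.
apply/cvg_nrmP => e e0; have [d d0 hd] := h t e It e0.
apply/nbhs_normP; exists d => //= s; rewrite /ball_ /= distrC => sd Is.
by rewrite nrmB; exact: hd.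
Qed.

End Topology.

(** * Calculus on the unit interval *)

Section IntervalCalculus.
Variable R : realType.

Lemma I01E (t : R) : I01 t <-> 0 <= t <= 1.
Proof. by rewrite /I01 /= in_itv. Qed.

Lemma I01_0 : @I01 R 0.
Proof. by apply/I01E; rewrite lexx ler01. Qed.

(* Cousin's lemma. *)
Lemma interval_induction (P : R -> R -> Prop) (a b : R) : a <= b ->
  (forall u v w, a <= u -> u <= v -> v <= w -> w <= b -> P u v -> P v w -> P u w) ->
  (forall t, a <= t -> t <= b -> exists2 d : R, 0 < d &
     forall u v, a <= u -> u <= t -> t <= v -> v <= b -> v - u < d -> P u v) ->
  P a b.
Proof.
move=> ab tr loc; pose S := [set t | [/\ a <= t, t <= b & P a t]].
have Paa : P a a.
  by have [d d0] := loc a (lexx _) ab; apply => //; rewrite subrr.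
have hS : has_sup S by split; [exists a | exists b => t []].
pose c := sup S.
have ac : a <= c by apply: ub_le_sup => //; case: hS.
have cb : c <= b by apply: ge_sup; [exists a | move=> t []].
have [d d0 hd] := loc c ac cb.
have d2 : 0 < d / 2 by lra.
have [t [at_ tb Pt] ct] := sup_adherent d2 hS.
have tc : t <= c by apply: ub_le_sup => //; case: hS.
(* [t] lies within [d / 2] of the supremum [c], so the local hypothesis at [c] covers the step from
   [t] to [s]. Then [s] is in [S], which forces [s = c] and therefore [c = b]. *)
pose s := Num.min b (c + d / 4).
have cs : c <= s by rewrite le_min cb /=; lra.
have sb : s <= b by rewrite ge_min lexx.
have sd : s <= c + d / 4 by rewrite ge_min lexx orbT.
have Pas : P a s.
  apply: (tr a t s) => //; first exact: le_trans tc cs.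
  apply: hd => //; rewrite -/c in ct; lra.
have Ss : S s by split => //; lra.
have sc : s <= c by apply: ub_le_sup => //; case: hS.
suff -> : b = s by [].
have : s = c by apply/eqP; rewrite eq_le sc cs.
rewrite /s; case: (leP b (c + d / 4)) => // _; lra.
Qed.

Variable V : normedModType R[i].

(** Stated with local bounds on increments instead of a derivative, because the final estimate
    applies it to functions built from a corrector that is only Lipschitz in time. The bounds on
    adjacent intervals add up, so interval induction applies. *)
Lemma mean_value_ineq (f : R -> V) (M a b : R) : a <= b ->
  (forall t e, a <= t -> t <= b -> 0 < e -> exists2 d : R, 0 < d &
    forall s, a <= s -> s <= b -> `|s - t| < d ->
      nrm (f s - f t) <= (M + e) * `|s - t|) ->
  nrm (f b - f a) <= M * (b - a).
Proof.
move=> ab h; apply/ler_addgt0Pl => e e0.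
pose e' := e / (b - a + 1).
have e'0 : 0 < e' by rewrite divr_gt0 //; lra.
apply: (@le_trans _ _ ((M + e') * (b - a))); last first.
  rewrite mulrDl addrC lerD2r /e' mulrAC ler_pdivrMr; last lra.
  by rewrite ler_wpM2l //; lra.
apply: (@interval_induction (fun u v => nrm (f v - f u) <= (M + e') * (v - u)))
  => // [u v w _ _ _ _ h1 h2|t at_ tb].
  apply: (le_trans (nrm_tri (f v) _ _)); rewrite addrC; lra.
have [d d0 hd] := h t e' at_ tb e'0; exists d => // u v au ut tv vb vud.
apply: (le_trans (nrm_tri (f t) _ _)).
have h1 := hd v (le_trans at_ tv) vb; have h2 := hd u au (le_trans ut tb).
move: h1 h2; rewrite (nrmB (f u)) ger0_norm ?subr_ge0 // distrC.
rewrite ger0_norm ?subr_ge0 // => h1 h2.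
have := h1 (le_lt_trans (lerB (lexx v) ut) vud).
have := h2 (le_lt_trans (lerB tv (lexx u)) vud).
lra.
Qed.

Lemma continuous_I01_bounded (f : R -> V) : {within I01, continuous f} ->
  exists2 C : R, 0 <= C & forall t, I01 t -> nrm (f t) <= C.
Proof.
move=> /continuous_I01P cf.
suff [C h] : exists C : R, forall t, 0 <= t <= 1 -> nrm (f t) <= C.
  exists C => [|t /I01E]; last exact: h.
  by apply: le_trans (nrm_ge0 (f 0)) (h 0 _); rewrite lexx ler01.
apply: (@interval_induction
  (fun u v => exists C : R, forall t, u <= t <= v -> nrm (f t) <= C)) => //.
  move=> u v w _ _ _ _ [C1 h1] [C2 h2]; exists (Num.max C1 C2) => t /andP[ut tw].
  have [tv|vt] := leP t v.
    by rewrite le_max h1 ?ut.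
  by rewrite le_max h2 ?orbT // tw ltW.
move=> t t0 t1; have It : I01 t by apply/I01E/andP.
have [d d0 hd] := cf t 1 It ltr01; exists d => // u v u0 ut tv v1 uvd.
exists (nrm (f t) + 1) => s /andP[us sv].
have Is : I01 s by apply/I01E/andP; split; lra.
have std : `|s - t| < d by rewrite ltr_norml; apply/andP; split; lra.
have := hd s Is std; have := nrm_leB (f s) (f t); lra.
Qed.

Lemma is_deriv01_local_lip (f : R -> V) (t M : R) (v : V) : I01 t ->
  is_deriv01 f t v -> nrm v <= M -> forall e, 0 < e -> exists2 d : R, 0 < d &
    forall s, I01 s -> `|s - t| < d -> nrm (f s - f t) <= (M + e) * `|s - t|.
Proof.
move=> It /(is_deriv01P _ _ It) h vM e e0; have [d d0 hd] := h e e0.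
exists d => // s Is sd; have := hd s Is sd.
have := nrm_leB (f s - f t) ((s - t)%:C *: v); rewrite nrmZr.
have := ler_wpM2r (normr_ge0 (s - t)) vM; lra.
Qed.

Lemma deriv01_lip (f g : R -> V) (M : R) :
  (forall t, I01 t -> is_deriv01 f t (g t)) ->
  (forall t, I01 t -> nrm (g t) <= M) ->
  forall s t, I01 s -> I01 t -> nrm (f s - f t) <= M * `|s - t|.
Proof.
move=> df gM s t.
wlog st : s t / t <= s => [hw Is It|].
  have [st|/ltW st] := leP t s; first exact: hw.
  by rewrite nrmB distrC; exact: hw.
move=> /I01E/andP[s0 s1] /I01E/andP[t0 t1]; rewrite ger0_norm ?subr_ge0 //.
apply: mean_value_ineq => // u e tu us e0.
have Iu : I01 u by apply/I01E/andP; split; lra.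
have [d d0 h] := is_deriv01_local_lip Iu (df u Iu) (gM u Iu) e0.
exists d => // w tw ws; apply: h; apply/I01E/andP; split; lra.
Qed.

Lemma C1_lip (f : R -> V) : Ck01 1 f -> exists2 M : R, 0 <= M &
  forall s t, I01 s -> I01 t -> nrm (f s - f t) <= M * `|s - t|.
Proof.
move=> [g df /continuous_I01_bounded[M M0 gM]]; exists M => //.
exact: deriv01_lip df gM.
Qed.

(** Between [t] and [s] the function [h] has derivative [g u - g t], of norm at most [L * |s - t|];
    the mean value inequality then gives [L] where integration would give [L / 2]. *)
Lemma is_deriv01_taylor (f g : R -> V) (L : R) : 0 <= L ->
  (forall t, I01 t -> is_deriv01 f t (g t)) ->
  (forall s t, I01 s -> I01 t -> nrm (g s - g t) <= L * `|s - t|) ->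
  forall s t, I01 s -> I01 t ->
    nrm (f s - f t - (s - t)%:C *: g t) <= L * (s - t) ^+ 2.
Proof.
move=> L0 df gL s t Is It.
pose h u := f u - (u - t)%:C *: g t.
have hE : f s - f t - (s - t)%:C *: g t = h s - h t.
  by rewrite /h subrr scale0r subr0 addrAC.
rewrite hE; have -> : L * (s - t) ^+ 2 = L * `|s - t| * `|s - t|.
  by rewrite -mulrA -expr2 real_normK // num_real.
have loc u e : I01 u -> 0 < e -> `|u - t| <= `|s - t| ->
    exists2 d : R, 0 < d & forall w, I01 w -> `|w - u| < d ->
      nrm (h w - h u) <= (L * `|s - t| + e) * `|w - u|.
  move=> Iu e0 ust; have [d d0 hd] := (is_deriv01P f (g u) Iu).1 (df u Iu) e e0.
  exists d => // w Iw wu; have := hd w Iw wu.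
  have -> : h w - h u = (f w - f u - (w - u)%:C *: g u) + (w - u)%:C *: (g u - g t).
    rewrite scalerBr addrA subrK /h opprD addrACA -opprD -scalerBl -rmorphB.
    by congr (_ - _%:C *: _); ring.
  move=> h1; apply: (le_trans (nrmD_le _ _)); rewrite nrmZr.
  have := gL u t Iu It.
  have h2 := ler_wpM2l L0 ust; move=> h3.
  have := ler_wpM2l (normr_ge0 (w - u)) (le_trans h3 h2); lra.
move: (Is) (It) => /I01E/andP[s0 s1] /I01E/andP[t0 t1].
have [st|/ltW st] := leP t s.
  rewrite [X in _ <= _ * X]ger0_norm ?subr_ge0 //.
  apply: mean_value_ineq => // u e tu us e0.
  have Iu : I01 u by apply/I01E/andP; split; lra.
  have [|d d0 hd] := loc u e Iu e0; first by rewrite !ger0_norm; lra.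
  exists d => // w tw ws; apply: hd; apply/I01E/andP; split; lra.
rewrite nrmB [X in _ <= _ * X]distrC [X in _ <= _ * X]ger0_norm ?subr_ge0 //.
apply: mean_value_ineq => // u e tu us e0.
have Iu : I01 u by apply/I01E/andP; split; lra.
have [|d d0 hd] := loc u e Iu e0; first by rewrite distrC [`|s - _|]distrC !ger0_norm; lra.
exists d => // w tw ws; apply: hd; apply/I01E/andP; split; lra.
Qed.

End IntervalCalculus.

(** * Functional analysis *)

Section Completeness.
Variables (R : realType) (H : completeNormedModType R[i]).

Lemma nrm_cauchy_filter (F : set_system H) : ProperFilter F ->
  (forall e : R, 0 < e -> exists x, F [set y | nrm (x - y) < e]) ->
  exists l : H, F --> l.
Proof.
move=> PF h; exists (lim F); apply: cauchy_cvg; apply: cauchy_exP.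
move=> _ /pos_complexP[e e0 ->]; have [x hx] := h e e0; exists x.
by apply: filterS hx => y; rewrite -ball_normE /ball_ /= nrmE ltcR.
Qed.

Lemma nrm_complete (u : nat -> H) (r : nat -> R) :
  (forall m n, (n <= m)%N -> nrm (u m - u n) <= r n) ->
  (forall e : R, 0 < e -> exists n, r n < e) ->
  exists l, forall n, nrm (l - u n) <= r n.
Proof.
move=> hu hr; have [|l ul] := @nrm_cauchy_filter (u @ \oo) _.
  move=> e e0; have [n hn] := hr e e0; exists (u n); exists n => // m /= nm.
  by rewrite nrmB; exact: le_lt_trans (hu _ _ nm) hn.
exists l => n; apply/ler_addgt0Pl => e e0.
have /cvg_nrmP/(_ e e0) [N _ hN] := ul.
have := hN (maxn N n) (leq_maxl _ _); have := hu _ _ (leq_maxr N n).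
have := nrm_tri (u (maxn N n)) l (u n); rewrite /=; lra.
Qed.

End Completeness.

Section UniformBoundedness.
Variables (R : realType) (H : completeNormedModType R[i]).

(** Operators are plain functions carrying a [linear] hypothesis; a locally packed linear map
    recovers the morphism lemmas. *)
Lemma linear_facts (W : lmodType R[i]) (V : lmodType R[i]) (f : V -> W) :
  linear f -> [/\ f 0 = 0, {morph f : x y / x + y}, {morph f : x / - x},
   {morph f : x y / x - y} & forall a, {morph f : x / a *: x}].
Proof.
move=> lf.
pose g : {linear V -> W} := HB.pack f (GRing.isLinear.Build _ _ _ _ _ lf).
by split=> [|x y|x|x y|a x]; rewrite -[f]/(g : V -> W);
  [exact: linear0|exact: linearD|exact: linearN|exact: linearB|exact: linearZ].
Qed.

Variable V : normedModType R[i].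

(** Banach-Steinhaus, with the Baire argument carried out directly on nested balls. *)
Lemma uniform_boundedness (I : Type) (T : I -> H -> V) :
  (forall i, linear (T i)) ->
  (forall i, exists C : R, forall x, nrm (T i x) <= C * nrm x) ->
  (forall x, exists C : R, forall i, nrm (T i x) <= C) ->
  exists2 C : R, 0 <= C & forall i x, nrm (T i x) <= C * nrm x.
Proof.
move=> lT bT pT.
(* If the family is bounded on one ball, subtracting the value at the centre and rescaling give the
   bound. Otherwise [step] shrinks any ball to one on which some [T i] exceeds [n] everywhere. *)
have [[[x0 r] /= [K [r0 hK]]]|nK] := pselect (exists p : H * R, exists K : R,
  0 < p.2 /\ forall i y, nrm (y - p.1) <= p.2 -> nrm (T i y) <= K).
  rewrite /= in r0 hK.
  have K0 (i : I) : 0 <= K.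
    by apply: (le_trans (nrm_ge0 (T i x0))); apply: hK; rewrite subrr nrm0 ltW.
  exists (`|2 * K / r|) => // i x.
  have {}K0 := K0 i.
  have [T0 TD _ TB TZ] := linear_facts (lT i).
  have [->|x_neq0] := eqVneq x 0; first by rewrite T0 !nrm0 mulr0.
  have nx := nrm_gt0 x_neq0.
  have h1 := hK i x0; have h2 := hK i (x0 + (r / nrm x)%:C *: x).
  rewrite subrr nrm0 in h1; have {}h1 := h1 (ltW r0).
  have nx' : nrm x != 0 by rewrite gt_eqF.
  have rx0 : 0 <= r / nrm x by rewrite divr_ge0 // ltW.
  rewrite addrAC subrr add0r nrmZr ger0_norm // divfK // in h2.
  have {}h2 := h2 (lexx r).
  have h3 : nrm (T i ((r / nrm x)%:C *: x)) <= 2 * K.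
    have -> : (r / nrm x)%:C *: x = x0 + (r / nrm x)%:C *: x - x0 by rewrite addrAC subrr add0r.
    rewrite TB; apply: (le_trans (nrmB_le _ _)); lra.
  move: h3; rewrite TZ nrmZr ger0_norm // => h3.
  apply: (@le_trans _ _ (2 * K / r * nrm x)); last first.
    by rewrite ler_wpM2r ?nrm_ge0 ?ler_norm.
  rewrite mulrAC ler_pdivlMr // -ler_pdivrMr //; apply: le_trans h3.
  by rewrite le_eqVlt; apply/orP; left; apply/eqP; ring.
have step (p : H * R) (n : nat) : 0 < p.2 -> exists q : H * R,
    [/\ 0 < q.2, q.2 <= p.2 / 2, nrm (q.1 - p.1) + q.2 <= p.2 &
    forall y, nrm (y - q.1) <= q.2 -> exists i, n%:R < nrm (T i y)].
  case: p => x r /= r0.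
  have [i [y [yx yn]]] : exists i y, nrm (y - x) <= r / 2 /\ n%:R < nrm (T i y).
    apply: contrapT => nex; apply: nK; exists (x, r / 2), n%:R; split => /=; first lra.
    move=> i y yx; rewrite leNgt; apply/negP => yn; apply: nex; by exists i, y.
  have [_ _ _ TB _] := linear_facts (lT i).
  have [C hC] := bT i.
  pose C' := `|C| + 1.
  have C'0 : 0 < C' by rewrite /C'; have := normr_ge0 C; lra.
  have hC' z : nrm (T i z) <= C' * nrm z.
    apply: (le_trans (hC z)); rewrite ler_wpM2r ?nrm_ge0 //.
    by rewrite /C'; have := ler_norm C; lra.
  (* Within distance [g] of [y] the value of [T i] moves by at most half of its excess over [n]. *)
  pose g := (nrm (T i y) - n%:R) / 2 / C'.
  have g0 : 0 < g by rewrite !divr_gt0 // subr_gt0.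
  exists (y, Num.min (r / 2) g); split => /=.
  - by rewrite lt_min g0 andbT; lra.
  - by rewrite ge_min lexx.
  - have : Num.min (r / 2) g <= r / 2 by rewrite ge_min lexx.
    lra.
  - move=> z zy; exists i.
    have {}zy : nrm (z - y) <= g by apply: (le_trans zy); rewrite ge_min lexx orbT.
    have h1 : nrm (T i (z - y)) <= (nrm (T i y) - n%:R) / 2.
      apply: (le_trans (hC' _)); rewrite mulrC.
      by apply: (le_trans (ler_wpM2r (ltW C'0) zy)); rewrite /g divfK ?gt_eqF.
    have := nrm_leB (T i y) (T i z); rewrite nrmB -TB; lra.
have [f hf] : exists f : nat -> H * R -> H * R, forall n p, 0 < p.2 ->
    [/\ 0 < (f n p).2, (f n p).2 <= p.2 / 2, nrm ((f n p).1 - p.1) + (f n p).2 <= p.2 &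
    forall y, nrm (y - (f n p).1) <= (f n p).2 -> exists i, n%:R < nrm (T i y)].
  have h np : exists q : H * R, 0 < np.2.2 ->
    [/\ 0 < q.2, q.2 <= np.2.2 / 2, nrm (q.1 - np.2.1) + q.2 <= np.2.2 &
    forall y, nrm (y - q.1) <= q.2 -> exists i, np.1%:R < nrm (T i y)].
    have [/(step _ np.1) [q hq]|p0] := pselect (0 < np.2.2); first by exists q.
    by exists np.2.
  have [f hf] := choice h; exists (fun n p => f (n, p)) => n p.
  exact: hf (n, p).
pose p := fix p n := if n is k.+1 then f k (p k) else (0 : H, 1 : R).
have p0 n : 0 < (p n).2.
  by elim: n => [|n IH] /=; [exact: ltr01 | have [] := hf n (p n) IH].
have dec m n : (n <= m)%N -> nrm ((p m).1 - (p n).1) + (p m).2 <= (p n).2.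
  elim: m => [|m IH].
    by rewrite leqn0 => /eqP ->; rewrite subrr nrm0 add0r.
  rewrite leq_eqVlt => /orP[/eqP ->|nm]; first by rewrite subrr nrm0 add0r.
  have [_ _ h _] := hf m (p m) (p0 m); have {}IH := IH nm.
  have /= := nrm_tri (p m).1 (f m (p m)).1 (p n).1; lra.
have small n : (p n).2 <= n.+1%:R^-1.
  have h : (p n).2 * 2 ^+ n <= 1.
    elim: n => [|n IH]; first by rewrite mulr1.
    have [_ h _ _] := hf n (p n) (p0 n); rewrite exprS mulrA /=.
    by apply: le_trans IH; apply: ler_wpM2r; [exact: exprn_ge0 | lra].
  rewrite -[_^-1]mul1r ler_pdivlMr ?ltr0Sn //; apply: le_trans h.
  by rewrite ler_pM2l // -natrX ler_nat ltn_expl.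
have [m n nm|e e0|l hl] := @nrm_complete R H (fun n => (p n).1) (fun n => (p n).2).
- have := dec m n nm; have := p0 m; lra.
- exists (Num.truncn e^-1); apply: (le_lt_trans (small _)).
  by rewrite invf_plt ?posrE ?ltr0Sn // truncnS_gt.
(* The common point [l] of the balls lies in the one built at stage [(Num.truncn C).+1], where some
   [T i] exceeds that integer and so exceeds [C]. *)
have [C hC] := pT l.
have [_ _ _ h] := hf (Num.truncn C).+1 (p (Num.truncn C).+1) (p0 _).
have [j] := h l (hl (Num.truncn C).+2).
have := hC j; have := truncnS_gt C; lra.
Qed.

End UniformBoundedness.

Section Hilbert.
Variables (R : realType) (H : completeNormedModType R[i]).
Variable dot : {dot H for Num.conj}.
Hypothesis dotE : forall x : H, `|x| ^+ 2 = dot x x.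
Implicit Types (x y z w : H) (a : R[i]).

(** Riesz representation along a linear map [S] on a subspace that need not be closed. A minimizing
    sequence of [J x = |S x|^2 - 2 Re (l x)] has Cauchy images under [S], and their limit [w]
    represents [l]. It is used with [S] the identity and with [S = A - conjc z]. *)
Lemma riesz_subspace (D : set H) (S : H -> H) (l : H -> R[i]) (C : R) :
  D 0 -> linear_op (Operator D S) ->
  (forall a x y, D x -> D y -> l (a *: x + y) = a * l x + l y) ->
  (forall x, D x -> nrm (l x) <= C * nrm (S x)) ->
  exists w, forall x, D x -> l x = dot (S x) w.
Proof.
move=> D0 linS linl bl.
have DP a x y : D x -> D y -> D (a *: x + y) by move=> Dx /(linS a x y Dx)[].
have SP a x y : D x -> D y -> S (a *: x + y) = a *: S x + S y.
  by move=> Dx /(linS a x y Dx)[].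
have reM (t : R) c : complex.Re (t%:C * c) = t * complex.Re c.
  by case: c => c1 c2 /=; rewrite mul0r subr0.
have reD (a b : R[i]) : complex.Re (a + b) = complex.Re a + complex.Re b.
  by case: a => ? ?; case: b.
pose J x := nrm (S x) ^+ 2 - 2 * complex.Re (l x).
pose E := [set J x | x in D].
have J_ge x : D x -> - C ^+ 2 <= J x.
  move=> Dx; rewrite /J; have := bl x Dx; have := nrm_Re (l x).
  have := ler_norm (complex.Re (l x)); have := sqr_ge0 (nrm (S x) - C); lra.
have hE : has_inf E.
  split; first by exists (J 0), 0.
  by exists (- C ^+ 2) => _ [x Dx <-]; exact: J_ge.
pose j := inf E.
have jJ x : D x -> j <= J x by move=> Dx; apply: ge_inf => //; [case: hE | exists x].
pose r n : R := n.+1%:R^-1.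
have r0 n : 0 < r n by rewrite invr_gt0 ltr0Sn.
have rle m n : (n <= m)%N -> r m <= r n.
  by move=> nm; rewrite lef_pV2 ?posrE ?ltr0Sn // ler_nat.
have rsmall e : 0 < e -> exists n, r n < e.
  move=> e0; exists (Num.truncn e^-1).
  by rewrite invf_plt ?posrE ?ltr0Sn // truncnS_gt.
(* By the parallelogram law [|S (u m) - S (u n)|^2 = 2 J (u m) + 2 J (u n) - 4 J p] with [p] the
   midpoint, so the tolerance [r n ^ 2 / 4] yields the Cauchy rate [r n]. *)
have hJ n : exists x, D x /\ J x < j + (r n) ^+ 2 / 4.
  have e0 : 0 < (r n) ^+ 2 / 4 by rewrite divr_gt0 // exprn_gt0.
  by have [_ [x Dx <-] h] := inf_adherent e0 hE; exists x.
have [u hu] := choice hJ.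
have Du n : D (u n) by have [] := hu n.
have Ju n : J (u n) < j + (r n) ^+ 2 / 4 by have [] := hu n.
have [m n nm|//|w hw] := @nrm_complete R H (S \o u) r.
  rewrite /= -(@ler_pXn2r _ 2) ?nnegrE ?nrm_ge0 ?(ltW (r0 _)) //.
  pose p := 2^-1%:C *: (u m) + 2^-1%:C *: (u n).
  have Dh k : D (2^-1%:C *: u k) by rewrite -[_ *: _]addr0; exact: DP.
  have Sh k : S (2^-1%:C *: u k) = 2^-1%:C *: S (u k).
    have S0 : S 0 = 0.
      have := SP 1 0 0 D0 D0; rewrite !scale1r addr0 => /eqP.
      by rewrite eq_sym -subr_eq0 addrK => /eqP.
    by rewrite -[_ *: _]addr0 SP // S0 addr0.
  have Dp : D p by exact: DP.
  have Sp : nrm (S p) ^+ 2 = nrm (S (u m) + S (u n)) ^+ 2 / 4.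
    rewrite /p SP // Sh -scalerDr nrmZr exprMn ger0_norm; last lra.
    by field.
  have lp : complex.Re (l p) = (complex.Re (l (u m)) + complex.Re (l (u n))) / 2.
    have l0 : l 0 = 0.
      have := linl 1 0 0 D0 D0; rewrite scale1r addr0 mul1r => /eqP.
      by rewrite eq_sym -subr_eq0 addrK => /eqP.
    have lh k : complex.Re (l (2^-1%:C *: u k)) = complex.Re (l (u k)) / 2.
      by rewrite -[_ *: _]addr0 linl // l0 addr0 reM; ring.
    by rewrite /p linl // reD lh reM; field.
  have := jJ p Dp; rewrite /J Sp lp; have := Ju m; have := Ju n; rewrite /J.
  have := parallelogram dotE (S (u m)) (S (u n)); have := rle _ _ nm.
  have : r m ^+ 2 <= r n ^+ 2 by rewrite ler_pXn2r ?nnegrE ?(ltW (r0 _)) ?rle.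
  lra.
(* Vanishing of the first variation of [J] in the direction [x]: the quadratic in [t] of [pos] is
   nonnegative for every real [t], so its linear coefficient [2 d] is 0. *)
have key x : D x -> complex.Re (l x) = complex.Re (dot (S x) w).
  move=> Dx; pose d := complex.Re (dot (S x) w) - complex.Re (l x).
  have pos t : 0 <= t ^+ 2 * nrm (S x) ^+ 2 + 2 * t * d.
    apply/ler_addgt0Pl => e e0.
    pose q := 1 + 2 * `|t| * nrm (S x).
    have q0 : 0 < q by rewrite ltr_pwDl // !mulr_ge0 ?nrm_ge0.
    have m0 : 0 < Num.min 1 (e / q) by rewrite lt_min ltr01 divr_gt0.
    have [n] := rsmall _ m0; rewrite lt_min => /andP[rn1 rne].
    have Dt : D (t%:C *: x + u n) by exact: DP.
    have Jt : J (t%:C *: x + u n) = J (u n) + t ^+ 2 * nrm (S x) ^+ 2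
       + 2 * t * (complex.Re (dot (S x) (S (u n))) - complex.Re (l x)).
      rewrite /J SP // (nrmD_sqr dotE) nrmZr exprMn real_normK ?num_real //.
      rewrite linl // reD dotZl.
      by rewrite !reM; ring.
    have h1 := jJ _ Dt; have h2 := Ju n.
    have h4 := le_trans (nrm_Re _) (dot_le dotE (S x) (w - S (u n))).
    have h5 : `|t * complex.Re (dot (S x) (w - S (u n)))| <= `|t| * (nrm (S x) * r n).
      rewrite normrM; apply: ler_wpM2l => //; apply: (le_trans h4).
      by apply: ler_wpM2l; [exact: nrm_ge0 | exact: hw].
    have h6 := ler_norm (- (t * complex.Re (dot (S x) (w - S (u n))))).
    rewrite normrN in h6.
    have h7 : r n * q < e by rewrite -ltr_pdivlMr.
    have h8 : (r n) ^+ 2 <= r n by rewrite expr2 ger_pMl // ltW.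
    have := r0 n; have {}h7 : r n + 2 * (`|t| * (nrm (S x) * r n)) < e.
      by move: h7; rewrite /q; lra.
    move=> rn0.
    rewrite Jt in h1.
    have -> : d = (complex.Re (dot (S x) (S (u n))) - complex.Re (l x)) +
        complex.Re (dot (S x) (w - S (u n))) by rewrite /d; lra.
    lra.
  suff : d = 0 by move/eqP; rewrite subr_eq0 eq_sym => /eqP.
  (* At [t = - d k] the quadratic equals [- d^2 k (1 + k)]; the [+ 1] keeps [k] defined when
     [S x = 0]. *)
  pose k := (nrm (S x) ^+ 2 + 1)^-1.
  have s0 : 0 < nrm (S x) ^+ 2 + 1 by have := sqr_ge0 (nrm (S x)); lra.
  have k0 : 0 < k by rewrite invr_gt0.
  have ks : k * (nrm (S x) ^+ 2 + 1) = 1 by rewrite mulVf // gt_eqF.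
  have h := pos (- (d * k)).
  have {}h : 0 <= - (d ^+ 2 * (k * (1 + k))).
    suff <- : (- (d * k)) ^+ 2 * nrm (S x) ^+ 2 + 2 * - (d * k) * d =
        - (d ^+ 2 * (k * (1 + k))) by [].
    have -> : (- (d * k)) ^+ 2 * nrm (S x) ^+ 2 =
      d ^+ 2 * k * (k * (nrm (S x) ^+ 2 + 1) - k) by ring.
    by rewrite ks; ring.
  have kk : 0 < k * (1 + k) by rewrite mulr_gt0 // ltr_pwDl // ltW.
  have d2 : d ^+ 2 = 0.
    apply/eqP; rewrite eq_le sqr_ge0 andbT -(pmulr_lle0 _ kk) mulrC; lra.
  by apply/eqP; rewrite -sqrf_eq0 d2.
exists w => x Dx; apply/eqP; rewrite eq_complex key //= eqxx /=.
(* The imaginary parts follow from the real ones at ['i%C *: x]. *)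
have Dix : D ('i%C *: x) by rewrite -[_ *: _]addr0; exact: DP.
have l0 : l 0 = 0.
  have := linl 1 0 0 D0 D0; rewrite scale1r addr0 mul1r => /eqP.
  by rewrite eq_sym -subr_eq0 addrK => /eqP.
have S0 : S 0 = 0.
  have := SP 1 0 0 D0 D0; rewrite !scale1r addr0 => /eqP.
  by rewrite eq_sym -subr_eq0 addrK => /eqP.
have := key _ Dix; rewrite -['i%C *: x]addr0 linl // SP // l0 S0 !addr0 dotZl.
by rewrite ![_ * l x]mulrC ![_ * dot _ _]mulrC !ReiNIm => /oppr_inj ->.
Qed.

End Hilbert.

(** * Self-adjoint operators *)

Section BoundedOperators.
Variables (R : realType) (H : completeNormedModType R[i]).
Variable dot : {dot H for Num.conj}.
Hypothesis dotE : forall x : H, `|x| ^+ 2 = dot x x.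
Implicit Types (x y z w : H) (a : R[i]).

Lemma unitary_nrm (W : H -> H) x : unitary dot W -> nrm (W x) = nrm x.
Proof.
move=> [_ h _]; apply/eqP; rewrite -(@eqrXn2 _ 2) ?nrm_ge0 //; apply/eqP.
by apply: complexI; rewrite -!(dotxx dotE) h.
Qed.

Lemma dense_nrm_le_dot (D : set H) x (C : R) : dense D -> 0 <= C ->
  (forall y, D y -> nrm (dot x y) <= C * nrm y) -> nrm x <= C.
Proof.
move=> dD C0 h; apply: (nrm_le_dot dotE) => // y; apply/ler_addgt0Pl => e e0.
have q0 : 0 < nrm x + C + 1 by have := nrm_ge0 x; lra.
have [y' Dy' yy'] := dense_nrm y dD (divr_gt0 e0 q0).
have h1 := h y' Dy'.
have h2 := dot_le dotE x (y - y').
have h3 := nrmD_le (dot x y') (dot x (y - y')).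
rewrite -dotDr addrC subrK in h3.
have h4 : nrm y' <= nrm y + nrm (y - y').
  by rewrite -{1}(subrK y y') addrC (le_trans (nrmD_le _ _)) // (nrmB y').
have h5 : nrm (y - y') * (nrm x + C + 1) < e by rewrite -ltr_pdivlMr.
have := ler_wpM2l C0 h4; have := nrm_ge0 (y - y'); lra.
Qed.

Lemma dense_dot_extl (D : set H) x x' : dense D ->
  (forall y, D y -> dot x y = dot x' y) -> x = x'.
Proof.
move=> dD h; apply: subr0_eq; apply: nrm_eq0.
apply/eqP; rewrite eq_le nrm_ge0 andbT.
apply: (dense_nrm_le_dot dD) => // y Dy.
by rewrite dotBl h // subrr nrm0 mul0r.
Qed.

Lemma dot_extr x y : (forall z, dot z x = dot z y) -> x = y.
Proof. by move=> h; apply: (dot_extl dotE) => z; rewrite dotC h -dotC. Qed.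

(** The functionals [x |-> <T x, y> / |y|], with [y] in [D], are each bounded and are bounded at a
    given [x] by [|T x|], so uniform boundedness applies. This replaces the closed graph theorem for
    products of an unbounded operator with a map into its domain. At [y = 0] the factor is 0 since
    [0^-1 = 0]. *)
Lemma hellinger_toeplitz (D : set H) (T : H -> H) : dense D -> linear T ->
  (forall y, D y -> exists C : R, forall x, nrm (dot (T x) y) <= C * nrm x) ->
  exists2 C : R, 0 <= C & forall x, nrm (T x) <= C * nrm x.
Proof.
move=> dD lT hT.
have [|||C C0 hC] := @uniform_boundedness R H R[i]^o {y | D y}
  (fun (y : {y | D y}) (x : H) => ((nrm (sval y))^-1)%:C * dot (T x) (sval y)).
- move=> [y Dy] a x x' /=; rewrite lT dotDl dotZl mulrDr.
  by congr (_ + _); rewrite mulrCA.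
- move=> [y Dy] /=; have [C hC] := hT y Dy.
  exists ((nrm y)^-1 * C) => x; rewrite nrmM nrm_real ger0_norm ?invr_ge0 ?nrm_ge0 //.
  by rewrite -mulrA ler_wpM2l ?invr_ge0 ?nrm_ge0.
- move=> x; exists (nrm (T x)) => -[y Dy] /=.
  rewrite nrmM nrm_real ger0_norm ?invr_ge0 ?nrm_ge0 //.
  have [->|y0] := eqVneq y 0; first by rewrite nrm0 invr0 mul0r nrm_ge0.
  have ny := nrm_gt0 y0.
  by rewrite mulrC ler_pdivrMr //; exact: dot_le.
exists C => // x; apply: (dense_nrm_le_dot dD); first by rewrite mulr_ge0 ?nrm_ge0.
move=> y Dy; have := hC (exist _ y Dy) x => /=.
rewrite nrmM nrm_real ger0_norm ?invr_ge0 ?nrm_ge0 //.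
have [->|y0] := eqVneq y 0; first by move=> _; rewrite dot0r !nrm0 mulr0.
have ny := nrm_gt0 y0.
by rewrite mulrC ler_pdivrMr.
Qed.

Lemma riesz (l : H -> R[i]) (C : R) :
  (forall a x y, l (a *: x + y) = a * l x + l y) ->
  (forall x, nrm (l x) <= C * nrm x) -> exists w, forall x, l x = dot x w.
Proof.
move=> ll bl; have [//|//|||w hw] := @riesz_subspace R H dot dotE setT id l C.
- by move=> *; exact: ll.
- by move=> *; exact: bl.
by exists w => x; exact: hw.
Qed.

Lemma adjointP (T : H -> H) (C : R) : linear T -> 0 <= C ->
  (forall x, nrm (T x) <= C * nrm x) ->
  exists T', [/\ linear T', forall x y, dot (T x) y = dot x (T' y) &
    forall x, nrm (T' x) <= C * nrm x].
Proof.
move=> lT C0 bT.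
have h y : exists w, forall x, dot (T x) y = dot x w.
  apply: (@riesz _ (C * nrm y)) => [a x x'|x]; first by rewrite lT dotDl dotZl.
  apply: (le_trans (dot_le dotE _ _)).
  by rewrite mulrAC ler_wpM2r ?nrm_ge0.
have [T' hT'] := choice h; exists T'; split => // [a x y|x].
  by apply: dot_extr => z; rewrite dotDr dotZr -!hT' dotDr dotZr.
apply: (nrm_le_dot dotE); first by rewrite mulr_ge0 ?nrm_ge0.
move=> y; rewrite dotC nrm_conj -hT'; apply: (le_trans (dot_le dotE _ _)).
by rewrite mulrAC ler_wpM2r ?nrm_ge0.
Qed.

End BoundedOperators.

Section SelfAdjoint.
Variables (R : realType) (H : completeNormedModType R[i]).
Variable dot : {dot H for Num.conj}.
Hypothesis dotE : forall x : H, `|x| ^+ 2 = dot x x.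
Variable A : operator H.
Hypothesis sA : self_adjoint dot A.
Implicit Types (x y w : H) (z : R[i]).

Lemma sa_dense : dense (dom A). Proof. by case: sA. Qed.
Lemma sa_lin : linear_op A. Proof. by case: sA. Qed.

Lemma sa_dom0 : dom A 0.
Proof.
have [y Dy _] := dense_nrm (0 : H) sa_dense (@ltr01 R).
by have [] := sa_lin (-1) Dy Dy; rewrite scaleN1r addNr.
Qed.

Lemma saP (a : R[i]) x y : dom A x -> dom A y ->
  dom A (a *: x + y) /\ A (a *: x + y) = a *: A x + A y.
Proof. exact: sa_lin. Qed.

Lemma sa0 : A 0 = 0.
Proof.
have [_] := sa_lin 1 sa_dom0 sa_dom0; rewrite !scale1r addr0 => /eqP.
by rewrite eq_sym -subr_eq0 addrK => /eqP.
Qed.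

Lemma saZ (a : R[i]) x : dom A x -> dom A (a *: x) /\ A (a *: x) = a *: A x.
Proof. by move=> Dx; have := sa_lin a Dx sa_dom0; rewrite sa0 !addr0. Qed.

Lemma saD x y : dom A x -> dom A y -> dom A (x + y) /\ A (x + y) = A x + A y.
Proof. by move=> Dx Dy; have := sa_lin 1 Dx Dy; rewrite !scale1r. Qed.

Lemma saB x y : dom A x -> dom A y -> dom A (x - y) /\ A (x - y) = A x - A y.
Proof.
move=> Dx Dy; have [DNy ANy] := saZ (-1) Dy; rewrite !scaleN1r in DNy ANy.
by have := saD Dx DNy; rewrite ANy.
Qed.

Lemma sa_adjP x y : (dom A x /\ y = A x) <->
  (forall w, dom A w -> dot (A w) x = dot w y).
Proof.
case: sA => _ _ /seteqP[h1 h2]; split=> h; first exact: (h2 (x, y)).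
exact: (h1 (x, y)).
Qed.

Lemma sa_sym x y : dom A x -> dom A y -> dot (A x) y = dot x (A y).
Proof. by move=> Dx Dy; apply: (sa_adjP y (A y)).1. Qed.

Lemma sa_max x y : (forall w, dom A w -> dot (A w) x = dot w y) ->
  dom A x /\ A x = y.
Proof. by move=> /sa_adjP[]. Qed.

Lemma sa_real x : dom A x -> complex.Im (dot (A x) x) = 0.
Proof.
move=> Dx; have := dotC dot (A x) x; rewrite -sa_sym //.
case: (dot (A x) x) => b c /= [h]; lra.
Qed.

(** As [<A x, x>] is real, the cross term of the squared norm sees only the real part of [z]. *)
Lemma sa_conj_nrm x z : dom A x ->
  nrm (A x - conjc z *: x) = nrm (A x - z *: x).
Proof.
move=> Dx; apply/eqP; rewrite -(@eqrXn2 _ 2) ?nrm_ge0 //; apply/eqP.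
rewrite !(nrmB_sqr dotE) !nrmZ nrm_conj !dotZr conjcK.
have := sa_real Dx; case: (dot (A x) x) => b c /= ->.
by case: z => d e /=; ring.
Qed.

(** The lower bound passes to [conjc z], so [riesz_subspace] solves [<x, y> = <(A - conjc z) x, w>]
    for all [x] in the domain; self-adjointness then puts [w] in the domain with [(A - z) w = y]. *)
Lemma sa_resolvent_set z (M : R) :
  (forall x, dom A x -> nrm x <= M * nrm (A x - z *: x)) -> resolvent_set A z.
Proof.
move=> hM; split=> [y|]; last first.
  by exists M => x Dx; rewrite !nrmE -rmorphM lecR hM.
have [||| |w hw] := @riesz_subspace R H dot dotE (dom A)
    (fun x => A x - conjc z *: x) (fun x => dot x y) (M * nrm y).
- exact: sa_dom0.
- move=> a u v Du Dv; have [D1 e1] := saP a Du Dv; split=> //=.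
  rewrite e1; apply: (dot_extl dotE) => t; rewrite !dot_lin; ring.
- by move=> a u v _ _; rewrite dotDl dotZl.
- move=> x Dx; apply: (le_trans (dot_le dotE _ _)); rewrite mulrAC.
  by rewrite ler_wpM2r ?nrm_ge0 // sa_conj_nrm // hM.
have [Dw Aw] : dom A w /\ A w = y + z *: w.
  apply: sa_max => x Dx; rewrite dotDr dotZr (hw x Dx) dotBl dotZl; ring.
exists w; split=> [|w' [Dw' Aw']]; first by rewrite Aw addrK.
have [Dd Ad] := saB Dw Dw'.
apply: subr0_eq; apply: nrm_eq0; apply/eqP; rewrite eq_le nrm_ge0 andbT.
apply: (le_trans (hM _ Dd)); rewrite Ad scalerBr.
have -> : A w - A w' - (z *: w - z *: w') = (A w - z *: w) - (A w' - z *: w').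
  by apply: (dot_extl dotE) => t; rewrite !dot_lin; ring.
by rewrite Aw addrK Aw' subrr nrm0 mulr0.
Qed.

Lemma resolvent_set_bound z : resolvent_set A z -> exists2 M : R, 0 <= M &
  forall x, dom A x -> nrm x <= M * nrm (A x - z *: x).
Proof.
move=> [_ [M hM]]; exists `|M| => // x Dx; have := hM x Dx.
rewrite !nrmE -rmorphM lecR => h; apply: (le_trans h).
by rewrite ler_wpM2r ?nrm_ge0 ?ler_norm.
Qed.

Lemma resolvent_set_conj z : resolvent_set A z -> resolvent_set A (conjc z).
Proof.
move=> /resolvent_set_bound[M _ hM]; apply: (@sa_resolvent_set _ M) => x Dx.
by rewrite sa_conj_nrm // hM.
Qed.

Lemma sa_graph_norm x : dom A x ->
  nrm (A x - (- 'i%C) *: x) ^+ 2 = nrm (A x) ^+ 2 + nrm x ^+ 2.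
Proof.
move=> Dx; rewrite (nrmB_sqr dotE) nrmZ nrmN nrm_i mul1r dotZr.
have := sa_real Dx; case: (dot (A x) x) => b c /= ->; ring.
Qed.

Lemma sa_Ni : resolvent_set A (- 'i%C).
Proof.
apply: (@sa_resolvent_set _ 1) => x Dx; rewrite mul1r.
rewrite -(@ler_pXn2r _ 2) ?nnegrE ?nrm_ge0 // sa_graph_norm //.
by rewrite lerDr sqr_ge0.
Qed.

Section Resolvent.
Variable z : R[i].
Hypothesis rz : resolvent_set A z.

Lemma resP y : dom A (resolvent A z y) /\
  A (resolvent A z y) - z *: resolvent A z y = y.
Proof.
rewrite /resolvent; case: xgetP => [x -> //|/= h].
by case: rz => /(_ y)[x [hx _]] _; case: (h x).
Qed.

Lemma res_dom y : dom A (resolvent A z y).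
Proof. by case: (resP y). Qed.

Lemma A_res y : A (resolvent A z y) = y + z *: resolvent A z y.
Proof. by case: (resP y) => _ {2}<-; rewrite subrK. Qed.

Lemma res_uniq x y : dom A x -> A x - z *: x = y -> resolvent A z y = x.
Proof.
move=> Dx hx; case: rz => /(_ y)[x' [_ u]] _.
by rewrite -(u _ (resP y)) -(u x).
Qed.

Lemma res_lin : linear (resolvent A z).
Proof.
move=> a x y; have [D1 e1] := saP a (res_dom x) (res_dom y).
apply: res_uniq => //; rewrite e1 !A_res.
apply: (dot_extl dotE) => t; rewrite !dot_lin; ring.
Qed.

Lemma res_bound (M : R) : (forall x, dom A x -> nrm x <= M * nrm (A x - z *: x)) ->
  forall y, nrm (resolvent A z y) <= M * nrm y.
Proof. by move=> h y; have := h _ (res_dom y); case: (resP y) => _ ->. Qed.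

Lemma res_A x : dom A x -> resolvent A z (A x) = x + z *: resolvent A z x.
Proof.
move=> Dx; have [Dzx ezx] := saZ z (res_dom x); have [D1 e1] := saD Dx Dzx.
apply: res_uniq => //; rewrite e1 ezx A_res.
apply: (dot_extl dotE) => t; rewrite !dot_lin; ring.
Qed.

End Resolvent.

Lemma res_adj z x y : resolvent_set A z ->
  dot (resolvent A z x) y = dot x (resolvent A (conjc z) y).
Proof.
move=> rz; have rz' := resolvent_set_conj rz.
have [_ {2}<-] := resP rz x; have [_ {1}<-] := resP rz' y.
rewrite !dot_lin (sa_sym (res_dom rz x) (res_dom rz' y)) conjcK; ring.
Qed.

Lemma res_identity z z' x : resolvent_set A z -> resolvent_set A z' ->
  resolvent A z x - resolvent A z' x =
  (z - z') *: resolvent A z (resolvent A z' x).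
Proof.
move=> rz rz'; have [_ _ _ B Z] := linear_facts (res_lin rz).
have {1}-> : resolvent A z x = resolvent A z (A (resolvent A z' x)) -
    z' *: resolvent A z (resolvent A z' x).
  by rewrite -Z -B; congr resolvent; case: (resP rz' x).
rewrite (res_A rz (res_dom rz' x)).
apply: (dot_extl dotE) => t; rewrite !dot_lin; ring.
Qed.

Lemma res_comm z z' x : resolvent_set A z -> resolvent_set A z' ->
  resolvent A z (resolvent A z' x) = resolvent A z' (resolvent A z x).
Proof.
move=> rz rz'; have [->//|zz'] := eqVneq z z'.
have h1 := res_identity x rz rz'; have h2 := res_identity x rz' rz.
have : (z - z') *: resolvent A z (resolvent A z' x) =
       (z - z') *: resolvent A z' (resolvent A z x).
  by rewrite -h1 -[z - z']opprB scaleNr -h2 opprB.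
move=> /eqP; rewrite -subr_eq0 -scalerBr scaler_eq0 subr_eq0 (negbTE zz') /=.
by rewrite subr_eq0 => /eqP.
Qed.

End SelfAdjoint.

(** * Contour integrals *)

Section ScalarIntegral.
Variable R : realType.
Implicit Types (g h : R -> R[i]) (c : R[i]).

(* An inductive wrapper: unfolding this predicate makes failing unifications very slow. *)
Variant cont01 g : Prop :=
  Cont01 of {within I01, continuous (g : R -> R[i]^o)}.

Lemma cont01P g : cont01 g <-> forall t e : R, I01 t -> 0 < e ->
  exists2 d : R, 0 < d & forall s, I01 s -> `|s - t| < d -> nrm (g s - g t) < e.
Proof.
have e := @continuous_I01P R R[i]^o g; split; first by case=> /e.
by move=> /e h; split.
Qed.

Lemma cont01E g : cont01 g <-> {within I01, continuous (g : R -> R[i]^o)}.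
Proof. by split=> [[]|]. Qed.


Lemma cont01_lip (V : normedModType R[i]) (f : R -> V) g (C : R) : 0 <= C ->
  cont01 g ->
  (forall s t, I01 s -> I01 t -> nrm (f s - f t) <= C * nrm (g s - g t)) ->
  {within I01, continuous f}.
Proof.
move=> C0 /cont01P cg h; apply/continuous_I01P => t e It e0.
have C1 : 0 < C + 1 by lra.
have [d d0 hd] := cg t (e / (C + 1)) It (divr_gt0 e0 C1).
exists d => // s Is sd; apply: (le_lt_trans (h s t Is It)).
have := hd s Is sd; rewrite ltr_pdivlMr // => h1.
by apply: le_lt_trans h1; rewrite mulrC ler_wpM2l ?nrm_ge0 // lerDl.
Qed.

Lemma cont01_cst c : cont01 (fun=> c).
Proof. by split; apply: continuous_subspaceT => x; exact: cvg_cst. Qed.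

Lemma cont01M g h : cont01 g -> cont01 h -> cont01 (fun s => g s * h s).
Proof.
move=> /cont01E/subspace_continuousP cg /cont01E/subspace_continuousP ch.
apply/cont01E/subspace_continuousP => t It; exact: cvgM (cg t It) (ch t It).
Qed.

Lemma cont01D g h : cont01 g -> cont01 h -> cont01 (fun s => g s + h s).
Proof.
move=> /cont01E/subspace_continuousP cg /cont01E/subspace_continuousP ch.
apply/cont01E/subspace_continuousP => t It; exact: cvgD (cg t It) (ch t It).
Qed.

Lemma cont01_ext g h : (forall s, I01 s -> g s = h s) -> cont01 g -> cont01 h.
Proof.
move=> gh cg; apply/cont01E; apply: (@cont01_lip _ _ g 1) => // s t Is It.
by rewrite -!gh // mul1r.
Qed.

Lemma cont01V g : cont01 g -> (forall s, I01 s -> g s != 0) ->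
  cont01 (fun s => (g s)^-1).
Proof.
move=> /cont01E/subspace_continuousP cg g0.
apply/cont01E/subspace_continuousP => t It; apply: cvgV; [exact: g0 | exact: cg].
Qed.

Lemma cont01_bounded g : cont01 g -> exists2 G : R, 0 <= G &
  forall s, I01 s -> nrm (g s) <= G.
Proof. by move=> /cont01E; exact: (@continuous_I01_bounded R R[i]^o). Qed.

Let mI01 : measurable (@I01 R : set (measurableTypeR R)).
Proof. exact: measurable_itv. Qed.

Lemma cont01_integrable (f : R -> R) g : cont01 g ->
  (forall s t, `|f s - f t| <= nrm (g s - g t)) ->
  lebesgue_measure.-integrable (@I01 R) (EFin \o f).
Proof.
move=> /cont01P cg h; apply: continuous_compact_integrable.
  exact: segment_compact.
apply/subspace_continuousP => t It; apply/cvgrPdist_lt => e e0.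
have [d d0 hd] := cg t e It e0.
apply/nbhs_normP; exists d => //= s; rewrite /ball_ /= => ts Is.
apply: (le_lt_trans (h t s)); rewrite nrmB; apply: hd => //.
by rewrite distrC.
Qed.

Let ReB (a b : R[i]) : complex.Re (a - b) = complex.Re a - complex.Re b.
Proof. by case: a => ? ?; case: b. Qed.
Let ImB (a b : R[i]) : complex.Im (a - b) = complex.Im a - complex.Im b.
Proof. by case: a => ? ?; case: b. Qed.

Let iRe g : cont01 g ->
  lebesgue_measure.-integrable (@I01 R) (EFin \o (fun s => complex.Re (g s))).
Proof. by move=> cg; apply: (cont01_integrable cg) => s t; rewrite -ReB nrm_Re. Qed.

Let iIm g : cont01 g ->
  lebesgue_measure.-integrable (@I01 R) (EFin \o (fun s => complex.Im (g s))).
Proof. by move=> cg; apply: (cont01_integrable cg) => s t; rewrite -ImB nrm_Im. Qed.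

Lemma eq_cint01 g h : (forall s, I01 s -> g s = h s) -> cint01 g = cint01 h.
Proof.
by move=> gh; rewrite /cint01; congr (_ +i* _); apply: eq_Rintegral => s;
  rewrite inE => /gh ->.
Qed.

Lemma cint01D g h : cont01 g -> cont01 h ->
  cint01 (fun s => g s + h s) = cint01 g + cint01 h.
Proof.
move=> cg ch; rewrite /cint01 /=; apply/eqP; rewrite eq_complex /=.
rewrite -RintegralD ?iRe // -RintegralD ?iIm //.
apply/andP; split; apply/eqP; apply: eq_Rintegral => s _;
  by case: (g s) => ? ?; case: (h s).
Qed.

Lemma cint01Z c g : cont01 g -> cint01 (fun s => c * g s) = c * cint01 g.
Proof.
move=> cg; have ci r : cont01 (fun s => r%:C * g s) by apply: cont01M => //; exact: cont01_cst.
case: c => a b; rewrite /cint01 /=; apply/eqP; rewrite eq_complex /=.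
have i1 r : lebesgue_measure.-integrable (@I01 R)
    (EFin \o (fun s => r * complex.Re (g s))).
  apply: eq_integrable (iRe (ci r)) => // s _ /=.
  by case: (g s) => u v /=; rewrite mul0r subr0.
have i2 r : lebesgue_measure.-integrable (@I01 R)
    (EFin \o (fun s => r * complex.Im (g s))).
  apply: eq_integrable (iIm (ci r)) => // s _ /=.
  by case: (g s) => u v /=; rewrite mul0r addr0.
rewrite -!RintegralZl ?iRe ?iIm // -RintegralB // -RintegralD //.
apply/andP; split; apply/eqP; apply: eq_Rintegral => s _; by case: (g s).
Qed.

(** The factor 2 comes from estimating real and imaginary parts separately. *)
Lemma cint01_le g (M : R) : cont01 g -> (forall s, I01 s -> nrm (g s) <= M) ->
  nrm (cint01 g) <= 2 * M.
Proof.
move=> cg gM; apply: (le_trans (nrm_le_ReIm _)); rewrite mulrDl mul1r.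
have bnd (f : R -> R) : lebesgue_measure.-integrable (@I01 R) (EFin \o f) ->
    (forall s, `|f s| <= nrm (g s)) ->
    `|\int[lebesgue_measure]_(s in I01) f s| <= M.
  move=> fi fg; apply: (le_trans (le_normr_Rintegral mI01 fi)).
  have iM : lebesgue_measure.-integrable (@I01 R) (EFin \o (fun _ : R => M)).
    apply: (@cont01_integrable (fun=> M) (fun=> 0) (@cont01_cst 0)) => s t.
    by rewrite !subrr normr0 nrm0.
  have m1 : lebesgue_measure (@I01 R) = 1%E.
    by rewrite /I01 lebesgue_measure_itv /= lte_fin ltr01 oppr0 addr0.
  have -> : M = \int[lebesgue_measure]_(s in @I01 R) (fun=> M) s.
    rewrite Rintegral_cst // -[LHS]mulr1; congr (_ * _).
    by rewrite -[LHS]/(fine 1%E); congr fine; exact: esym m1.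
  apply: le_Rintegral => // [|s Is]; last by apply: (le_trans (fg s)); exact: gM.
  exact: integrable_norm.
by apply: lerD; apply: bnd => [|s]; [exact: iRe|exact: nrm_Re|exact: iIm|exact: nrm_Im].
Qed.

End ScalarIntegral.

Section PettisIntegral.
Variables (R : realType) (H : completeNormedModType R[i]).
Variable dot : {dot H for Num.conj}.
Hypothesis dotE : forall x : H, `|x| ^+ 2 = dot x x.

(** The choice made by [int01] is not vacuous, by Riesz; the functional is conjugated because [dot]
    is antilinear in its second argument. *)
Lemma int01P (f : R -> H) (M : R) :
  (forall y, cont01 (fun s => dot (f s) y)) ->
  (forall s, I01 s -> nrm (f s) <= M) ->
  forall y, dot (int01 dot f) y = cint01 (fun s => dot (f s) y).
Proof.
move=> cf fM; rewrite /int01; case: xgetP => [v -> //|/= h].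
have [||w hw] := @riesz R H dot dotE
    (fun y => conjc (cint01 (fun s => dot (f s) y))) (2 * M).
- move=> a x y; rewrite -[a in a * _]conjcK -conjcM -conjcD -cint01Z //.
  rewrite -cint01D //; last by apply: cont01M => //; exact: cont01_cst.
  by congr conjc; apply: eq_cint01 => s _; rewrite dotDr dotZr.
- move=> y; rewrite nrm_conj -mulrA; apply: cint01_le => // s Is.
  apply: (le_trans (dot_le dotE _ _)); by rewrite ler_wpM2r ?nrm_ge0 ?fM.
by have := h w; case => y; rewrite dotC -hw conjcK.
Qed.

End PettisIntegral.

Section Contour.
Variables (R : realType) (gamma : R -> R[i]).
Hypothesis gamma_closed : closed_path gamma.

Lemma cont01_C1 (V : normedModType R[i]) (f : R -> V) :
  Ck01 1 f -> {within I01, continuous f}.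
Proof.
move=> /C1_lip[M M0 hM]; apply/continuous_I01P => t e It e0.
have M1 : 0 < M + 1 by lra.
exists (e / (M + 1)); first exact: divr_gt0.
move=> s Is; rewrite ltr_pdivlMr // => h; apply: (le_lt_trans (hM s t Is It)).
by apply: le_lt_trans h; rewrite mulrC ler_wpM2l // lerDl.
Qed.

Lemma cont01_path : cont01 gamma.
Proof. by apply/cont01E; apply: cont01_C1; case: gamma_closed. Qed.

Lemma cont01_velocity : cont01 (velocity gamma).
Proof.
case: gamma_closed => -[g dg cg] _.
apply: (@cont01_ext _ g) => [s Is|]; last exact/cont01E.
by rewrite /velocity (deriv01E Is (dg s Is)).
Qed.

Lemma velocity_bound : exists2 G : R, 0 <= G &
  forall s, I01 s -> nrm (velocity gamma s) <= G.
Proof. exact: cont01_bounded cont01_velocity. Qed.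

(** Scalar counterpart of [P0] with the same normalization, sign included; hence the minus sign in
    [winding_contour]. *)
Definition contour (h : R -> R[i]) : R[i] :=
  - (two_pi_i R)^-1 * cint01 (fun s => velocity gamma s * h s).

Implicit Types h : R -> R[i].

Lemma eq_contour h1 h2 : (forall s, I01 s -> h1 s = h2 s) ->
  contour h1 = contour h2.
Proof. by move=> e; congr (_ * _); apply: eq_cint01 => s Is; rewrite e. Qed.

Lemma contourD h1 h2 : cont01 h1 -> cont01 h2 ->
  contour (fun s => h1 s + h2 s) = contour h1 + contour h2.
Proof.
move=> c1 c2; rewrite /contour -mulrDr -cint01D.
- by congr (_ * _); apply: eq_cint01 => s _; rewrite mulrDr.
- exact: cont01M cont01_velocity c1.
- exact: cont01M cont01_velocity c2.
Qed.

Lemma contourZ c h : cont01 h -> contour (fun s => c * h s) = c * contour h.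
Proof.
move=> c1; rewrite /contour [RHS]mulrCA -[in RHS]cint01Z.
  by congr (_ * _); apply: eq_cint01 => s _; rewrite mulrCA.
exact: cont01M cont01_velocity c1.
Qed.

Lemma contourB h1 h2 : cont01 h1 -> cont01 h2 ->
  contour (fun s => h1 s - h2 s) = contour h1 - contour h2.
Proof.
move=> c1 c2; rewrite -mulN1r -contourZ // -contourD //; last first.
  by apply: cont01M => //; exact: cont01_cst.
by apply: eq_contour => s _; rewrite mulN1r.
Qed.

Lemma contour_le : exists2 K : R, 0 <= K & forall h (M : R), cont01 h ->
  (forall s, I01 s -> nrm (h s) <= M) -> nrm (contour h) <= K * M.
Proof.
have [G G0 hG] := velocity_bound.
exists (nrm ((two_pi_i R)^-1) * (2 * G)) => [|h M ch hM].
  by rewrite !mulr_ge0 ?nrm_ge0.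
rewrite nrmM nrmN -mulrA ler_wpM2l ?nrm_ge0 // -mulrA; apply: cint01_le.
  exact: cont01M cont01_velocity ch.
by move=> s Is; rewrite nrmM ler_pM ?nrm_ge0 ?hG ?hM.
Qed.

Variables (H : completeNormedModType R[i]) (dot : {dot H for Num.conj}).
Hypothesis dotE : forall x : H, `|x| ^+ 2 = dot x x.

Definition contour_vec (f : R -> H) : H :=
  - (two_pi_i R)^-1 *: int01 dot (fun s => velocity gamma s *: f s).

Lemma contour_vecP (f : R -> H) (M : R) :
  (forall y, cont01 (fun s => dot (f s) y)) ->
  (forall s, I01 s -> nrm (f s) <= M) ->
  forall y, dot (contour_vec f) y = contour (fun s => dot (f s) y).
Proof.
move=> cf fM y; have [G G0 hG] := velocity_bound.
have c z : cont01 (fun s => dot (velocity gamma s *: f s) z).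
  apply: (@cont01_ext _ (fun s => velocity gamma s * dot (f s) z)).
    by move=> s _; rewrite dotZl.
  exact: cont01M cont01_velocity (cf z).
rewrite /contour_vec dotZl (int01P dotE (M := G * M) c) => [|s Is].
  by congr (_ * _); apply: eq_cint01 => s _; rewrite dotZl.
by rewrite nrmZ ler_pM ?nrm_ge0 ?hG ?fM.
Qed.

Lemma cont01_dot (f : R -> H) y : {within I01, continuous f} ->
  cont01 (fun s => dot (f s) y).
Proof.
move=> /continuous_I01P cf; apply/cont01P => t e It e0.
have n1 : 0 < nrm y + 1 by have := nrm_ge0 y; lra.
have [d d0 hd] := cf t (e / (nrm y + 1)) It (divr_gt0 e0 n1); exists d => // s Is sd.
have := hd s Is sd; rewrite ltr_pdivlMr // => h1; apply: le_lt_trans h1.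
have -> : dot (f s) y - dot (f t) y = dot (f s - f t) y by rewrite dotBl.
by apply: (le_trans (dot_le dotE _ _)); rewrite ler_wpM2l ?nrm_ge0 // lerDl.
Qed.

Lemma cont01_dot_lip (f : R -> H) (C : R) : 0 <= C ->
  (forall s t, I01 s -> I01 t -> nrm (f s - f t) <= C * nrm (gamma s - gamma t)) ->
  forall y, cont01 (fun s => dot (f s) y).
Proof.
by move=> C0 hf y; apply: cont01_dot; exact: cont01_lip C0 cont01_path hf.
Qed.

Lemma winding_contour (z : R[i]) :
  contour (fun s => (gamma s - z)^-1) = - winding gamma z.
Proof. by rewrite /contour /winding mulNr. Qed.

End Contour.

(** * Spectral vanishing *)

Section SpectralVanishing.
Variables (R : realType) (H : completeNormedModType R[i]).
Variable dot : {dot H for Num.conj}.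
Hypothesis dotE : forall x : H, `|x| ^+ 2 = dot x x.
Implicit Types (x y : H).

(* If [T] is dominated by every [1 - w U], then, with [nu ^ 2 = w], applying the bound
   for [nu] and [- nu] to [(1 + nu U) x] and [(1 - nu U) x] dominates [T] by [1 - w U^2]
   with a squared constant halved; iterate. *)
Lemma doubling_bound (T U : H -> H) (Q : R) (k : nat) :
  linear T -> linear U -> (forall x, nrm (U x) = nrm x) ->
  (forall x, T (U x) = U (T x)) -> 0 <= Q ->
  (forall (w : R[i]) x, nrm w = 1 ->
     nrm (T x) ^+ 2 <= Q * nrm (x - w *: U x) ^+ 2) ->
  forall x, nrm (T x) ^+ 2 * 2 ^+ k <= 4 * Q * nrm x ^+ 2.
Proof.
move=> lT; elim: k U Q => [|k IH] U Q lU isoU TU Q0 h x.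
  rewrite mulr1; apply: (le_trans (h 1 x (nrm1 _))); rewrite scale1r.
  have := nrmB_le x (U x); rewrite isoU.
  rewrite -(@ler_pXn2r _ 2) ?nnegrE ?addr_ge0 ?nrm_ge0 // => h1.
  rewrite [4 * Q]mulrC -mulrA; apply: ler_wpM2l => //; lra.
have [_ UD UN UB UZ] := linear_facts lU.
have [_ TD TN TB TZ] := linear_facts lT.
suff : nrm (T x) ^+ 2 * 2 ^+ k <= 4 * (Q / 2) * nrm x ^+ 2.
  by rewrite [2 ^+ k.+1]exprS; move: (2 ^+ k) => p; lra.
apply: (IH (U \o U)) => {x} [a x y|x|x||w x w1] /=.
- by rewrite !lU.
- by rewrite !isoU.
- by rewrite !TU.
- lra.
pose nu := sqrtC w.
have nu2 : nu * nu = w by rewrite -expr2 sqrtCK.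
have nu1 : nrm nu = 1.
  by apply/eqP; rewrite -(@eqrXn2 _ 2) ?nrm_ge0 // expr2 -nrmM nu2 w1 expr1n.
have h1 := h nu (x + nu *: U x) nu1.
have h2 := h (- nu) (x - nu *: U x); rewrite nrmN in h2; have {}h2 := h2 nu1.
have e1 : x + nu *: U x - nu *: U (x + nu *: U x) = x - w *: U (U x).
  rewrite UD UZ -nu2; apply: (dot_extl dotE) => t; rewrite !dot_lin; ring.
have e2 : x - nu *: U x - (- nu) *: U (x - nu *: U x) = x - w *: U (U x).
  rewrite UB UZ -nu2; apply: (dot_extl dotE) => t; rewrite !dot_lin; ring.
rewrite e1 TD TZ TU in h1; rewrite e2 TB TZ TU in h2.
have := parallelogram dotE (T x) (nu *: U (T x)).
rewrite nrmZ nu1 mul1r isoU; lra.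
Qed.

(** If [T x] were nonzero, [doubling_bound] would bound all the powers [2 ^ k] by [q]. *)
Lemma doubling_vanish (T U : H -> H) (C : R) :
  linear T -> linear U -> (forall x, nrm (U x) = nrm x) ->
  (forall x, T (U x) = U (T x)) -> 0 <= C ->
  (forall (w : R[i]) x, nrm w = 1 -> nrm (T x) <= C * nrm (x - w *: U x)) ->
  forall x, T x = 0.
Proof.
move=> lT lU isoU TU C0 h x; apply: nrm_eq0.
have hk k : nrm (T x) ^+ 2 * 2 ^+ k <= 4 * C ^+ 2 * nrm x ^+ 2.
  apply: (doubling_bound k lT lU) => //; first exact: sqr_ge0.
  move=> w y w1; rewrite -exprMn; have := h w y w1.
  by rewrite ler_pXn2r ?nnegrE ?mulr_ge0 ?nrm_ge0.
apply/eqP; rewrite -[_ == 0](@sqrf_eq0 R) eq_le sqr_ge0 andbT leNgt.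
apply/negP => p0.
pose q := 4 * C ^+ 2 * nrm x ^+ 2 / nrm (T x) ^+ 2.
have hq k : 2 ^+ k <= q by rewrite /q ler_pdivlMr // mulrC.
have h1 : (Num.truncn q).+1%:R < 2 ^+ (Num.truncn q).+1 :> R.
  by rewrite -natrX ltr_nat ltn_expl.
have := lt_trans (truncnS_gt q) (lt_le_trans h1 (hq _)).
by rewrite ltxx.
Qed.

Variable A : operator H.
Hypothesis sA : self_adjoint dot A.

Let J := resolvent A (- 'i%C).

(* [doubling_vanish] for the Cayley transform [(A - i)(A + i)^-1]. *)
Lemma cayley_vanish (T : H -> H) (C CT : R) : linear T ->
  (forall x, nrm (T x) <= CT * nrm x) -> 0 <= CT -> 0 <= C ->
  (forall x, T (J x) = J (T x)) ->
  (forall (mu : R) y, dom A y -> nrm (T y) <= C * nrm (A y - mu%:C *: y)) ->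
  forall x, T x = 0.
Proof.
move=> lT bT CT0 C0 TJ h.
have rJ := sa_Ni dotE sA; have lJ : linear J := res_lin dotE sA rJ.
have [J0 JD JN JB JZ] := linear_facts lJ.
have [T0 TD TN TB TZ] := linear_facts lT.
have J1 x : nrm (J x) <= nrm x.
  rewrite -[leRHS]mul1r; apply: (res_bound rJ) => y Dy.
  rewrite mul1r -(@ler_pXn2r _ 2) ?nnegrE ?nrm_ge0 // (sa_graph_norm dotE sA) //.
  by rewrite lerDr sqr_ge0.
pose U x := x - (2 * 'i%C) *: J x.
have xJ x : A (J x) + 'i%C *: J x = x.
  by have [_] := resP rJ x; rewrite scaleNr opprK.
have UJ x : U x = A (J x) - 'i%C *: J x.
  rewrite /U -{1}(xJ x); apply: (dot_extl dotE) => t; rewrite !dot_lin; ring.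
(* One factor [J] brings [x] into the domain; the other makes up for the real point [m], which goes
   to infinity as [w] tends to 1. *)
have hT2 : forall x, T (J (J x)) = 0.
  apply: (@doubling_vanish (fun x => T (J (J x))) U (C + CT)) => //.
  - by move=> a x y; rewrite !lJ lT.
  - move=> a x y; rewrite /U lJ; apply: (dot_extl dotE) => t; rewrite !dot_lin; ring.
  - move=> x; rewrite UJ -[in RHS](xJ x).
    have := sa_conj_nrm dotE sA (- 'i%C) (res_dom rJ x).
    by rewrite conjcNi => ->; rewrite scaleNr opprK.
  - by move=> x; rewrite /U !JB !JZ TB TZ !TJ.
  - by rewrite addr_ge0.
  move=> w x w1; set y := J x.
  have Dy : dom A y := res_dom rJ x.
  have e : x - w *: U x = (1 - w) *: A y + ('i%C * (1 + w)) *: y.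
    rewrite UJ -{1}(xJ x) -/y; apply: (dot_extl dotE) => t; rewrite !dot_lin; ring.
  have [w_eq1|w_neq1] := eqVneq w 1.
    rewrite e w_eq1 subrr scale0r add0r nrmZ nrmM nrm_i mul1r.
    have -> : nrm (1 + 1 : R[i]) = 2.
      by rewrite -[1 + 1]/(2%:R) -(rmorph_nat (real_complex R)) nrm_real ger0_norm.
    apply: (le_trans (bT _)); have := J1 y; have := nrm_ge0 y; have := nrm_ge0 (J y); nra.
  have w0 : 1 - w != 0 by rewrite subr_eq0 eq_sym.
  (* The inverse Cayley transform of [w], real because [|w| = 1]. It satisfies
     [|m + i| |1 - w| = 2], which makes the final constant independent of [w]. *)
  pose m := - 'i%C * (1 + w) / (1 - w).
  have mR : m = (complex.Re m)%:C.
    have ww : conjc w = w^-1.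
      have w00 : w != 0 by apply/eqP => w0'; move: w1; rewrite w0' nrm0; lra.
      apply: (mulIf w00); rewrite mulVf // mulrC -sqr_normc nrmE w1.
      by rewrite rmorph1 expr1n.
    suff : conjc m = m.
      by case: (m) => a b [] hb; congr (_ +i* _); lra.
    have w00 : w != 0 by apply/eqP => w0'; move: w1; rewrite w0' nrm0; lra.
    rewrite /m conjcM conjcM conjc_inv conjcB conjcD conjcNi ww conjc1.
    have w2 : w - 1 != 0 by rewrite subr_eq0.
    field.
    by rewrite w00 w0 w2.
  have e2 : x - w *: U x = (1 - w) *: (A y - m *: y).
    rewrite e scalerBr scalerA /m mulrCA divff // mulr1.
    apply: (dot_extl dotE) => t; rewrite !dot_lin; ring.
  have hm := h (complex.Re m) y Dy; rewrite -mR in hm.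
  have e3 : (m + 'i%C) *: T (J y) = T y - T (J (A y - m *: y)).
    rewrite JB JZ /J (res_A dotE sA rJ) // -/J TB TD !TZ.
    apply: (dot_extl dotE) => t; rewrite !dot_lin; ring.
  have e4 : (m + 'i%C) * (1 - w) = - (2 * 'i%C * w).
    by rewrite /m mulrDl divfK //; ring.
  have n2 : nrm (m + 'i%C) * nrm (1 - w) = 2.
    rewrite -nrmM e4 nrmN !nrmM w1 nrm_i !mulr1.
    by rewrite -(rmorph_nat (real_complex R)) nrm_real ger0_norm.
  have h5 : nrm (m + 'i%C) * nrm (T (J y)) <= (C + CT) * nrm (A y - m *: y).
    rewrite -nrmZ e3; apply: (le_trans (nrmB_le _ _)); rewrite mulrDl; apply: lerD => //.
    by apply: (le_trans (bT _)); rewrite ler_wpM2l.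
  rewrite e2 nrmZ; have := ler_wpM2r (nrm_ge0 (1 - w)) h5.
  have -> : nrm (m + 'i%C) * nrm (T (J y)) * nrm (1 - w) = 2 * nrm (T (J y)).
    by rewrite -n2; ring.
  rewrite [nrm (1 - w) * _]mulrC mulrA; apply: le_trans.
  by rewrite ler_peMl ?nrm_ge0 // ler1n.
(* [T] commutes with [J], so applying [A + i] twice to [J (J (T x)) = 0] removes both factors. *)
move=> x; have := hT2 x; rewrite !TJ => /(congr1 (fun z => A z + 'i%C *: z)).
rewrite xJ (sa0 sA) scaler0 addr0 => /(congr1 (fun z => A z + 'i%C *: z)).
by rewrite xJ (sa0 sA) scaler0 addr0.
Qed.

(** [a] is the inverse norm of [B = (A - mu)^-1]. If [mu + a] and [mu - a] were both regular, [B^2]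
    would be controlled by [1 - a^2 B^2] (this is [key]), while a vector that nearly attains the
    norm of [B] makes [1 - a^2 B^2] small. *)
Lemma nearest_spectrum (mu : R) : (exists x : H, x != 0) ->
  resolvent_set A mu%:C -> exists a : R,
    [/\ 0 < a, forall y, dom A y -> a * nrm y <= nrm (A y - mu%:C *: y) &
    ~ resolvent_set A (mu + a)%:C \/ ~ resolvent_set A (mu - a)%:C].
Proof.
move=> [x0 x0_neq0] rmu; pose B := resolvent A mu%:C.
have lB : linear B := res_lin dotE sA rmu.
have [B0 BD BN BB BZ] := linear_facts lB.
have [M M0 hM] := resolvent_set_bound rmu.
have bB x : nrm (B x) <= M * nrm x := res_bound rmu hM x.
have symB x y : dot (B x) y = dot x (B y).
  by rewrite (res_adj dotE sA) // conjc_real.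
pose E := [set nrm (B u) | u in [set u : H | nrm u <= 1]].
have hE : has_sup E.
  split; first by exists (nrm (B 0)), 0 => //=; rewrite nrm0 ler01.
  exists M => _ [u /= u1 <-]; apply: (le_trans (bB u)).
  by rewrite -[leRHS]mulr1 ler_wpM2l.
pose b := sup E.
have Bb u : nrm (B u) <= b * nrm u.
  have [->|u0] := eqVneq u 0; first by rewrite B0 !nrm0 mulr0.
  have nu := nrm_gt0 u0.
  rewrite -ler_pdivrMr //; apply: ub_le_sup; first by case: hE.
  exists ((nrm u)^-1%:C *: u) => /=.
    by rewrite nrmZr ger0_norm ?invr_ge0 ?nrm_ge0 // mulVf // gt_eqF.
  by rewrite BZ nrmZr ger0_norm ?invr_ge0 ?nrm_ge0 // mulrC.
have b0 : 0 < b.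
  rewrite ltNge; apply/negP => b0; move/eqP: x0_neq0; apply.
  have : nrm (B x0) <= 0.
    by apply: (le_trans (Bb x0)); rewrite mulr_le0_ge0 ?nrm_ge0.
  rewrite le_eqVlt ltNge nrm_ge0 orbF => /eqP/nrm_eq0 Bx0.
  by have [_] := resP rmu x0; rewrite -/B Bx0 (sa0 sA) scaler0 subrr.
pose a := b^-1; have a0 : 0 < a by rewrite invr_gt0.
have ab : a * b = 1 by rewrite mulVf // gt_eqF.
have aB u : a * nrm (B u) <= nrm u.
  by rewrite -[leRHS]mul1r -ab -mulrA ler_pM2l.
exists a; split => // [y Dy|].
  have e : B (A y - mu%:C *: y) = y by exact: res_uniq.
  by rewrite -{1}e; exact: aB.
apply/not_andP => -[r1 r2].
have [M1 M10 h1] := resolvent_set_bound r1.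
have [M2 M20 h2] := resolvent_set_bound r2.
have DB u : dom A (B u) := res_dom rmu u.
have AB u : A (B u) = u + mu%:C *: B u := A_res rmu u.
have key u : nrm (B (B u)) <= M1 * M2 * nrm (u - (a ^+ 2)%:C *: B (B u)).
  apply: (le_trans (h1 _ (DB (B u)))); rewrite -mulrA ler_wpM2l //.
  have [Dz Az] := saZ sA a%:C (DB (B u)).
  have [Dv Av] := saB sA (DB u) Dz.
  have -> : A (B (B u)) - (mu + a)%:C *: B (B u) = B u - a%:C *: B (B u).
    by rewrite AB rmorphD /= scalerDl opprD addrA addrK.
  apply: (le_trans (h2 _ Dv)); rewrite ler_wpM2l // Av Az !AB.
  rewrite le_eqVlt; apply/orP; left; apply/eqP; congr nrm.
  apply: (dot_extl dotE) => t; rewrite !dot_lin rmorphB rmorphXn /=; ring.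
(* For the chosen [u], [1 - s^2 / 2 < a |B u| <= |u| <= |w| + a^2 |B (B u)| <= s + N s = 1 - s],
   which is impossible since [s <= 1 / 2]. *)
pose N := a ^+ 2 * (M1 * M2).
have N0 : 0 <= N by rewrite mulr_ge0 ?sqr_ge0 // mulr_ge0.
pose s := (N + 2)^-1.
have N2 : 0 < N + 2 by lra.
have s0 : 0 < s by rewrite invr_gt0.
have sN : s * (N + 2) = 1 by rewrite mulVf // gt_eqF.
have s1 : s <= 1 / 2 by rewrite div1r lef_pV2 ?posrE //; lra.
have e0 : 0 < b * (s ^+ 2 / 2).
  by rewrite mulr_gt0 // divr_gt0 // exprn_gt0.
have [_ [u /= u1 <-]] := sup_adherent e0 hE; rewrite -/b => hu.
have {}hu : 1 - s ^+ 2 / 2 < a * nrm (B u).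
  have := hu; rewrite -(ltr_pM2l a0) mulrBr mulrA ab mul1r; lra.
pose w := u - (a ^+ 2)%:C *: B (B u).
have hw : nrm w ^+ 2 <= nrm u ^+ 2 - (a * nrm (B u)) ^+ 2.
  rewrite /w (nrmB_sqr dotE) nrmZr (ger0_norm (sqr_ge0 a)) dotZr conjc_real.
  rewrite -symB (dotxx dotE) -rmorphM /=.
  have : (a * nrm (B (B u))) ^+ 2 <= nrm (B u) ^+ 2.
    by rewrite ler_pXn2r ?nnegrE ?mulr_ge0 ?nrm_ge0 ?(ltW a0).
  move=> h3; have := ler_wpM2l (sqr_ge0 a) h3; lra.
have ws : nrm w <= s.
  rewrite -(@ler_pXn2r _ 2) ?nnegrE ?nrm_ge0 ?(ltW s0) //.
  have u2 : nrm u ^+ 2 <= 1 by rewrite expr_le1 ?nrm_ge0.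
  have s2 : s ^+ 2 <= 1 by rewrite expr_le1 ?(ltW s0) //; lra.
  have : (1 - s ^+ 2 / 2) ^+ 2 <= (a * nrm (B u)) ^+ 2.
    rewrite ler_pXn2r ?nnegrE ?mulr_ge0 ?nrm_ge0 ?(ltW a0) ?(ltW hu) //; lra.
  have := sqr_ge0 (s ^+ 2); move: (s ^+ 2) (nrm w ^+ 2) (nrm u ^+ 2) ((a * nrm (B u)) ^+ 2) hw u2 s2 => s' w' u' aB'; nra.
have h4 : a ^+ 2 * nrm (B (B u)) <= N * s.
  rewrite /N -mulrA ler_wpM2l ?sqr_ge0 //; apply: (le_trans (key u)).
  by rewrite ler_wpM2l // mulr_ge0.
have h5 : nrm u <= nrm w + a ^+ 2 * nrm (B (B u)).
  have := nrmD_le w ((a ^+ 2)%:C *: B (B u)).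
  by rewrite /w subrK nrmZr (ger0_norm (sqr_ge0 a)).
have h6 := aB u.
have s2s : s ^+ 2 <= s / 2 by rewrite expr2; apply: ler_wpM2l; [exact: ltW|lra].
have {}sN : s * N + 2 * s = 1 by rewrite -[RHS]sN; ring.
have aux (c t X n n' Y m : R) : 0 < c -> 1 - t / 2 < X -> X <= n ->
    n <= n' + Y -> Y <= m -> n' <= c -> t <= c / 2 -> m + 2 * c = 1 -> False.
  by clear=> *; lra.
rewrite [N * s]mulrC in h4.
exact: (aux _ _ _ _ _ _ _ s0 hu h6 h5 h4 ws s2s sN).
Qed.

(** A regular real [mu] is replaced by a spectral point at distance [a]; as [a |y| <= |(A - mu) y|],
    this costs only a factor 2 in the bound required by [cayley_vanish]. *)
Lemma spectral_vanish (T : H -> H) (C CT : R) : linear T ->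
  (forall x, nrm (T x) <= CT * nrm x) -> 0 <= CT -> 0 <= C ->
  (forall x, T (resolvent A (- 'i%C) x) = resolvent A (- 'i%C) (T x)) ->
  (forall (mu : R) y, ~ resolvent_set A mu%:C -> dom A y ->
     nrm (T y) <= C * nrm (A y - mu%:C *: y)) ->
  forall x, T x = 0.
Proof.
move=> lT bT CT0 C0 TJ h x.
have [x00|nx] := pselect (exists x : H, x != 0); last first.
  apply/eqP; apply: contrapT => /negP Tx; apply: nx; by exists (T x).
apply: (@cayley_vanish T (2 * C) CT) => // [|mu y Dy].
  by rewrite mulr_ge0.
have [rmu|nrmu] := pselect (resolvent_set A mu%:C); last first.
  apply: (le_trans (h mu y nrmu Dy)); have := mulr_ge0 C0 (nrm_ge0 (A y - mu%:C *: y)).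
  lra.
have [a [a0 ha hor]] := nearest_spectrum x00 rmu.
have [m [m1 nm]] : exists m : R, `|m - mu| = a /\ ~ resolvent_set A m%:C.
  case: hor => hor; [exists (mu + a)|exists (mu - a)]; split => //.
    by rewrite addrAC subrr add0r gtr0_norm.
  by rewrite addrAC subrr add0r normrN gtr0_norm.
apply: (le_trans (h m y nm Dy)); rewrite [2 * C]mulrC -mulrA ler_wpM2l //.
have -> : A y - m%:C *: y = (A y - mu%:C *: y) - (m - mu)%:C *: y.
  rewrite rmorphB /=; apply: (dot_extl dotE) => t; rewrite !dot_lin; ring.
apply: (le_trans (nrmB_le _ _)); rewrite nrmZr m1; have := ha y Dy; lra.
Qed.

End SpectralVanishing.

(** * Strongly differentiable families *)

Section Derivative.
Variables (R : realType) (V : normedModType R[i]).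

Lemma is_deriv01_uniq (f : R -> V) t u v : I01 t ->
  is_deriv01 f t u -> is_deriv01 f t v -> u = v.
Proof. by move=> It hu hv; rewrite -(deriv01E It hu) (deriv01E It hv). Qed.

Lemma is_deriv01_lin (f g : R -> V) t u v (a : R[i]) : I01 t ->
  is_deriv01 f t u -> is_deriv01 g t v ->
  is_deriv01 (fun s => a *: f s + g s) t (a *: u + v).
Proof.
move=> It hf hg; have PF := dnbhs_I01_proper It.
rewrite /is_deriv01.
rewrite (_ : diff_quot _ t = fun s => a *: diff_quot f t s + diff_quot g t s).
  by apply: cvgD => //; apply: cvgZr.
apply/funext => s; rewrite /diff_quot scalerA mulrC -scalerA -scalerDr.
by congr (_ *: _); rewrite opprD addrACA scalerBr.
Qed.

Lemma is_deriv01_bound (f : R -> V) t v (M : R) : I01 t ->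
  is_deriv01 f t v ->
  (forall s, I01 s -> nrm (f s - f t) <= M * `|s - t|) -> nrm v <= M.
Proof.
move=> It /(is_deriv01P _ _ It) h hM; apply/ler_addgt0Pl => e e0.
have [d d0 hd] := h e e0; have PF := dnbhs_I01_proper It.
have : (within I01 t^') [set s | I01 s /\ s != t /\ `|s - t| < d].
  by apply/(dnbhs_I01P _ It); exists d.
move=> /filter_ex[s [Is [st sd]]].
have p0 : 0 < `|s - t| by rewrite normr_gt0 subr_eq0.
rewrite -(ler_pM2r p0) mulrC -nrmZr mulrDl.
have -> : (s - t)%:C *: v = (f s - f t) - (f s - f t - (s - t)%:C *: v).
  by rewrite opprB [RHS]addrC subrK.
by apply: (le_trans (nrmB_le _ _)); rewrite addrC lerD ?hd ?hM.
Qed.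

End Derivative.

Section Families.
Variables (R : realType) (H : completeNormedModType R[i]).
Variable dot : {dot H for Num.conj}.
Hypothesis dotE : forall x : H, `|x| ^+ 2 = dot x x.
Variables (A : R -> operator H) (D : set H).
Hypothesis sA : forall t, I01 t -> self_adjoint dot (A t).
Hypothesis dA : forall t, I01 t -> dom (A t) = D.

Let I0 := I01_0 R.

Lemma family_lin t (a : R[i]) x y : I01 t -> D x -> D y ->
  D (a *: x + y) /\ A t (a *: x + y) = a *: A t x + A t y.
Proof. by move=> It; rewrite -(dA It); exact: saP (sA It) a _ _. Qed.

(** The graph norm of [A 0] without a square root (see [graph_nrm_sqr]). With it [J = (A 0 + i)^-1]
    is an isometry of [H] onto [D], which carries statements on [D] over to everywhere defined
    operators. *)
Definition graph_nrm (x : H) : R := nrm (A 0 x + 'i%C *: x).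

Lemma graph_nrm_ge0 x : 0 <= graph_nrm x. Proof. exact: nrm_ge0. Qed.

Lemma graph_nrm_sqr x : D x -> graph_nrm x ^+ 2 = nrm (A 0 x) ^+ 2 + nrm x ^+ 2.
Proof.
move=> Dx; rewrite -(sa_graph_norm dotE (sA I0)) ?dA //.
by rewrite /graph_nrm scaleNr opprK.
Qed.

Lemma nrm_le_graph x : D x -> nrm x <= graph_nrm x.
Proof.
move=> Dx; rewrite -(@ler_pXn2r _ 2) ?nnegrE ?nrm_ge0 // graph_nrm_sqr //.
by rewrite lerDr sqr_ge0.
Qed.

Lemma nrm_A0_le_graph x : D x -> nrm (A 0 x) <= graph_nrm x.
Proof.
move=> Dx; rewrite -(@ler_pXn2r _ 2) ?nnegrE ?nrm_ge0 // graph_nrm_sqr //.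
by rewrite lerDl sqr_ge0.
Qed.

Let J := resolvent (A 0) (- 'i%C).
Let rJ : resolvent_set (A 0) (- 'i%C). Proof. exact: (sa_Ni dotE (sA I0)). Qed.
Let lJ : linear J. Proof. exact: (res_lin dotE (sA I0) rJ). Qed.
Let DJ x : D (J x). Proof. by rewrite -(dA I0); exact: res_dom. Qed.
Let J1 x : nrm (J x) <= nrm x.
Proof.
rewrite -[leRHS]mul1r; apply: (res_bound rJ) => y; rewrite (dA I0) => Dy.
by rewrite mul1r scaleNr opprK; exact: nrm_le_graph.
Qed.
Let JK x : D x -> J (A 0 x + 'i%C *: x) = x.
Proof. by move=> Dx; apply: (res_uniq rJ); rewrite ?dA // scaleNr opprK. Qed.

Lemma bounded_comp_J t : I01 t -> linear (fun x => A t (J x)) /\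
  exists C : R, forall x, nrm (A t (J x)) <= C * nrm x.
Proof.
move=> It; have lAJ : linear (fun x => A t (J x)).
  move=> a x y; rewrite lJ.
  by have [] := family_lin a It (DJ x) (DJ y).
split=> //.
have [|C _ hC] := hellinger_toeplitz dotE (sa_dense (sA It)) lAJ; last by exists C.
move=> y Dy; exists (nrm (A t y)) => x.
rewrite (sa_sym (sA It)) // ?dA //; apply: (le_trans (dot_le dotE _ _)).
by rewrite mulrC ler_wpM2l ?nrm_ge0.
Qed.

Let pairs01 := {p : R * R | I01 p.1 /\ I01 p.2}.

(** Uniform boundedness for the difference quotients of [B t (J x)], indexed by all pairs of times;
    [C1_lip] gives the pointwise bounds. Pairs with [s = t] are harmless because [0^-1 = 0]. [B] is
    left general so as to cover the derivative of [A] too. *)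
Lemma strong_lip (B : R -> H -> H) :
  (forall t, I01 t -> linear (fun x => B t (J x)) /\
     exists C : R, forall x, nrm (B t (J x)) <= C * nrm x) ->
  (forall x, D x -> Ck01 1 (fun t => B t x)) ->
  exists2 L : R, 0 <= L & forall s t x, I01 s -> I01 t -> D x ->
    nrm (B s x - B t x) <= L * `|s - t| * graph_nrm x.
Proof.
move=> hB cB.
have [|||L L0 hL] := @uniform_boundedness R H H pairs01
  (fun (p : pairs01) (x : H) => (((sval p).1 - (sval p).2)^-1)%:C *:
     (B (sval p).1 (J x) - B (sval p).2 (J x))).
- move=> [[s t] [Is It]] a x y /=.
  rewrite (hB s Is).1 (hB t It).1.
  apply: (dot_extl dotE) => z; rewrite !dot_lin; ring.
- move=> [[s t] [/= Is It]].
  have [_ [Cs hs]] := hB s Is; have [_ [Ct ht]] := hB t It.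
  exists (`|(s - t)^-1| * (Cs + Ct)) => x; rewrite nrmZr -mulrA ler_wpM2l //.
  by apply: (le_trans (nrmB_le _ _)); rewrite mulrDl lerD.
- move=> x; have [M M0 hM] := C1_lip (cB _ (DJ x)); exists M => -[[s t] [/= Is It]].
  rewrite nrmZr normfV; have [->|st] := eqVneq s t.
    by rewrite subrr normr0 invr0 mul0r.
  by rewrite mulrC ler_pdivrMr ?normr_gt0 ?subr_eq0 // hM.
exists L => // s t x Is It Dx.
have := hL (exist _ (s, t) (conj Is It)) (A 0 x + 'i%C *: x) => /=.
rewrite JK // nrmZr normfV; have [->|st] := eqVneq s t.
  by move=> _; rewrite !subrr normr0 nrm0 mulr0 mul0r.
by rewrite mulrC ler_pdivrMr ?normr_gt0 ?subr_eq0 // mulrAC.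
Qed.

Lemma family_C1 : (forall x, D x -> Ck01 1 (fun t => A t x)) ->
  exists2 L : R, 0 <= L & forall s t x, I01 s -> I01 t -> D x ->
    nrm (A s x - A t x) <= L * `|s - t| * graph_nrm x.
Proof. by apply: strong_lip => t It; exact: bounded_comp_J. Qed.

(** Strong C^2 regularity in the form used later: a derivative that is Lipschitz and a quadratic
    Taylor remainder, uniformly relative to the graph norm. *)
Lemma family_C2 : (forall x, D x -> Ck01 2 (fun t => A t x)) ->
  exists (A' : R -> H -> H) (L : R), [/\ 0 <= L,
    forall t x y a, I01 t -> D x -> D y -> A' t (a *: x + y) = a *: A' t x + A' t y,
    forall s t x, I01 s -> I01 t -> D x ->
      nrm (A s x - A t x) <= L * `|s - t| * graph_nrm x,
    forall t x, I01 t -> D x -> nrm (A' t x) <= L * graph_nrm x &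
    (forall s t x, I01 s -> I01 t -> D x ->
      nrm (A' s x - A' t x) <= L * `|s - t| * graph_nrm x) /\
    forall s t x, I01 s -> I01 t -> D x ->
      nrm (A s x - A t x - (s - t)%:C *: A' t x) <= L * (s - t) ^+ 2 * graph_nrm x].
Proof.
move=> cA; have [|L1 L10 hL1] := family_C1.
  move=> x /cA[g dg [g' dg' cg']]; exists g => //=.
  apply/continuous_I01P => t e It e0.
  have [|M M0 hM] := @C1_lip R H g; first by exists g'.
  have M1 : 0 < M + 1 by lra.
  exists (e / (M + 1)); first exact: divr_gt0.
  move=> s Is; rewrite ltr_pdivlMr // => h; apply: (le_lt_trans (hM s t Is It)).
  by apply: le_lt_trans h; rewrite mulrC ler_wpM2l // lerDl.
pose A' t x := deriv01 (fun s => A s x) t.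
have dA' t x : I01 t -> D x -> is_deriv01 (fun s => A s x) t (A' t x).
  by move=> It /cA[g dg _]; rewrite /A' (deriv01E It (dg t It)); exact: dg.
have cA' x : D x -> Ck01 1 (fun t => A' t x).
  move=> Dx; have [g dg [g' dg' cg']] := cA x Dx.
  have gA t : I01 t -> g t = A' t x by move=> It; rewrite /A' (deriv01E It (dg t It)).
  exists g' => // t It; apply/(is_deriv01P _ _ It) => e e0.
  have [d d0 hd] := (is_deriv01P _ _ It).1 (dg' t It) e e0.
  by exists d => // s Is sd; rewrite -!gA //; exact: hd.
have lA' t x y a : I01 t -> D x -> D y -> A' t (a *: x + y) = a *: A' t x + A' t y.
  move=> It Dx Dy; apply: (is_deriv01_uniq It).
    by apply: dA' => //; have [] := family_lin a It Dx Dy.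
  have := @is_deriv01_lin R H _ _ t _ _ a It (dA' t x It Dx) (dA' t y It Dy).
  move=> /(is_deriv01P _ _ It) h; apply/(is_deriv01P _ _ It) => e e0.
  have [d d0 hd] := h e e0; exists d => // s Is sd.
  have AE u : I01 u -> A u (a *: x + y) = a *: A u x + A u y.
    by move=> Iu; have [] := family_lin a Iu Dx Dy.
  by rewrite !AE //; exact: hd.
have bA' t x : I01 t -> D x -> nrm (A' t x) <= L1 * graph_nrm x.
  move=> It Dx; apply: (is_deriv01_bound It (dA' t x It Dx)) => s Is.
  by rewrite mulrAC; exact: hL1.
have [|//|L2 L20 hL2] := @strong_lip A'.
  move=> t It; split=> [a x y|].
    by rewrite lJ lA'.
  exists L1 => x; apply: (le_trans (bA' t _ It (DJ x))).
  have [_] := resP rJ x; rewrite scaleNr opprK => xE.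
  by rewrite /graph_nrm /J xE.
exists A', (L1 + L2); split=> [|//|s t x Is It Dx|t x It Dx|].
- by rewrite addr_ge0.
- apply: (le_trans (hL1 s t x Is It Dx)); rewrite -!mulrA ler_wpM2r ?mulr_ge0 ?nrm_ge0 //.
  by rewrite lerDl.
- apply: (le_trans (bA' t x It Dx)); rewrite ler_wpM2r ?nrm_ge0 //.
  by rewrite lerDl.
split=> s t x Is It Dx.
  apply: (le_trans (hL2 s t x Is It Dx)); rewrite -!mulrA ler_wpM2r ?mulr_ge0 ?nrm_ge0 //.
  by rewrite lerDr.
have := @is_deriv01_taylor R H (fun s => A s x) (fun s => A' s x) (L2 * graph_nrm x).
move=> /(_ _ _ _ s t Is It) h; apply: (le_trans (h _ _ _)).
- by rewrite mulr_ge0 ?nrm_ge0.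
- by move=> u Iu; exact: dA'.
- by move=> u v Iu Iv; rewrite mulrAC; exact: hL2.
rewrite mulrAC ler_wpM2r ?nrm_ge0 // ler_wpM2r ?sqr_ge0 //.
by rewrite lerDr.
Qed.

End Families.

(** * The resolvent along the path *)

Section ResolventFamily.
Variables (R : realType) (H : completeNormedModType R[i]).
Variable dot : {dot H for Num.conj}.
Hypothesis dotE : forall x : H, `|x| ^+ 2 = dot x x.
Variables (A : R -> operator H) (D : set H) (gamma : R -> R[i]).
Hypothesis sA : forall t, I01 t -> self_adjoint dot (A t).
Hypothesis dA : forall t, I01 t -> dom (A t) = D.
Hypothesis C2A : forall x, D x -> Ck01 2 (fun t => A t x).
Hypothesis cgamma : cont01 gamma.
Hypothesis rA : forall t s, I01 t -> I01 s -> resolvent_set (A t) (gamma s).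

Let I0 := I01_0 R.
Let g := graph_nrm A.

Lemma graph_nrmZ a x : D x -> g (a *: x) = nrm a * g x.
Proof.
move=> Dx; rewrite /g /graph_nrm; have := saZ (sA I0) a (x := x).
rewrite dA // => /(_ Dx)[_ ->].
by rewrite scalerA [_ * a]mulrC -scalerA -scalerDr nrmZ.
Qed.

(** [A 0] composed with the resolvent of [A t] is everywhere defined, since the domains agree, and
    is bounded by Hellinger-Toeplitz. *)
Lemma graph_nrm_resolvent t z : I01 t -> resolvent_set (A t) z ->
  exists2 K : R, 0 <= K & forall x, D x -> g x <= K * nrm (A t x - z *: x).
Proof.
move=> It rz; pose Rz := resolvent (A t) z.
have DR x : D (Rz x) by rewrite -(dA It); exact: res_dom.
have lR : linear Rz := res_lin dotE (sA It) rz.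
have [M M0 hM] := resolvent_set_bound rz.
have bR x : nrm (Rz x) <= M * nrm x := res_bound rz hM x.
have lT : linear (fun x => A 0 (Rz x)).
  by move=> a x y; rewrite lR; have [] := family_lin sA dA a I0 (DR x) (DR y).
have [|K K0 hK] := hellinger_toeplitz dotE (sa_dense (sA I0)) lT.
  move=> y Dy; exists (M * nrm (A 0 y)) => x.
  have D1 : dom (A 0) (Rz x) by rewrite dA.
  rewrite (sa_sym (sA I0) D1 Dy); apply: (le_trans (dot_le dotE _ _)).
  by rewrite mulrAC ler_wpM2r ?nrm_ge0.
exists (K + M) => [|x Dx]; first by rewrite addr_ge0.
have xE : Rz (A t x - z *: x) = x by apply: (res_uniq rz); rewrite ?dA.
apply: (le_trans (nrmD_le _ _)); rewrite nrmZ nrm_i mul1r mulrDl lerD //.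
  by rewrite -{1}xE.
by rewrite -{1}xE.
Qed.

(** The bound at one [(t, s)] persists nearby by perturbation ([loc]); compactness of the square
    comes from two interval inductions, over [s] at a fixed [t] ([one]) and then over [t]. *)
Lemma graph_nrm_uniform : exists2 M : R, 0 <= M & forall t s x,
  I01 t -> I01 s -> D x -> g x <= M * nrm (A t x - gamma s *: x).
Proof.
have [A' [L [L0 _ hL _ _]]] := family_C2 dotE sA dA C2A.
pose P t s M := forall x, D x -> g x <= M * nrm (A t x - gamma s *: x).
have mono t s M M' : M <= M' -> P t s M -> P t s M'.
  by move=> MM' h x Dx; apply: (le_trans (h x Dx)); rewrite ler_wpM2r ?nrm_ge0.
(* Absorption: the two perturbation terms amount to at most [G / 2], which moves to the left side
   and doubles [K]. *)
have aux (K N N1 N2 N3 G k : R) : 0 <= K -> 0 <= G -> G <= K * N1 ->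
    N1 <= N + (N2 + N3) -> N3 <= k * G -> N2 <= k * G -> K * k <= 1 / 4 ->
    G <= 2 * K * N.
  clear=> K0 G0 h1 h2 h3 h4 h5.
  have := ler_wpM2l K0 h2; have := ler_wpM2l K0 h3; have := ler_wpM2l K0 h4.
  have := ler_wpM2r G0 h5; lra.
have loc t s : I01 t -> I01 s -> exists M d : R, 0 < d /\
   forall t' s', I01 t' -> I01 s' -> `|t' - t| < d -> `|s' - s| < d -> P t' s' M.
  move=> It Is; have [K K0 hK] := graph_nrm_resolvent It (rA It Is).
  pose q := 4 * (K + 1) * (L + 1).
  have q0 : 0 < q by rewrite !mulr_gt0 //; lra.
  have q1 : 0 < (4 * (K + 1))^-1 by rewrite invr_gt0 mulr_gt0 //; lra.
  have [d d0 hd] := (cont01P gamma).1 cgamma s _ Is q1.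
  exists (2 * K), (Num.min d q^-1); split; first by rewrite lt_min d0 invr_gt0.
  move=> t' s' It' Is'; rewrite !lt_min => /andP[_ tq] /andP[sd _] x Dx.
  have h1 := hK x Dx; have h2 := hL t' t x It' It Dx; have h3 := hd s' Is' sd.
  have g0 : 0 <= g x := nrm_ge0 _.
  have h4 : nrm (A t x - gamma s *: x) <= nrm (A t' x - gamma s' *: x) +
      (nrm (A t' x - A t x) + nrm (gamma s' - gamma s) * nrm x).
    rewrite -nrmZ; have -> : A t x - gamma s *: x = (A t' x - gamma s' *: x) -
        ((A t' x - A t x) - (gamma s' - gamma s) *: x).
      apply: (dot_extl dotE) => w; rewrite !dot_lin; ring.
    by apply: (le_trans (nrmB_le _ _)); rewrite lerD2l; exact: nrmB_le.
  have h5 : nrm x <= g x := nrm_le_graph dotE sA dA Dx.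
  have h6 : nrm (gamma s' - gamma s) * nrm x <= (4 * (K + 1))^-1 * g x.
    by rewrite ler_pM ?nrm_ge0 // ltW.
  have h7 : L * `|t' - t| <= (4 * (K + 1))^-1.
    have -> : (4 * (K + 1))^-1 = (L + 1) * q^-1.
      by rewrite /q; field; rewrite !gt_eqF //; lra.
    by rewrite ler_pM // ?(ltW tq) // lerDl.
  have h8 : nrm (A t' x - A t x) <= (4 * (K + 1))^-1 * g x.
    by apply: (le_trans h2); rewrite ler_wpM2r.
  have h9 : K * (4 * (K + 1))^-1 <= 1 / 4.
    rewrite ler_pdivrMr ?mulr_gt0 //; lra.
  exact: aux K0 g0 h1 h4 h6 h8 h9.
have one t : I01 t -> exists M d : R, 0 < d /\
   forall t' s', I01 t' -> 0 <= s' <= 1 -> `|t' - t| < d -> P t' s' M.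
  move=> It; apply: (@interval_induction R (fun u v => exists M d : R, 0 < d /\
    forall t' s', I01 t' -> u <= s' <= v -> `|t' - t| < d -> P t' s' M)) => //.
    move=> u v w _ _ _ _ [M1 [d1 [d10 h1]]] [M2 [d2 [d20 h2]]].
    exists (Num.max M1 M2), (Num.min d1 d2); split; first by rewrite lt_min d10.
    move=> t' s' It' /andP[us sw]; rewrite lt_min => /andP[td1 td2].
    have [sv|vs] := leP s' v.
      apply: (mono _ _ M1); first by rewrite le_max lexx.
      by apply: h1 => //; rewrite us.
    apply: (mono _ _ M2); first by rewrite le_max lexx orbT.
    by apply: h2 => //; rewrite sw ltW.
  move=> s s0 s1; have Is : I01 s by apply/I01E/andP.
  have [M [d [d0 h]]] := loc t s It Is; exists d => // u v u0 us sv v1 uvd.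
  exists M, d; split=> // t' s' It' /andP[us' sv'] td; apply: h => //.
    by apply/I01E/andP; split; lra.
  by rewrite ltr_norml; apply/andP; split; lra.
have [M hM] : exists M : R, forall t' s', 0 <= t' <= 1 -> 0 <= s' <= 1 -> P t' s' M.
  apply: (@interval_induction R (fun u v => exists M : R,
    forall t' s', u <= t' <= v -> 0 <= s' <= 1 -> P t' s' M)) => //.
    move=> u v w _ _ _ _ [M1 h1] [M2 h2]; exists (Num.max M1 M2) => t' s' /andP[ut tw] Is.
    have [tv|vt] := leP t' v.
      by apply: (mono _ _ M1); [rewrite le_max lexx | apply: h1 => //; rewrite ut].
    by apply: (mono _ _ M2); [rewrite le_max lexx orbT | apply: h2 => //; rewrite tw ltW].
  move=> t t0 t1; have It : I01 t by apply/I01E/andP.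
  have [M [d [d0 h]]] := one t It; exists d => // u v u0 ut tv v1 uvd.
  exists M => t' s' /andP[ut' tv'] Is; apply: h => //.
    by apply/I01E/andP; split; lra.
  by rewrite ltr_norml; apply/andP; split; lra.
exists `|M| => // t s x /I01E It /I01E Is Dx.
by apply: (mono _ _ _ _ (ler_norm M) (hM t s It Is)).
Qed.

Let Rs t s := R0 A t (gamma s).

(** The time derivative of the resolvent is [R' = - R A' R]. Everything follows from
    [R_t - R_t' = - R_t (A_t - A_t') R_t'], from the first resolvent identity along the path and
    from [graph_nrm_uniform]. *)
Lemma resolvent_estimates : exists (R' : R -> R -> H -> H) (M : R), [/\ 0 <= M,
  forall t s, I01 t -> I01 s -> linear (R' t s),
  [/\ forall t s x, I01 t -> I01 s -> g (Rs t s x) <= M * nrm x,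
    forall t t' s x, I01 t -> I01 t' -> I01 s ->
      g (Rs t s x - Rs t' s x) <= M * `|t - t'| * nrm x &
    forall t s s' x, I01 t -> I01 s -> I01 s' ->
      g (Rs t s x - Rs t s' x) <= M * nrm (gamma s - gamma s') * nrm x],
  [/\ forall t s x, I01 t -> I01 s -> nrm (R' t s x) <= M * nrm x,
    forall t t' s x, I01 t -> I01 t' -> I01 s ->
      nrm (R' t s x - R' t' s x) <= M * `|t - t'| * nrm x &
    forall t s s' x, I01 t -> I01 s -> I01 s' ->
      nrm (R' t s x - R' t s' x) <= M * nrm (gamma s - gamma s') * nrm x] &
  forall t t' s x, I01 t -> I01 t' -> I01 s ->
    nrm (Rs t' s x - Rs t s x - (t' - t)%:C *: R' t s x) <= M * (t' - t) ^+ 2 * nrm x].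
Proof.
have [A' [L [L0 lA' hL bA' [hA' tA']]]] := family_C2 dotE sA dA C2A.
have [M M0 hM] := graph_nrm_uniform.
have DR t s x : I01 t -> I01 s -> D (Rs t s x).
  by move=> It Is; rewrite -(dA It); apply: res_dom; exact: rA.
have lR t s : I01 t -> I01 s -> linear (Rs t s).
  by move=> It Is; exact: (res_lin dotE (sA It) (rA It Is)).
have DB x y : D x -> D y -> D (x - y).
  move=> Dx Dy; have [] := saB (sA I0) (x := x) (y := y); by rewrite ?dA.
have Rb t s x : I01 t -> I01 s -> g (Rs t s x) <= M * nrm x.
  move=> It Is; have := hM t s _ It Is (DR t s x It Is).
  by have [_ ->] := resP (rA It Is) x.
have ng x : D x -> nrm x <= g x := fun Dx => nrm_le_graph dotE sA dA Dx.
have Rn t s x : I01 t -> I01 s -> nrm (Rs t s x) <= M * nrm x.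
  by move=> It Is; apply: le_trans (Rb t s x It Is); apply: ng; exact: DR.
have Rt t t' s x : I01 t -> I01 t' -> I01 s ->
    Rs t s x - Rs t' s x = - Rs t s (A t (Rs t' s x) - A t' (Rs t' s x)).
  move=> It It' Is; have [_ _ RN RB RZ] := linear_facts (lR t s It Is).
  have e1 := A_res (rA It' Is) x; rewrite -/(R0 A t' (gamma s)) -/(Rs t' s) in e1.
  have D1 : dom (A t) (Rs t' s x) by rewrite dA //; exact: DR.
  have e2 := res_A dotE (sA It) (rA It Is) D1.
  rewrite -/(R0 A t (gamma s)) -/(Rs t s) in e2.
  have [_ RD _ _ _] := linear_facts (lR t s It Is).
  rewrite RB e2 e1 RD RZ.
  apply: (dot_extl dotE) => w; rewrite !dot_lin; ring.
have RtN t t' s x : I01 t -> I01 t' -> I01 s ->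
    Rs t s x - Rs t' s x = Rs t s (- (A t (Rs t' s x) - A t' (Rs t' s x))).
  move=> It It' Is; have [_ _ RN RB RZ] := linear_facts (lR t s It Is).
  by rewrite RN; exact: Rt.
have At t t' s x : I01 t -> I01 t' -> I01 s ->
    nrm (A t (Rs t' s x) - A t' (Rs t' s x)) <= L * M * `|t - t'| * nrm x.
  move=> It It' Is; apply: (le_trans (hL t t' _ It It' (DR _ _ _ It' Is))).
  have -> : L * M * `|t - t'| * nrm x = L * `|t - t'| * (M * nrm x) by ring.
  by rewrite ler_wpM2l ?Rb // mulr_ge0.
have Rtg t t' s x : I01 t -> I01 t' -> I01 s ->
    g (Rs t s x - Rs t' s x) <= M * (L * M * `|t - t'| * nrm x).
  move=> It It' Is; rewrite RtN //; apply: (le_trans (Rb _ _ _ It Is)).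
  by rewrite nrmN ler_wpM2l // At.
have Rsg t s s' x : I01 t -> I01 s -> I01 s' ->
    g (Rs t s x - Rs t s' x) <= M * M * nrm (gamma s - gamma s') * nrm x.
  move=> It Is Is'; have := res_identity dotE (sA It) x (rA It Is) (rA It Is').
  rewrite -/(R0 A t (gamma s)) -/(R0 A t (gamma s')) -/(Rs t s) -/(Rs t s') => ->.
  rewrite graph_nrmZ; last by apply: DR.
  have -> : M * M * nrm (gamma s - gamma s') * nrm x =
    nrm (gamma s - gamma s') * (M * (M * nrm x)) by ring.
  rewrite ler_wpM2l ?nrm_ge0 //; apply: (le_trans (Rb _ _ _ It Is)).
  by rewrite ler_wpM2l // Rn.
pose R' t s x := - Rs t s (A' t (Rs t s x)).
have lR' t s : I01 t -> I01 s -> linear (R' t s).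
  move=> It Is a x y; rewrite /R' (lR t s) // lA' //; try exact: DR.
  by rewrite (lR t s) // opprD scalerN.
have A'R t s x : I01 t -> I01 s -> nrm (A' t (Rs t s x)) <= L * (M * nrm x).
  move=> It Is; apply: (le_trans (bA' t _ It (DR _ _ _ It Is))).
  by rewrite ler_wpM2l // Rb.
have A'B t x y : I01 t -> D x -> D y -> A' t (x - y) = A' t x - A' t y.
  move=> It Dx Dy; have := lA' t y x (-1) It Dy Dx.
  by rewrite !scaleN1r addrC [- A' t y + _]addrC.
(* Constants for [R A' R], for [R A' R A' R] and for [R A' R R]; their sum [K] is a single constant
   for all the estimates. *)
pose p2 := M * L * M; pose p4 := M * L * M * L * M; pose p5 := M * L * M * M.
have p20 : 0 <= p2 by rewrite !mulr_ge0.
have p40 : 0 <= p4 by rewrite !mulr_ge0.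
have p50 : 0 <= p5 by rewrite !mulr_ge0.
have MM0 : 0 <= M * M by rewrite mulr_ge0.
pose K := M + M * M + p2 + p2 + p4 + p4 + p5 + p5.
have up (c r : R) (x : H) (y : R) : 0 <= r -> y <= c * r * nrm x -> c <= K -> y <= K * r * nrm x.
  move=> r0 h cK; apply: (le_trans h).
  by apply: ler_wpM2r; [exact: nrm_ge0 | exact: ler_wpM2r].
have up1 (c : R) (x : H) (y : R) : y <= c * nrm x -> c <= K -> y <= K * nrm x.
  by move=> h cK; apply: (le_trans h); apply: ler_wpM2r => //; exact: nrm_ge0.
have Rtn t t' s x : I01 t -> I01 t' -> I01 s ->
    nrm (Rs t s x - Rs t' s x) <= p2 * `|t - t'| * nrm x.
  move=> It It' Is; apply: (le_trans (ng _ (DB _ _ (DR _ _ _ It Is) (DR _ _ _ It' Is)))).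
  apply: (le_trans (Rtg t t' s x It It' Is)).
  by rewrite le_eqVlt; apply/orP; left; apply/eqP; rewrite /p2; ring.
have Rsn t s s' x : I01 t -> I01 s -> I01 s' ->
    nrm (Rs t s x - Rs t s' x) <= M * M * nrm (gamma s - gamma s') * nrm x.
  move=> It Is Is'; apply: le_trans (Rsg t s s' x It Is Is').
  by apply: ng; apply: DB; exact: DR.
exists R', K; split=> [|//|||t t' s x It It' Is].
- by rewrite !addr_ge0.
- split=> [t s x It Is|t t' s x It It' Is|t s s' x It Is Is'].
  + by apply: (@up1 M); [exact: Rb | ]; rewrite /K; lra.
  + apply: (@up p2) => //; last by rewrite /K; lra.
    apply: (le_trans (Rtg t t' s x It It' Is)).
    by rewrite le_eqVlt; apply/orP; left; apply/eqP; rewrite /p2; ring.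
  + apply: (@up (M * M)); [exact: nrm_ge0 | exact: Rsg | rewrite /K; lra].
- split=> [t s x It Is|t t' s x It It' Is|t s s' x It Is Is'].
  + apply: (@up1 p2); last by rewrite /K; lra.
    rewrite nrmN; apply: (le_trans (Rn _ _ _ It Is)).
    by rewrite /p2 -!mulrA ler_wpM2l // A'R.
  + apply: (@up (p4 + p2 + p4)) => //; last by rewrite /K; lra.
    have e : R' t s x - R' t' s x =
       - (Rs t s (A' t (Rs t s x - Rs t' s x)) +
          Rs t s (A' t (Rs t' s x) - A' t' (Rs t' s x)) +
          (Rs t s (A' t' (Rs t' s x)) - Rs t' s (A' t' (Rs t' s x)))).
      have [_ _ _ RB _] := linear_facts (lR t s It Is).
      rewrite /R' A'B //; try exact: DR.
      rewrite !RB; apply: (dot_extl dotE) => w; rewrite !dot_lin; ring.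
    rewrite e nrmN; apply: (le_trans (nrmD_le _ _)); rewrite !mulrDl.
    apply: lerD; last first.
      apply: (le_trans (Rtn _ _ _ _ It It' Is)).
      have := A'R t' s x It' Is => h.
      have -> : p4 * `|t - t'| * nrm x = p2 * `|t - t'| * (L * (M * nrm x)).
        by rewrite /p4 /p2; ring.
      by rewrite ler_wpM2l // mulr_ge0.
    apply: (le_trans (nrmD_le _ _)); apply: lerD.
      apply: (le_trans (Rn _ _ _ It Is)).
      have -> : p4 * `|t - t'| * nrm x = M * (L * (p2 * `|t - t'| * nrm x)).
        by rewrite /p4 /p2; ring.
      rewrite ler_wpM2l //; apply: (le_trans (bA' t _ It (DB _ _ (DR _ _ _ It Is) (DR _ _ _ It' Is)))).
      rewrite ler_wpM2l //; apply: (le_trans (Rtg t t' s x It It' Is)).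
      by rewrite le_eqVlt; apply/orP; left; apply/eqP; rewrite /p2; ring.
    apply: (le_trans (Rn _ _ _ It Is)).
    have -> : p2 * `|t - t'| * nrm x = M * (L * `|t - t'| * (M * nrm x)).
      by rewrite /p2; ring.
    rewrite ler_wpM2l //; apply: (le_trans (hA' t t' _ It It' (DR _ _ _ It' Is))).
    by rewrite ler_wpM2l ?mulr_ge0 // Rb.
  + apply: (@up (p5 + p5)); [exact: nrm_ge0 | | rewrite /K; lra].
    have e : R' t s x - R' t s' x =
       - (Rs t s (A' t (Rs t s x - Rs t s' x)) +
          (Rs t s (A' t (Rs t s' x)) - Rs t s' (A' t (Rs t s' x)))).
      have [_ _ _ RB _] := linear_facts (lR t s It Is).
      rewrite /R' A'B //; try exact: DR.
      rewrite !RB; apply: (dot_extl dotE) => w; rewrite !dot_lin; ring.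
    rewrite e nrmN; apply: (le_trans (nrmD_le _ _)); rewrite !mulrDl.
    apply: lerD.
      apply: (le_trans (Rn _ _ _ It Is)).
      have -> : p5 * nrm (gamma s - gamma s') * nrm x =
        M * (L * (M * M * nrm (gamma s - gamma s') * nrm x)) by rewrite /p5; ring.
      rewrite ler_wpM2l //; apply: (le_trans (bA' t _ It (DB _ _ (DR _ _ _ It Is) (DR _ _ _ It Is')))).
      by rewrite ler_wpM2l // Rsg.
    apply: (le_trans (Rsn _ _ _ _ It Is Is')).
    have -> : p5 * nrm (gamma s - gamma s') * nrm x =
        M * M * nrm (gamma s - gamma s') * (L * (M * nrm x)) by rewrite /p5; ring.
    by rewrite ler_wpM2l ?A'R // mulr_ge0 ?nrm_ge0.
apply: (@up (p2 + p4)); [exact: sqr_ge0 | | rewrite /K; lra].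
have e : Rs t' s x - Rs t s x - (t' - t)%:C *: R' t s x =
   - Rs t' s (A t' (Rs t s x) - A t (Rs t s x) - (t' - t)%:C *: A' t (Rs t s x)) -
   (t' - t)%:C *: (Rs t' s (A' t (Rs t s x)) - Rs t s (A' t (Rs t s x))).
  have [_ _ _ RB RZ] := linear_facts (lR t' s It' Is).
  rewrite (Rt t' t s x It' It Is) /R' [in RHS]RB RZ.
  apply: (dot_extl dotE) => w; rewrite !dot_lin; ring.
rewrite e; apply: (le_trans (nrmB_le _ _)); rewrite nrmN !mulrDl nrmZr; apply: lerD.
  apply: (le_trans (Rn _ _ _ It' Is)).
  have -> : p2 * (t' - t) ^+ 2 * nrm x = M * (L * (t' - t) ^+ 2 * (M * nrm x)).
    by rewrite /p2; ring.
  rewrite ler_wpM2l //; apply: (le_trans (tA' t' t _ It' It (DR _ _ _ It Is))).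
  by rewrite ler_wpM2l ?Rb // mulr_ge0 // sqr_ge0.
have -> : p4 * (t' - t) ^+ 2 * nrm x = `|t' - t| * (p2 * `|t' - t| * (L * (M * nrm x))).
  by rewrite -[(t' - t) ^+ 2](real_normK (num_real _)) /p4 /p2; ring.
rewrite ler_wpM2l //; apply: (le_trans (Rtn _ _ _ _ It' It Is)).
by rewrite ler_wpM2l ?A'R // mulr_ge0.
Qed.

End ResolventFamily.

(** * Relative bounds *)

Section RelativeBounds.
Variables (R : realType) (H : completeNormedModType R[i]).
Variable dot : {dot H for Num.conj}.
Hypothesis dotE : forall x : H, `|x| ^+ 2 = dot x x.
Variables (B : R -> operator H) (D1 : set H).
Hypothesis sB : forall t, I01 t -> self_adjoint dot (B t).
Hypothesis dB : forall t, I01 t -> dom (B t) = D1.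
Hypothesis C1B : forall x, D1 x -> Ck01 1 (fun t => B t x).
Variables (P P1 : R -> H -> H) (M : R).
Hypothesis M0 : 0 <= M.
Hypothesis lP : forall t, I01 t -> linear (P t).
Hypothesis lP1 : forall t, I01 t -> linear (P1 t).
Hypothesis bP : forall t (x : H), I01 t -> nrm (P t x) <= M * nrm x.
Hypothesis bP1 : forall t (x : H), I01 t -> nrm (P1 t x) <= M * nrm x.
Hypothesis lipP : forall t t' (x : H), I01 t -> I01 t' ->
  nrm (P t x - P t' x) <= M * `|t - t'| * nrm x.
Hypothesis dP : forall t x, I01 t -> is_deriv01 (fun s => P s x) t (P1 t x).
Hypothesis rP : forall t x, I01 t -> D1 (P t x).
Hypothesis rP1 : forall t x, I01 t -> D1 (P1 t x).
Hypothesis cP1 : forall x, {within I01, continuous (fun t => B 0 (P1 t x))}.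

Let I0 := I01_0 R.
Let g := graph_nrm B.

Lemma sa_comp_bounded t (T : H -> H) (C : R) : I01 t -> 0 <= C -> linear T ->
  (forall x, nrm (T x) <= C * nrm x) -> (forall x, D1 (T x)) ->
  linear (fun x => B t (T x)) /\
  exists2 K : R, 0 <= K & forall x, nrm (B t (T x)) <= K * nrm x.
Proof.
move=> It C0 lT bT DT.
have lBT : linear (fun x => B t (T x)).
  by move=> a x y; rewrite lT; have [] := family_lin sB dB a It (DT x) (DT y).
split=> //; apply: (hellinger_toeplitz dotE (sa_dense (sB It)) lBT) => y Dy.
exists (C * nrm (B t y)) => x.
have Dx : dom (B t) (T x) by rewrite dB.
rewrite (sa_sym (sB It) Dx Dy); apply: (le_trans (dot_le dotE _ _)).
by rewrite mulrAC ler_wpM2r ?nrm_ge0.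
Qed.

Lemma is_deriv01_dot (f : R -> H) t v y : I01 t -> is_deriv01 f t v ->
  is_deriv01 (fun s => dot (f s) y : R[i]^o) t (dot v y).
Proof.
move=> It /(is_deriv01P _ _ It) h; apply/(is_deriv01P _ _ It) => e e0.
have c0 : 0 < nrm y + 1 by have := nrm_ge0 y; lra.
have [d d0 hd] := h (e / (nrm y + 1)) (divr_gt0 e0 c0).
exists d => // s Is sd; have := hd s Is sd => h1.
have -> : (dot (f s) y : R[i]^o) - dot (f t) y - (s - t)%:C *: (dot v y : R[i]^o) =
    dot (f s - f t - (s - t)%:C *: v) y by rewrite !dot_lin.
apply: (le_trans (dot_le dotE _ _)).
apply: (@le_trans _ _ (e / (nrm y + 1) * `|s - t| * (nrm y + 1))).
  by apply: ler_pM; rewrite ?nrm_ge0 // lerDl.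
by rewrite mulrAC divfK // gt_eqF.
Qed.

Lemma deriv_comp_bound : exists2 K : R, 0 <= K &
  forall t (x : H), I01 t -> nrm (B 0 (P1 t x)) <= K * nrm x.
Proof.
have h t : I01 t -> _ := fun It => sa_comp_bounded I0 M0 (lP1 It)
  (fun x => bP1 x It) (fun x => rP1 x It).
have [|||K K0 hK] := @uniform_boundedness R H H {t | I01 t}
  (fun (t : {t | I01 t}) x => B 0 (P1 (sval t) x)).
- by move=> [t It]; have [] := h t It.
- by move=> [t It]; have [_ [K _ hK]] := h t It; exists K.
- move=> x; have [K _ hK] := continuous_I01_bounded (cP1 (x := x)).
  by exists K => -[t It]; exact: hK.
by exists K => // t x It; exact: (hK (exist _ t It)).
Qed.

(** [B 0] cannot be applied to the difference quotients in the limit. It is moved onto a test vector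
    of its domain, where [P] can be differentiated, and then back onto [P1], where
    [deriv_comp_bound] holds. *)
Lemma comp_lip : exists2 K : R, 0 <= K & forall t t' (x : H), I01 t -> I01 t' ->
  nrm (B 0 (P t x - P t' x)) <= K * `|t - t'| * nrm x.
Proof.
have [K K0 hK] := deriv_comp_bound; exists K => // t t' x It It'.
apply: (dense_nrm_le_dot dotE (sa_dense (sB I0))).
  by rewrite !mulr_ge0 ?nrm_ge0.
move=> y Dy; have D2 : dom (B 0) (P t x) by rewrite dB //; exact: rP.
have D3 : dom (B 0) (P t' x) by rewrite dB //; exact: rP.
have [D4 _] := saB (sB I0) D2 D3.
rewrite (sa_sym (sB I0) D4 Dy) dotBl.
have := @deriv01_lip R R[i]^o (fun s => dot (P s x) (B 0 y))
  (fun s => dot (P1 s x) (B 0 y)) (K * nrm x * nrm y).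
move=> h; apply: (le_trans (h _ _ t t' It It')).
- by move=> s Is; apply: is_deriv01_dot => //; exact: dP.
- move=> s Is; have D5 : dom (B 0) (P1 s x) by rewrite dB //; exact: rP1.
  rewrite -(sa_sym (sB I0) D5 Dy); apply: (le_trans (dot_le dotE _ _)).
  by rewrite ler_wpM2r ?nrm_ge0 // hK.
- by rewrite le_eqVlt; apply/orP; left; apply/eqP; ring.
Qed.

Lemma graph_nrm_triangle x : g x <= nrm (B 0 x) + nrm x.
Proof. by rewrite /g /graph_nrm; apply: (le_trans (nrmD_le _ _)); rewrite nrmZ nrm_i mul1r. Qed.

Lemma comp_graph_bounds : exists2 K : R, 0 <= K &
  (forall t (x : H), I01 t -> g (P t x) <= K * nrm x) /\
  forall t t' (x : H), I01 t -> I01 t' -> g (P t x - P t' x) <= K * `|t - t'| * nrm x.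
Proof.
have [K K0 hK] := comp_lip.
have [lb [L L0 hL]] := sa_comp_bounded I0 M0 (lP I0)
  (fun x => bP x I0) (fun x => rP x I0).
exists (K + L + M) => [|]; first by rewrite !addr_ge0.
split=> [t x It|t t' x It It'].
  apply: (le_trans (graph_nrm_triangle _)); rewrite mulrDl lerD ?bP //.
  have D2 : dom (B 0) (P t x) by rewrite dB //; exact: rP.
  have D3 : dom (B 0) (P 0 x) by rewrite dB //; exact: rP.
  have [D4 e] := saB (sB I0) D2 D3.
  have -> : B 0 (P t x) = B 0 (P t x - P 0 x) + B 0 (P 0 x) by rewrite e subrK.
  apply: (le_trans (nrmD_le _ _)); rewrite mulrDl lerD ?hL //.
  apply: (le_trans (hK t 0 x It I0)); rewrite ler_wpM2r ?nrm_ge0 // subr0.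
  move: It => /I01E/andP[t0 t1]; rewrite ger0_norm //.
  by rewrite -[leRHS]mulr1 ler_wpM2l.
apply: (le_trans (graph_nrm_triangle _)).
apply: (le_trans (lerD (hK t t' x It It') (lipP x It It'))).
rewrite -!mulrDl; apply: ler_wpM2r; first exact: nrm_ge0.
by apply: ler_wpM2r => //; lra.
Qed.

Lemma family_graph_bound : exists2 K : R, 0 <= K &
  forall t (x : H), I01 t -> D1 x -> nrm (B t x) <= K * g x.
Proof.
have [L L0 hL] := family_C1 dotE sB dB C1B.
exists (L + 1) => [|t x It Dx]; first by rewrite addr_ge0.
have := hL t 0 x It I0 Dx; have := nrm_A0_le_graph dotE sB dB Dx.
have := nrm_leB (B t x) (B 0 x); have := graph_nrm_ge0 B x.
rewrite subr0 -/g; move: It => /I01E/andP[t0 t1]; rewrite ger0_norm //.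
move=> g0 h1 h2 h3; have := ler_wpM2r g0 (ler_wpM2l L0 t1); lra.
Qed.

Lemma comp_bounds : exists2 K : R, 0 <= K &
  [/\ forall t, I01 t -> linear (fun x => B t (P t x)),
  forall t (x : H), I01 t -> nrm (B t (P t x)) <= K * nrm x &
  forall t t' (x : H), I01 t -> I01 t' ->
    nrm (B t (P t x) - B t' (P t' x)) <= K * `|t - t'| * nrm x].
Proof.
have [L L0 hL] := family_C1 dotE sB dB C1B.
have [N N0 hN] := family_graph_bound.
have [K K0 [h1 h2]] := comp_graph_bounds.
exists (N * K + L * K) => [|]; first by rewrite addr_ge0 ?mulr_ge0.
split=> [t It|t x It|t t' x It It'].
- by have [] := sa_comp_bounded It M0 (lP It) (fun x => bP x It) (fun x => rP x It).
- apply: (le_trans (hN t _ It (rP x It))); rewrite mulrDl -mulrA.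
  apply: (@le_trans _ _ (N * (K * nrm x))); first by rewrite ler_wpM2l // h1.
  by rewrite lerDl !mulr_ge0 ?nrm_ge0.
have D2 : dom (B t) (P t x) by rewrite dB //; exact: rP.
have D3 : dom (B t) (P t' x) by rewrite dB //; exact: rP.
have [D4 e] := saB (sB It) D2 D3; rewrite dB // in D4.
have -> : B t (P t x) - B t' (P t' x) =
    B t (P t x - P t' x) + (B t (P t' x) - B t' (P t' x)).
  rewrite e; apply: (dot_extl dotE) => w; rewrite !dot_lin; ring.
apply: (le_trans (nrmD_le _ _)); rewrite !mulrDl lerD //.
  apply: (le_trans (hN t _ It D4)); rewrite -!mulrA ler_wpM2l // mulrA; exact: h2.
apply: (le_trans (hL t t' _ It It' (rP x It'))).
have -> : L * K * `|t - t'| * nrm x = L * `|t - t'| * (K * nrm x) by ring.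
by rewrite ler_wpM2l ?h1 // mulr_ge0.
Qed.

End RelativeBounds.

(** * Lipschitz families *)

Section LipschitzFamilies.
Variables (R : realType) (H : completeNormedModType R[i]).
Variable dot : {dot H for Num.conj}.
Hypothesis dotE : forall x : H, `|x| ^+ 2 = dot x x.
Implicit Types (I : Type).

(** One constant serves for all indices: the index is the path parameter for resolvents, to be
    integrated out later, and [unit] for a single family. *)
Definition lipfam I (T : I -> R -> H -> H) (M : R) : Prop :=
  [/\ 0 <= M, forall i t, I01 t -> linear (T i t),
    forall i t (x : H), I01 t -> nrm (T i t x) <= M * nrm x &
    forall i t t' (x : H), I01 t -> I01 t' ->
      nrm (T i t x - T i t' x) <= M * `|t - t'| * nrm x].

Lemma lipfam_weaken I (T : I -> R -> H -> H) M N : M <= N -> lipfam T M -> lipfam T N.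
Proof.
move=> MN [M0 lT bT kT]; split=> [|//|j t x It|j t t' x It It'].
- exact: le_trans M0 MN.
- by apply: (le_trans (bT j t x It)); rewrite ler_wpM2r ?nrm_ge0.
apply: (le_trans (kT j t t' x It It')).
by rewrite ler_wpM2r ?nrm_ge0 // ler_wpM2r.
Qed.

Lemma lipfam_comp I (T S : I -> R -> H -> H) M N : lipfam T M -> lipfam S N ->
  lipfam (fun i t x => T i t (S i t x)) (2 * M * N).
Proof.
move=> [M0 lT bT kT] [N0 lS bS kS]; split=> [|i t It a x y|i t x It|i t t' x It It'].
- by rewrite !mulr_ge0.
- by rewrite lS // lT.
- apply: (@le_trans _ _ (M * N * nrm x)).
    by apply: (le_trans (bT i t _ It)); rewrite -mulrA ler_wpM2l ?bS.
  rewrite ler_wpM2r ?nrm_ge0 //; have := mulr_ge0 M0 N0; lra.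
have [_ _ _ TB _] := linear_facts (lT i t It).
have -> : T i t (S i t x) - T i t' (S i t' x) =
   T i t (S i t x - S i t' x) + (T i t (S i t' x) - T i t' (S i t' x)).
  by rewrite TB addrA subrK.
apply: (le_trans (nrmD_le _ _)).
have -> : 2 * M * N * `|t - t'| * nrm x = M * (N * `|t - t'| * nrm x) +
   M * `|t - t'| * (N * nrm x) by ring.
apply: lerD.
  by apply: (le_trans (bT i t _ It)); rewrite ler_wpM2l ?kS.
by apply: (le_trans (kT i t t' _ It It')); rewrite ler_wpM2l ?bS // mulr_ge0.
Qed.

Lemma lipfam_lin I (T S : I -> R -> H -> H) M N (c : R[i]) : lipfam T M -> lipfam S N ->
  lipfam (fun i t x => T i t x + c *: S i t x) (M + nrm c * N).
Proof.
move=> [M0 lT bT kT] [N0 lS bS kS]; split=> [|i t It a x y|i t x It|i t t' x It It'].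
- by rewrite addr_ge0 ?mulr_ge0 ?nrm_ge0.
- rewrite lS // lT //; apply: (dot_extl dotE) => z; rewrite !dot_lin; ring.
- apply: (le_trans (nrmD_le _ _)); rewrite mulrDl lerD ?bT // nrmZ -mulrA.
  by rewrite ler_wpM2l ?nrm_ge0 ?bS.
have -> : T i t x + c *: S i t x - (T i t' x + c *: S i t' x) =
   (T i t x - T i t' x) + c *: (S i t x - S i t' x).
  apply: (dot_extl dotE) => z; rewrite !dot_lin; ring.
apply: (le_trans (nrmD_le _ _)); rewrite !mulrDl lerD ?kT // nrmZ -!mulrA.
by rewrite ler_wpM2l ?nrm_ge0 // mulrA kS.
Qed.

Lemma lipfam_adj I (T S : I -> R -> H -> H) M : lipfam T M ->
  (forall i t x y, I01 t -> dot (T i t x) y = dot x (S i t y)) -> lipfam S M.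
Proof.
move=> [M0 lT bT kT] adj; split=> [//|i t It a x y|i t x It|i t t' x It It'].
- apply: (dot_extr dotE) => z; rewrite dotDr dotZr -!adj // dotDr dotZr //.
- apply: (nrm_le_dot dotE) => [|y]; first by rewrite mulr_ge0 ?nrm_ge0.
  rewrite dotC nrm_conj -adj //; apply: (le_trans (dot_le dotE _ _)).
  by rewrite mulrAC ler_wpM2r ?nrm_ge0 ?bT.
apply: (nrm_le_dot dotE) => [|y]; first by rewrite !mulr_ge0 ?nrm_ge0.
rewrite dotC nrm_conj dotBr -!adj // -dotBl; apply: (le_trans (dot_le dotE _ _)).
by rewrite mulrAC ler_wpM2r ?nrm_ge0 ?kT.
Qed.

End LipschitzFamilies.

(** * The spectral projector *)

Section Projector.
Variables (R : realType) (H : completeNormedModType R[i]).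
Variable dot : {dot H for Num.conj}.
Hypothesis dotE : forall x : H, `|x| ^+ 2 = dot x x.
Variables (A : R -> operator H) (D : set H) (gamma : R -> R[i]).
Hypothesis sA : forall t, I01 t -> self_adjoint dot (A t).
Hypothesis dA : forall t, I01 t -> dom (A t) = D.
Hypothesis C2A : forall x, D x -> Ck01 2 (fun t => A t x).
Hypothesis cpath : closed_path gamma.
Hypothesis rA : forall t s, I01 t -> I01 s -> resolvent_set (A t) (gamma s).

Let Rs t s := R0 A t (gamma s).
(* A variable, lest rewriting with [dotZl] unfold [P0]. *)
Variable P : R -> H -> H.
Hypothesis PE : forall t x, P t x = P0 dot A gamma t x.
Let cgamma : cont01 gamma := cont01_path cpath.

Let Rlin t s : I01 t -> I01 s -> linear (Rs t s).
Proof. by move=> It Is; exact: (res_lin dotE (sA It) (rA It Is)). Qed.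

Let DR t s x : I01 t -> I01 s -> D (Rs t s x).
Proof. by move=> It Is; rewrite -(dA It); exact: res_dom (rA It Is) x. Qed.

Lemma resolvent_lip : exists2 M : R, 0 <= M & forall t, I01 t ->
  (forall s (x : H), I01 s -> nrm (Rs t s x) <= M * nrm x) /\
  (forall s s' (x : H), I01 s -> I01 s' ->
     nrm (Rs t s x - Rs t s' x) <= M * nrm x * nrm (gamma s - gamma s')).
Proof.
have [R' [M [M0 _ [h1 _ h3] _ _]]] := resolvent_estimates dotE sA dA C2A cgamma rA.
have ng x : D x -> nrm x <= graph_nrm A x := fun Dx => nrm_le_graph dotE sA dA Dx.
exists M => // t It; split=> [s x Is|s s' x Is Is'].
  by apply: le_trans (h1 t s x It Is); apply: ng; exact: DR.
rewrite mulrAC; apply: le_trans (h3 t s s' x It Is Is'); apply: ng.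
have I0 := I01_0 R.
rewrite -(dA I0); have D1 := DR x It Is; have D2 := DR x It Is'.
by rewrite -(dA I0) in D1 D2; have [] := saB (sA I0) D1 D2.
Qed.

Lemma cont01_resolvent t x y : I01 t -> cont01 (fun s => dot (Rs t s x) y).
Proof.
move=> It; have [M M0 hM] := resolvent_lip; have [_ h] := hM t It.
apply: (cont01_dot_lip cpath dotE (C := M * nrm x)).
  by rewrite mulr_ge0 ?nrm_ge0.
by move=> s s' Is Is'; exact: h.
Qed.

Lemma P0_dot t x y : I01 t -> dot (P t x) y = contour gamma (fun s => dot (Rs t s x) y).
Proof.
move=> It; have [M M0 hM] := resolvent_lip; have [h _] := hM t It; rewrite PE.
apply: (contour_vecP cpath dotE (f := fun s => Rs t s x) (M := M * nrm x)).
  by move=> z; exact: cont01_resolvent.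
by move=> s Is; exact: h.
Qed.

Lemma contour_nrm_le : exists2 K : R, 0 <= K & forall (f : R -> H) (v : H) (M : R), 0 <= M ->
  (forall y, cont01 (fun s => dot (f s) y)) ->
  (forall y, dot v y = contour gamma (fun s => dot (f s) y)) ->
  (forall s, I01 s -> nrm (f s) <= M) -> nrm v <= K * M.
Proof.
have [K K0 hK] := contour_le cpath; exists K => // f v M M0 cf hv hM.
apply: (nrm_le_dot dotE) => [|y]; first by rewrite mulr_ge0.
rewrite hv -mulrA; apply: hK => // s Is.
by apply: (le_trans (dot_le dotE _ _)); rewrite ler_wpM2r ?nrm_ge0 ?hM.
Qed.

Lemma P0_linear t : I01 t -> linear (P t).
Proof.
move=> It a x y; apply: (dot_extl dotE) => z.
rewrite dotDl dotZl !P0_dot // -contourZ //; last exact: cont01_resolvent.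
rewrite -contourD //; try exact: cont01_resolvent; last first.
  by apply: cont01M; [exact: cont01_cst | exact: cont01_resolvent].
by apply: eq_contour => s Is; rewrite Rlin // dotDl dotZl.
Qed.

Lemma P0_bound : exists2 C : R, 0 <= C &
  forall t (x : H), I01 t -> nrm (P t x) <= C * nrm x.
Proof.
have [M M0 hM] := resolvent_lip; have [K K0 hK] := contour_nrm_le.
exists (K * M) => [|t x It]; first by rewrite mulr_ge0.
have [h _] := hM t It; rewrite -mulrA; apply: (hK (fun s => Rs t s x)).
- by rewrite mulr_ge0 ?nrm_ge0.
- by move=> y; exact: cont01_resolvent.
- by move=> y; exact: P0_dot.
- by move=> s Is; exact: h.
Qed.

Let cont01_AR t x y : I01 t -> cont01 (fun s => dot (A t (Rs t s x)) y).
Proof.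
move=> It; apply: (@cont01_ext _ (fun s => dot x y + gamma s * dot (Rs t s x) y)).
  by move=> s Is; rewrite /Rs /R0 A_res ?dotDl ?dotZl //; exact: rA.
apply: cont01D; first exact: cont01_cst.
by apply: cont01M => //; exact: cont01_resolvent.
Qed.

(** A self-adjoint operator passes under the contour integral: [sa_max] identifies [A t (P t x)]
    with the integral [w] of [A t (Rs t s x) = x + gamma s *: Rs t s x]. *)
Lemma P0_range : exists2 C : R, 0 <= C & forall t (x : H), I01 t ->
  [/\ D (P t x), nrm (A t (P t x)) <= C * nrm x &
  forall y, dot (A t (P t x)) y = contour gamma (fun s => dot (A t (Rs t s x)) y)].
Proof.
have [M M0 hM] := resolvent_lip; have [K K0 hK] := contour_nrm_le.
have [G G0 hG] := cont01_bounded cgamma.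
exists (K * (1 + G * M)) => [|t x It]; first by rewrite mulr_ge0 ?addr_ge0 ?mulr_ge0.
have [h _] := hM t It.
have bAR s : I01 s -> nrm (A t (Rs t s x)) <= (1 + G * M) * nrm x.
  move=> Is; rewrite /Rs /R0 A_res; last exact: rA.
  apply: (le_trans (nrmD_le _ _)); rewrite mulrDl mul1r lerD2l nrmZ -mulrA.
  by rewrite ler_pM ?nrm_ge0 ?hG ?h.
pose w := contour_vec gamma dot (fun s => A t (Rs t s x)).
have wP y : dot w y = contour gamma (fun s => dot (A t (Rs t s x)) y).
  by apply: (contour_vecP cpath dotE _ bAR) => z; exact: cont01_AR.
have [DP AP] : dom (A t) (P t x) /\ A t (P t x) = w.
  apply: (sa_max (sA It)) => u Du; rewrite dotC [RHS]dotC; congr conjc.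
  rewrite wP P0_dot //; apply: eq_contour => s Is.
  by rewrite (sa_sym (sA It)) // dA //; exact: DR.
rewrite -(dA It); split=> //; rewrite AP // -mulrA.
apply: (hK (fun s => A t (Rs t s x))) => //.
- by rewrite mulr_ge0 ?nrm_ge0 // addr_ge0 ?mulr_ge0.
- by move=> y; exact: cont01_AR.
Qed.

Lemma P0_comm t x : I01 t -> D x -> A t (P t x) = P t (A t x).
Proof.
move=> It Dx; apply: (dot_extl dotE) => y.
have [C _ hC] := P0_range; have [_ _ ->] := hC t x It.
rewrite P0_dot //; apply: eq_contour => s Is.
have Dx' : dom (A t) x by rewrite dA.
by rewrite /Rs /R0 (res_A dotE (sA It) (rA It Is) Dx') (A_res (rA It Is)).
Qed.

Lemma P0_resolvent t z x : I01 t -> resolvent_set (A t) z ->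
  P t (resolvent (A t) z x) = resolvent (A t) z (P t x).
Proof.
move=> It rz; apply: (dot_extl dotE) => y.
rewrite (res_adj dotE (sA It)) // !P0_dot //; apply: eq_contour => s Is.
by rewrite -(res_adj dotE (sA It)) // /Rs /R0 (res_comm dotE (sA It)) //; exact: rA.
Qed.

(** Divide [R(c) (A - z) x = x + (c - z) R(c) x] by [c - z] and integrate over the path. *)
Lemma P0_winding t z x y : I01 t -> D x -> (forall s, I01 s -> gamma s != z) ->
  dot (P t x - winding gamma z *: x) y =
  contour gamma (fun s => (gamma s - z)^-1 * dot (Rs t s (A t x - z *: x)) y).
Proof.
move=> It Dx gz; have Dx' : dom (A t) x by rewrite dA.
have cinv : cont01 (fun s => (gamma s - z)^-1).
  apply: cont01V => [|s Is]; last by rewrite subr_eq0 gz.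
  by apply: cont01D => //; exact: cont01_cst.
rewrite dotBl dotZl P0_dot // -[X in _ - X]opprK opprK -mulNr -winding_contour.
rewrite [_ * dot x y]mulrC -contourZ // -contourD //.
- apply: eq_contour => s Is.
  have gz0 : gamma s - z != 0 by rewrite subr_eq0 gz.
  have [_ _ _ RB RZ] := linear_facts (Rlin It Is).
  rewrite RB RZ {2}/Rs /R0 (res_A dotE (sA It) (rA It Is) Dx') -/(R0 A t (gamma s)) -/(Rs t s).
  rewrite dotBl dotDl !dotZl; apply: (mulfI gz0); rewrite [RHS]mulrA divff // mul1r.
  by rewrite mulrDr [dot x y * _]mulrC mulrA divff // mul1r; ring.
- exact: cont01_resolvent.
- by apply: cont01M => //; exact: cont01_cst.
Qed.

(** A real point closer to the path than this would inherit the lower bound of [graph_nrm_uniform]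
    and so be regular. *)
Lemma path_dist_spectrum : exists2 d : R, 0 < d & forall t s (mu : R), I01 t -> I01 s ->
  ~ resolvent_set (A t) mu%:C -> d <= nrm (gamma s - mu%:C).
Proof.
have [M M0 hM] := graph_nrm_uniform dotE sA dA C2A cgamma rA.
have ng x : D x -> nrm x <= graph_nrm A x := fun Dx => nrm_le_graph dotE sA dA Dx.
have M1 : 0 < 2 * (M + 1) by lra.
exists (2 * (M + 1))^-1 => [|t s mu It Is nr]; first by rewrite invr_gt0.
rewrite leNgt; apply/negP => hlt; apply: nr.
apply: (sa_resolvent_set dotE (sA It) (M := 2 * M)) => x; rewrite dA // => Dx.
have h1 : nrm x <= M * nrm (A t x - gamma s *: x).
  by apply: (le_trans (ng x Dx)); exact: hM.
have h2 : nrm (A t x - gamma s *: x) <= nrm (A t x - mu%:C *: x) +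
    nrm (gamma s - mu%:C) * nrm x.
  rewrite -nrmZ; have -> : A t x - gamma s *: x = (A t x - mu%:C *: x) -
        (gamma s - mu%:C) *: x.
    apply: (dot_extl dotE) => w; rewrite !dot_lin; ring.
  exact: nrmB_le.
have h3 : nrm (gamma s - mu%:C) * nrm x <= (2 * (M + 1))^-1 * nrm x.
  by rewrite ler_wpM2r ?nrm_ge0 // ltW.
have h4 : M * (2 * (M + 1))^-1 <= 1 / 2 by rewrite ler_pdivrMr //; lra.
have := ler_wpM2r (nrm_ge0 x) h4; have := ler_wpM2l M0 h2; have := ler_wpM2l M0 h3.
move: h1; move: (nrm x) (nrm (A t x - gamma s *: x)) (nrm (A t x - mu%:C *: x)).
move: (nrm (gamma s - mu%:C)) ((2 * (M + 1))^-1) => *; lra.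
Qed.

Hypothesis wA : forall t (mu : R), I01 t -> ~ resolvent_set (A t) mu%:C ->
  winding gamma mu%:C = 0 \/ winding gamma mu%:C = 1.

Lemma P0_projector t : I01 t ->
  (forall x, P t (P t x) = P t x) /\ (forall x y, dot (P t x) y = dot x (P t y)).
Proof.
move=> It; have [C C0 bP] := P0_bound; have lP := P0_linear It.
have [P0' PD PN PB PZ] := linear_facts lP.
have [Q [lQ adjQ bQ]] := adjointP dotE lP C0 (fun x => bP t x It).
have adjQ' x y : dot (Q x) y = dot x (P t y) by rewrite dotC -adjQ -dotC.
have [d d0 hd] := path_dist_spectrum.
have [M M0 hM] := resolvent_lip; have [hR _] := hM t It.
have [K K0 hK] := contour_le cpath.
pose C1 := K * (d^-1 * M).
have C10 : 0 <= C1 by rewrite !mulr_ge0 ?invr_ge0 // ltW.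
have inv_le (mu : R) s : ~ resolvent_set (A t) mu%:C -> I01 s ->
    nrm ((gamma s - mu%:C)^-1) <= d^-1.
  move=> nr Is; rewrite nrmV lef_pV2 ?posrE //; first exact: hd nr.
  by apply: (lt_le_trans d0); exact: hd nr.
have gz (mu : R) s : ~ resolvent_set (A t) mu%:C -> I01 s -> gamma s != mu%:C.
  move=> nr Is; apply/eqP => e; have := hd t s mu It Is nr.
  by rewrite e subrr nrm0 leNgt d0.
have cinv (mu : R) : ~ resolvent_set (A t) mu%:C ->
    cont01 (fun s => (gamma s - mu%:C)^-1).
  move=> nr; apply: cont01V => [|s Is]; last by rewrite subr_eq0 gz.
  by apply: cont01D => //; exact: cont01_cst.
have hP (mu : R) (x : H) : ~ resolvent_set (A t) mu%:C -> D x ->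
    nrm (P t x - winding gamma mu%:C *: x) <= C1 * nrm (A t x - mu%:C *: x).
  move=> nr Dx; apply: (nrm_le_dot dotE) => [|y]; first by rewrite mulr_ge0 ?nrm_ge0.
  rewrite P0_winding // => [|s Is]; last exact: gz.
  rewrite /C1 -!mulrA; apply: hK.
    by apply: cont01M; [exact: cinv | exact: cont01_resolvent].
  move=> s Is; rewrite nrmM ler_pM ?nrm_ge0 ?inv_le //.
  by apply: (le_trans (dot_le dotE _ _)); rewrite mulrA ler_wpM2r ?nrm_ge0 ?hR.
(* The same bound for the adjoint [Q]: the winding number is real, and [A t - mu] is moved across
   the resolvent from [x] to [y]. *)
have hQ (mu : R) (y : H) : ~ resolvent_set (A t) mu%:C -> D y ->
    nrm (Q y - winding gamma mu%:C *: y) <= C1 * nrm (A t y - mu%:C *: y).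
  move=> nr Dy; apply: (dense_nrm_le_dot dotE (sa_dense (sA It))).
    by rewrite mulr_ge0 ?nrm_ge0.
  move=> x; rewrite dA // => Dx.
  have wr : conjc (winding gamma mu%:C) = winding gamma mu%:C.
    by case: (wA It nr) => ->; rewrite ?conjc0 ?conjc1.
  have -> : dot (Q y - winding gamma mu%:C *: y) x =
      conjc (dot (P t x - winding gamma mu%:C *: x) y).
    by rewrite -dotC !dot_lin adjQ' wr.
  rewrite nrm_conj P0_winding // => [|s Is]; last exact: gz.
  rewrite /C1 -!mulrA [_ * nrm x]mulrC.
  have Dx' : dom (A t) x by rewrite dA.
  have -> : contour gamma (fun s => (gamma s - mu%:C)^-1 * dot (Rs t s (A t x - mu%:C *: x)) y)
     = contour gamma (fun s => (gamma s - mu%:C)^-1 * dot (Rs t s x) (A t y - mu%:C *: y)).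
    apply: eq_contour => s Is; congr (_ * _).
    have [_ _ _ RB RZ] := linear_facts (Rlin It Is).
    rewrite RB RZ {1}/Rs /R0 (res_A dotE (sA It) (rA It Is) Dx') -(A_res (rA It Is)).
    rewrite !dot_lin conjc_real (sa_sym (sA It)) ?dA //; exact: DR.
  apply: hK.
    by apply: cont01M; [exact: cinv | exact: cont01_resolvent].
  move=> s Is; rewrite nrmM ler_pM ?nrm_ge0 ?inv_le //.
  by apply: (le_trans (dot_le dotE _ _)); rewrite mulrA ler_wpM2r ?nrm_ge0 ?hR.
have rNi : resolvent_set (A t) (- 'i%C) := sa_Ni dotE (sA It).
have T0 : forall x, P t x - Q (P t x) = 0.
  apply: (@spectral_vanish R H dot dotE (A t) (sA It) (fun x => P t x - Q (P t x))
     ((1 + C) * C1 + C1 * C) (C + C * C)).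
  - move=> a x y; rewrite lP lQ.
    apply: (dot_extl dotE) => z; rewrite !dot_lin; ring.
  - move=> x; apply: (le_trans (nrmB_le _ _)); rewrite mulrDl lerD ?bP // -mulrA.
    by apply: (le_trans (bQ _)); rewrite ler_wpM2l // bP.
  - by rewrite addr_ge0 // mulr_ge0.
  - by rewrite addr_ge0 // mulr_ge0 // addr_ge0.
  - have [_ _ _ RB _] := linear_facts (res_lin dotE (sA It) rNi).
    move=> x; rewrite P0_resolvent // RB; congr (_ - _).
    apply: (dot_extl dotE) => y.
    rewrite adjQ' !(res_adj dotE (sA It)) // adjQ' P0_resolvent //.
    exact: (resolvent_set_conj dotE (sA It) rNi).
  move=> mu x nr; rewrite dA // => Dx; rewrite mulrDl.
  (* With winding number 0, [hP] bounds [P x], hence [T x]. With winding number 1,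
     [T x = (1 - Q) (P x)], so [hQ] is used at [P x], where [A t - mu] commutes with [P]. *)
  case: (wA It nr) => w.
    have := hP mu x nr Dx; rewrite w scale0r subr0 => h.
    apply: (@le_trans _ _ ((1 + C) * C1 * nrm (A t x - mu%:C *: x))); last first.
      by rewrite lerDl mulr_ge0 ?nrm_ge0 // mulr_ge0.
    apply: (le_trans (nrmB_le _ _)); rewrite -mulrA.
    apply: (@le_trans _ _ ((1 + C) * nrm (P t x))).
      by rewrite mulrDl mul1r lerD2l.
    by rewrite ler_wpM2l // addr_ge0.
  have [B _ hB] := P0_range; have [DP _ _] := hB t x It.
  have := hQ mu (P t x) nr DP; rewrite w scale1r nrmB => h.
  apply: (@le_trans _ _ (C1 * C * nrm (A t x - mu%:C *: x))); last first.
    by rewrite lerDr mulr_ge0 ?nrm_ge0 // mulr_ge0 // addr_ge0.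
  apply: (le_trans h); rewrite P0_comm // -PZ -PB -mulrA ler_wpM2l //.
  exact: bP.
(* From [P = P^* P] it follows that [P] is self-adjoint, and then that [P = P^2]. *)
have key x y : dot (P t x) y = dot (P t x) (P t y).
  have /eqP := T0 x; rewrite subr_eq0 => /eqP {1}->.
  by rewrite adjQ'.
have sym x y : dot (P t x) y = dot x (P t y).
  by rewrite key dotC [RHS]dotC; congr conjc; rewrite [RHS]key.
split=> // x; apply: (dot_extl dotE) => y.
by rewrite sym -key.
Qed.

Lemma P0_C11 : exists (P1 : R -> H -> H) (M : R), [/\ 0 <= M,
  forall t, I01 t -> linear (P1 t),
  forall t (x : H), I01 t -> nrm (P1 t x) <= M * nrm x,
  forall t t' (x : H), I01 t -> I01 t' -> nrm (P t x - P t' x) <= M * `|t - t'| * nrm x &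
  (forall t t' (x : H), I01 t -> I01 t' -> nrm (P1 t x - P1 t' x) <= M * `|t - t'| * nrm x) /\
  forall t t' (x : H), I01 t -> I01 t' ->
    nrm (P t' x - P t x - (t' - t)%:C *: P1 t x) <= M * (t' - t) ^+ 2 * nrm x].
Proof.
have [R' [M [M0 lR' [h1 h2 h3] [k1 k2 k3] l1]]] :=
  resolvent_estimates dotE sA dA C2A cgamma rA.
have ng x : D x -> nrm x <= graph_nrm A x := fun Dx => nrm_le_graph dotE sA dA Dx.
have DB x y : D x -> D y -> D (x - y).
  move=> Dx Dy; have I0 := I01_0 R.
  have [] := saB (sA I0) (x := x) (y := y); by rewrite ?dA.
have cR t x y : I01 t -> cont01 (fun s => dot (Rs t s x) y).
  by move=> It; exact: cont01_resolvent.
have cR' t x y : I01 t -> cont01 (fun s => dot (R' t s x) y).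
  move=> It; apply: (cont01_dot_lip cpath dotE (C := M * nrm x)).
    by rewrite mulr_ge0 ?nrm_ge0.
  by move=> s s' Is Is'; rewrite mulrAC; exact: k3.
have Pd t x y : I01 t -> dot (P t x) y = contour gamma (fun s => dot (Rs t s x) y).
  by move=> It; exact: P0_dot.
have [P1 P1E] : exists P1 : R -> H -> H, forall t x y, I01 t ->
    dot (P1 t x) y = contour gamma (fun s => dot (R' t s x) y).
  exists (fun t x => contour_vec gamma dot (fun s => R' t s x)) => t x y It.
  apply: (contour_vecP cpath dotE (M := M * nrm x)) => [z|s Is]; first exact: cR'.
  exact: k1.
have [K K0 hK] := contour_nrm_le.
have M'0 (c r : R) (x : H) : 0 <= c -> 0 <= r -> 0 <= c * r * nrm x.
  by move=> c0 r0; rewrite !mulr_ge0 ?nrm_ge0.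
have cB f1 f2 : cont01 f1 -> cont01 f2 -> cont01 (fun s => f1 s - f2 s).
  move=> c1 c2; apply: (@cont01_ext _ (fun s => f1 s + (-1) * f2 s)).
    by move=> s _; rewrite mulN1r.
  by apply: cont01D => //; apply: cont01M => //; exact: cont01_cst.
exists P1, (K * M); split=> [|t It a x y|t x It|t t' x It It'|].
- by rewrite mulr_ge0.
- apply: (dot_extl dotE) => z; rewrite dotDl dotZl !P1E // -(contourZ cpath) //; last exact: cR'.
  rewrite -(contourD cpath) //; try exact: cR'; last first.
    by apply: cont01M; [exact: cont01_cst | exact: cR'].
  by apply: eq_contour => s Is; rewrite lR' // dotDl dotZl.
- rewrite -mulrA; apply: (hK (fun s => R' t s x)) => //.
  + by rewrite mulr_ge0 ?nrm_ge0.
  + by move=> y; exact: cR'.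
  + by move=> y; exact: P1E.
  + by move=> s Is; exact: k1.
- rewrite -!mulrA; apply: (hK (fun s => Rs t s x - Rs t' s x)).
  + by rewrite mulrA M'0.
  + move=> y; apply: (@cont01_ext _ (fun s => dot (Rs t s x) y - dot (Rs t' s x) y)).
      by move=> s _; rewrite dotBl.
    by apply: cB; exact: cR.
  + move=> y; rewrite dotBl !Pd // -(contourB cpath) //; try exact: cR.
    by apply: eq_contour => s _; rewrite dotBl.
  + move=> s Is; rewrite mulrA; apply: le_trans (h2 t t' s x It It' Is).
    by apply: ng; apply: DB; exact: DR.
split=> t t' x It It'.
  rewrite -!mulrA; apply: (hK (fun s => R' t s x - R' t' s x)).
  + by rewrite mulrA M'0.
  + move=> y; apply: (@cont01_ext _ (fun s => dot (R' t s x) y - dot (R' t' s x) y)).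
      by move=> s _; rewrite dotBl.
    by apply: cB; exact: cR'.
  + move=> y; rewrite dotBl !P1E // -(contourB cpath) //; try exact: cR'.
    by apply: eq_contour => s _; rewrite dotBl.
  + by move=> s Is; rewrite mulrA; exact: k2.
have cZ (c : R[i]) f : cont01 f -> cont01 (fun s => c * f s).
  by move=> cf; apply: cont01M => //; exact: cont01_cst.
have -> : K * M * (t' - t) ^+ 2 * nrm x = K * (M * (t' - t) ^+ 2 * nrm x) by ring.
apply: (hK (fun s => Rs t' s x - Rs t s x - (t' - t)%:C *: R' t s x)).
- by rewrite M'0 // sqr_ge0.
- move=> y; apply: (@cont01_ext _ (fun s => dot (Rs t' s x) y - dot (Rs t s x) y
     - (t' - t)%:C * dot (R' t s x) y)).
    by move=> s _; rewrite !dotBl dotZl.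
  by apply: (cB); [apply: (cB); exact: cR | apply: cZ; exact: cR'].
- move=> y; rewrite !dotBl dotZl !Pd // P1E // -(contourZ cpath); last exact: cR'.
  rewrite -(contourB cpath); try exact: cR.
  rewrite -(contourB cpath).
  + by apply: eq_contour => s _; rewrite !dotBl dotZl.
  + by apply: cB; exact: cR.
  + by apply: cZ; exact: cR'.
- by move=> s Is; exact: l1.
Qed.

Variable P1 : R -> H -> H.
Hypothesis P1E : forall t x, P1 t x = dP0 dot A gamma t x.

(** Reads an identity for [P'] off an expansion in [t' - t] with quadratic remainder, without a
    product rule for strong derivatives. *)
Lemma quadratic_small (V : normedModType R[i]) (w : V) (t C : R) : I01 t ->
  (forall t', I01 t' -> nrm ((t' - t)%:C *: w) <= C * (t' - t) ^+ 2) -> w = 0.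
Proof.
move=> It h; apply: nrm_eq0; apply/eqP; rewrite eq_le nrm_ge0 andbT.
apply/ler_addgt0Pl => e e0; rewrite addr0.
pose d := e / (`|C| + 1).
have d0 : 0 < d by rewrite divr_gt0.
have PF := dnbhs_I01_proper It.
have : (within I01 t^') [set s | I01 s /\ s != t /\ `|s - t| < d].
  by apply/(dnbhs_I01P _ It); exists d.
move=> /filter_ex[s [Is [st sd]]].
have p0 : 0 < `|s - t| by rewrite normr_gt0 subr_eq0.
have := h s Is; rewrite nrmZr -(real_normK (num_real (s - t))) expr2 mulrA.
rewrite mulrC ler_pM2r // => h1; apply: (le_trans h1).
have h2 : `|s - t| * (`|C| + 1) < e by rewrite -ltr_pdivlMr.
have := ler_norm C; have := ltW p0; move: h2.
set u := `|s - t|; set c := `|C| => h2 u0 Cc.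
have := ler_wpM2r u0 Cc; lra.
Qed.

Lemma dP0_facts : exists2 M : R, 0 <= M &
  [/\ forall t, I01 t -> linear (P1 t),
  forall t (x : H), I01 t -> nrm (P1 t x) <= M * nrm x,
  forall t t' (x : H), I01 t -> I01 t' -> nrm (P t x - P t' x) <= M * `|t - t'| * nrm x,
  forall t t' (x : H), I01 t -> I01 t' -> nrm (P1 t x - P1 t' x) <= M * `|t - t'| * nrm x &
  [/\ forall t x, I01 t -> is_deriv01 (fun s => P s x) t (P1 t x),
    forall t x, I01 t -> P1 t (P t x) + P t (P1 t x) = P1 t x,
    forall t x, I01 t -> P t (P1 t (P t x)) = 0 &
    forall t x y, I01 t -> dot (P1 t x) y = dot x (P1 t y)]].
Proof.
have [Q [M [M0 lQ bQ lipP [lipQ tP]]]] := P0_C11.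
have dP t x : I01 t -> is_deriv01 (fun s => P s x) t (Q t x).
  move=> It; apply/(is_deriv01P _ _ It) => e e0.
  have c0 : 0 < M * nrm x + 1 by have := mulr_ge0 M0 (nrm_ge0 x); lra.
  exists (e / (M * nrm x + 1)); first by rewrite divr_gt0.
  move=> s Is; rewrite ltr_pdivlMr // => h; apply: (le_trans (tP t s x It Is)).
  rewrite -(real_normK (num_real (s - t))) expr2 mulrAC mulrA.
  apply: ler_wpM2r => //; apply: ltW; apply: le_lt_trans h.
  by rewrite mulrC ler_wpM2l // lerDl.
have QE t x : I01 t -> P1 t x = Q t x.
  move=> It; rewrite P1E /dP0.
  have -> : (fun s => P0 dot A gamma s x) = (fun s => P s x).
    by apply/funext => s; rewrite PE.
  exact: deriv01E (dP t x It).
have [C C0 bP] := P0_bound.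
have PP t : I01 t -> _ := P0_projector (t := t).
have lP t : I01 t -> linear (P t) := P0_linear (t := t).
have prod t x : I01 t -> Q t (P t x) + P t (Q t x) = Q t x.
  move=> It; apply/eqP; rewrite eq_sym -subr_eq0; apply/eqP.
  have [PPt _] := PP t It.
  have [_ PD PN PB PZ] := linear_facts (lP t It).
  apply: (@quadratic_small H _ t (M * nrm x + M * M * nrm x + M * (C * nrm x) + C * (M * nrm x))) => // s Is.
  have [PPs _] := PP s Is; have [_ SD SN SB SZ] := linear_facts (lP s Is).
  (* The identity [P_s^2 = P_s] expanded around [t]; each of the four terms is quadratic in
     [s - t]. *)
  have e : (s - t)%:C *: (Q t x - (Q t (P t x) + P t (Q t x))) =
     - (P s x - P t x - (s - t)%:C *: Q t x)
     + (P s (P s x - P t x) - P t (P s x - P t x))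
     + (P s (P t x) - P t (P t x) - (s - t)%:C *: Q t (P t x))
     + P t (P s x - P t x - (s - t)%:C *: Q t x).
    rewrite SB !PB PZ PPs PPt.
    apply: (dot_extl dotE) => w; rewrite !dot_lin; ring.
  rewrite e !mulrDl.
  have h1 := tP t s x It Is; have h2 := lipP s t (P s x - P t x) Is It.
  have h3 := lipP s t x Is It; have h4 := tP t s (P t x) It Is.
  have h5 := bP t (P s x - P t x - (s - t)%:C *: Q t x) It.
  have r2 : (s - t) ^+ 2 = `|s - t| * `|s - t|.
    by rewrite -(real_normK (num_real (s - t))) expr2.
  apply: (le_trans (nrmD_le _ _)); apply: lerD; last first.
    apply: (le_trans h5); rewrite -mulrA ler_wpM2l //; apply: (le_trans h1).
    by rewrite mulrAC.
  apply: (le_trans (nrmD_le _ _)); apply: lerD; last first.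
    apply: (le_trans h4); rewrite [M * (C * nrm x) * _]mulrAC.
    by rewrite ler_wpM2l ?bP // mulr_ge0 // sqr_ge0.
  apply: (le_trans (nrmD_le _ _)); apply: lerD; first by rewrite nrmN mulrAC.
  apply: (le_trans h2).
  have -> : M * M * nrm x * (s - t) ^+ 2 = M * `|s - t| * (M * `|s - t| * nrm x).
    by rewrite r2; ring.
  by rewrite ler_wpM2l // mulr_ge0.
exists M => //; split=> [t It a x y|t x It|//|t t' x It It'|].
- by rewrite !QE //; exact: lQ.
- by rewrite QE //; exact: bQ.
- by rewrite !QE //; exact: lipQ.
split=> [t x It|t x It|t x It|t x y It].
- by rewrite QE //; exact: dP.
- by rewrite !QE //; exact: prod.
- rewrite QE //; have [PPt _] := PP t It.
  have [_ PD _ _ _] := linear_facts (lP t It).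
  have := prod t (P t x) It; rewrite PPt => /(congr1 (P t)).
  rewrite PD PPt => /eqP; rewrite addrC -subr_eq0 addrK => /eqP //.
rewrite !QE //; have [_ sym] := PP t It.
apply/eqP; rewrite -subr_eq0; apply/eqP.
apply: (@quadratic_small R[i]^o _ t (2 * M * nrm x * nrm y)) => // s Is.
have [_ syms] := PP s Is.
have -> : (s - t)%:C *: (dot (Q t x) y - dot x (Q t y) : R[i]^o) =
   dot x (P s y - P t y - (s - t)%:C *: Q t y) - dot (P s x - P t x - (s - t)%:C *: Q t x) y.
  rewrite !dot_lin conjc_real !sym !syms.
  rewrite [LHS](_ : _ = (s - t)%:C * (dot (Q t x) y - dot x (Q t y))) //.
  ring.
have h1 := tP t s x It Is; have h2 := tP t s y It Is.
have h3 := dot_le dotE x (P s y - P t y - (s - t)%:C *: Q t y).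
have h4 := dot_le dotE (P s x - P t x - (s - t)%:C *: Q t x) y.
apply: (le_trans (nrmB_le _ _)).
have h5 := ler_wpM2l (nrm_ge0 x) h2; have h6 := ler_wpM2r (nrm_ge0 y) h1.
have -> : 2 * M * nrm x * nrm y * (s - t) ^+ 2 =
  nrm x * (M * (s - t) ^+ 2 * nrm y) + M * (s - t) ^+ 2 * nrm x * nrm y by ring.
by apply: lerD; [exact: le_trans h3 h5 | exact: le_trans h4 h6].
Qed.

(** * The commutator equation *)

Variables (Z : R -> H -> H) (KZ : R).
Hypothesis famZ : lipfam (fun _ : unit => Z) KZ.
Hypothesis ZP : forall t x, I01 t -> Z t (P t x) = Z t x.
Hypothesis PZ : forall t x, I01 t -> P t (Z t x) = 0.

Let sI := {s : R | I01 s}.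

Let famR : exists M : R, lipfam (fun i : sI => Rs^~ (sval i)) M.
Proof.
have [R' [M [M0 _ [h1 h2 _] _ _]]] := resolvent_estimates dotE sA dA C2A cgamma rA.
have ng x : D x -> nrm x <= graph_nrm A x := fun Dx => nrm_le_graph dotE sA dA Dx.
have I0 := I01_0 R.
exists M; split=> [//|[s Is] t It|[s Is] t x It|[s Is] t t' x It It'] /=.
- exact: (res_lin dotE (sA It) (rA It Is)).
- by apply: le_trans (h1 t s x It Is); apply: ng; exact: DR.
apply: le_trans (h2 t t' s x It It' Is); apply: ng.
have d1 := DR x It Is; have d2 := DR x It' Is.
by rewrite -(dA I0) in d1 d2 *; have [] := saB (sA I0) d1 d2.
Qed.

Let N t s x := Rs t s (Z t (Rs t s x)).

Let famN : exists M : R, lipfam (fun i : sI => N^~ (sval i)) M.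
Proof.
have [M fR] := famR; exists (2 * M * (2 * KZ * M)).
have fZ : lipfam (fun _ : sI => Z) KZ.
  by case: famZ => K0 h1 h2 h3; split=> // j; [exact: (h1 tt)|exact: (h2 tt)|exact: (h3 tt)].
exact: (lipfam_comp fR (lipfam_comp fZ fR)).
Qed.

Let cont01_ZR t x y : I01 t -> cont01 (fun s => dot (Z t (Rs t s x)) y).
Proof.
move=> It; have [M M0 hM] := resolvent_lip; have [_ h] := hM t It.
have [K0 lZ bZ _] := famZ; have [_ _ _ ZB _] := linear_facts (lZ tt t It).
apply: (cont01_dot_lip cpath dotE (C := KZ * (M * nrm x))).
  by rewrite !mulr_ge0 ?nrm_ge0.
move=> s s' Is Is'; rewrite -ZB; apply: (le_trans (bZ tt t _ It)).
by rewrite -mulrA ler_wpM2l // h.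
Qed.

Lemma cont01_sandwich t x y : I01 t ->
  cont01 (fun s => dot (Rs t s (Z t (Rs t s x))) y).
Proof.
move=> It; have [M M0 hM] := resolvent_lip; have [b h] := hM t It.
have [K0 lZ bZ _] := famZ; have [_ _ _ ZB _] := linear_facts (lZ tt t It).
apply: (cont01_dot_lip cpath dotE (C := M * (KZ * (M * nrm x)) + M * (KZ * (M * nrm x)))).
  by rewrite addr_ge0 // !mulr_ge0 ?nrm_ge0.
move=> s s' Is Is'.
have lR := res_lin dotE (sA It) (rA It Is).
have [_ _ _ RB _] := linear_facts lR.
have -> : Rs t s (Z t (Rs t s x)) - Rs t s' (Z t (Rs t s' x)) =
  Rs t s (Z t (Rs t s x - Rs t s' x)) +
  (Rs t s (Z t (Rs t s' x)) - Rs t s' (Z t (Rs t s' x))).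
  by rewrite ZB /Rs /R0 RB addrA subrK.
apply: (le_trans (nrmD_le _ _)); rewrite mulrDl; apply: lerD.
  apply: (le_trans (b s _ Is)); rewrite -!mulrA ler_wpM2l //.
  by apply: (le_trans (bZ tt t _ It)); rewrite ler_wpM2l // mulrA h.
apply: (le_trans (h s s' _ Is Is')); rewrite ler_wpM2r ?nrm_ge0 // ler_wpM2l //.
by apply: (le_trans (bZ tt t _ It)); rewrite ler_wpM2l // b.
Qed.

(** The last clause is the weak form of [A F - F A = Z]: [F A] is only densely defined, so it is
    expressed by [A F^*], which makes sense everywhere because [F^* = P F^*] maps into [D]. It holds
    because [A R Z R = Z R + z R Z R] and [R Z R A = R Z + z R Z R]. *)
Lemma commutator_solution : exists (F : R -> H -> H) (M : R),
  [/\ lipfam (fun _ : unit => F) M,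
   forall t x y, I01 t -> dot (F t x) y = contour gamma (fun s => dot (N t s x) y),
   forall t x, I01 t -> D (F t x),
   forall t x, I01 t -> F t (P t x) = F t x &
   forall t Fa, I01 t -> (forall x y, dot (F t x) y = dot x (Fa y)) ->
     forall u, Fa u = P t (Fa u) /\
     forall v, dot (A t (F t v)) u - dot v (A t (Fa u)) = dot (Z t v) u].
Proof.
have [M [M0 lN bN kN]] := famN.
have [K K0 hK] := contour_nrm_le.
have [F FE] : exists F : R -> H -> H, forall t x y, I01 t ->
    dot (F t x) y = contour gamma (fun s => dot (N t s x) y).
  exists (fun t x => contour_vec gamma dot (fun s => N t s x)) => t x y It.
  apply: (contour_vecP cpath dotE (M := M * nrm x)) => [z|s Is].
    exact: cont01_sandwich.
  exact: (bN (exist _ s Is)).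
have [KZ0 lZ bZ _] := famZ.
have FP t x : I01 t -> F t (P t x) = F t x.
  move=> It; apply: (dot_extl dotE) => y; rewrite !FE //; apply: eq_contour => s Is.
  by rewrite /N /Rs /R0 -(P0_resolvent x It (rA It Is)) ZP.
have famF : lipfam (fun _ : unit => F) (K * M).
  split=> [|_ t It a x y|_ t x It|_ t t' x It It'].
  - by rewrite mulr_ge0.
  - apply: (dot_extl dotE) => z; rewrite dotDl dotZl !FE // -(contourZ cpath); last exact: cont01_sandwich.
    rewrite -(contourD cpath).
    + by apply: eq_contour => s Is; rewrite (lN (exist _ s Is) t It) dotDl dotZl.
    + by apply: cont01M; [exact: cont01_cst | exact: cont01_sandwich].
    + exact: cont01_sandwich.
  - rewrite -mulrA; apply: (hK (fun s => N t s x)).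
    + by rewrite mulr_ge0 ?nrm_ge0.
    + by move=> y; exact: cont01_sandwich.
    + by move=> y; exact: FE.
    + by move=> s Is; exact: (bN (exist _ s Is)).
  - have -> : K * M * `|t - t'| * nrm x = K * (M * `|t - t'| * nrm x) by ring.
    apply: (hK (fun s => N t s x - N t' s x)).
    + by rewrite !mulr_ge0 ?nrm_ge0.
    + move=> y; apply: (@cont01_ext _ (fun s => dot (N t s x) y + (-1) * dot (N t' s x) y)).
        by move=> s _; rewrite dotBl mulN1r.
      by apply: cont01D; [|apply: cont01M; [exact: cont01_cst |]]; exact: cont01_sandwich.
    + move=> y; rewrite dotBl !FE // -(contourB cpath); try exact: cont01_sandwich.
      by apply: eq_contour => s Is; rewrite dotBl.
    + by move=> s Is; exact: (kN (exist _ s Is)).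
exists F, (K * M).
have AN t s x : I01 t -> I01 s -> D (N t s x) /\ A t (N t s x) = Z t (Rs t s x) + gamma s *: N t s x.
  move=> It Is; split; last exact: A_res (rA It Is) _.
  by rewrite -(dA It); exact: res_dom (rA It Is) _.
have cAN t x y : I01 t -> cont01 (fun s => dot (Z t (Rs t s x) + gamma s *: N t s x) y).
  move=> It; apply: (@cont01_ext _ (fun s => dot (Z t (Rs t s x)) y + gamma s * dot (N t s x) y)).
    by move=> s _; rewrite dotDl dotZl.
  by apply: cont01D; [exact: cont01_ZR | apply: cont01M => //; exact: cont01_sandwich].
have AF t x : I01 t -> D (F t x) /\ forall y,
    dot (A t (F t x)) y = contour gamma (fun s => dot (Z t (Rs t s x) + gamma s *: N t s x) y).
  move=> It; have [G G0 hG] := cont01_bounded cgamma.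
  have [MR [MR0 lR bR _]] := famR.
  pose w := contour_vec gamma dot (fun s => Z t (Rs t s x) + gamma s *: N t s x).
  have wP y : dot w y = contour gamma (fun s => dot (Z t (Rs t s x) + gamma s *: N t s x) y).
    apply: (contour_vecP cpath dotE (M := KZ * (MR * nrm x) + G * (M * nrm x))) => [z|s Is].
      exact: cAN.
    apply: (le_trans (nrmD_le _ _)); apply: lerD.
      apply: (le_trans (bZ tt t _ It)); rewrite ler_wpM2l //; exact: (bR (exist _ s Is)).
    rewrite nrmZ; apply: ler_pM; rewrite ?nrm_ge0 ?hG //; exact: (bN (exist _ s Is)).
  have [DF eF] : dom (A t) (F t x) /\ A t (F t x) = w.
    apply: (sa_max (sA It)) => u Du; rewrite dotC [RHS]dotC; congr conjc.
    rewrite wP FE //; apply: eq_contour => s Is; have [DN <-] := AN t s x It Is.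
    by rewrite (sa_sym (sA It)) // dA.
  by rewrite -(dA It); split=> // y; rewrite eF wP.
have [CP _ rangeP] := P0_range.
split=> //; first by move=> t x It; have [] := AF t x It.
move=> t Fa It adjF u.
have [PP symP] := P0_projector It.
have commP := P0_comm It.
have DP x : D (P t x) by have [] := rangeP t x It.
have FaP : Fa u = P t (Fa u).
  by apply: (dot_extr dotE) => v; rewrite -symP -!adjF FP.
split=> // v.
(* [A P] is everywhere defined and symmetric; this transfers [A] from [F^* u] to [P v], where
   [F A P] can be computed under the integral. *)
have symAP x y : dot x (A t (P t y)) = dot (A t (P t x)) y.
  have e z : A t (P t z) = P t (A t (P t z)) by rewrite -commP // PP.
  have DPx : dom (A t) (P t x) by rewrite dA.
  have DPy : dom (A t) (P t y) by rewrite dA.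
  by rewrite e -symP -(sa_sym (sA It) DPx DPy) -symP -e.
have [_ ->] := AF t v It.
rewrite FaP symAP -adjF FE //.
have -> : contour gamma (fun s => dot (N t s (A t (P t v))) u) =
    contour gamma (fun s => dot (Rs t s (Z t v)) u + gamma s * dot (N t s v) u).
  apply: eq_contour => s Is.
  have DPv : dom (A t) (P t v) by rewrite dA.
  have [_ ZD _ _ ZZ] := linear_facts (lZ tt t It).
  have [_ RD _ _ RZ] := linear_facts (res_lin dotE (sA It) (rA It Is)).
  rewrite /N /Rs /R0 (res_A dotE (sA It) (rA It Is) DPv).
  rewrite -(P0_resolvent v It (rA It Is)).
  by rewrite ZD ZZ !ZP // RD RZ dotDl dotZl.
have c1 : cont01 (fun s => gamma s * dot (N t s v) u).
  by apply: cont01M => //; exact: cont01_sandwich.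
have c2 x y : cont01 (fun s => dot (Rs t s x) y).
  exact: (cont01_resolvent).
rewrite (contourD cpath) //.
have -> : contour gamma (fun s => dot (Z t (Rs t s v) + gamma s *: N t s v) u) =
    contour gamma (fun s => dot (Z t (Rs t s v)) u) + contour gamma (fun s => gamma s * dot (N t s v) u).
  rewrite -(contourD cpath) //; last exact: cont01_ZR.
  by apply: eq_contour => s _; rewrite dotDl dotZl.
(* The terms carrying [gamma s] cancel. What is left is the integral of [R Z], which is [P Z = 0],
   and that of [Z R], which is [Z P = Z]. *)
rewrite -(P0_dot (Z t v) u It) PZ // dot0l add0r addrK.
have [Za [_ adjZ _]] := adjointP dotE (lZ tt t It) KZ0 (fun x => bZ tt t x It).
rewrite -(ZP v It) adjZ (P0_dot v (Za u) It).
by apply: eq_contour => s _; rewrite adjZ.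
Qed.

End Projector.

(** * Closures and difference quotients *)

Section ClosureOfSum.
Variables (R : realType) (H : completeNormedModType R[i]).
Variable dot : {dot H for Num.conj}.
Hypothesis dotE : forall x : H, `|x| ^+ 2 = dot x x.

Lemma closure_graph_approx (A : operator H) (x y : H) : closure (graph A) (x, y) ->
  forall e : R, 0 < e -> exists u, [/\ dom A u, nrm (x - u) < e & nrm (y - A u) < e].
Proof.
move=> cl e e0.
pose N := [set p : H * H | nrm (x - p.1) < e /\ nrm (y - p.2) < e].
have nN : nbhs (x, y) N.
  exists ([set u | nrm (x - u) < e], [set u | nrm (y - u) < e]) => /=.
    by split; apply/nbhs_nrmP; exists e.
  by move=> [u v] [].
have [[u v] [[/= Du ->] [h1 h2]]] := cl N nN.
by exists u.
Qed.

Lemma closure_graph_sym (A : operator H) :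
  (forall u v, dom A u -> dom A v -> dot (A u) v = dot u (A v)) ->
  forall x x' y y', closure (graph A) (x, x') -> closure (graph A) (y, y') ->
  dot x' y = dot x y'.
Proof.
move=> symA x x' y y' cx cy; apply: subr0_eq; apply: nrm_eq0.
apply/eqP; rewrite eq_le nrm_ge0 andbT; apply/ler_addgt0Pl => e e0; rewrite addr0.
pose c := nrm x + nrm x' + nrm y + nrm y' + 3.
have c0 : 0 < c.
  have := nrm_ge0 x; have := nrm_ge0 x'; have := nrm_ge0 y; have := nrm_ge0 y'.
  rewrite /c; lra.
pose d := Num.min 1 (e / c).
have d0 : 0 < d by rewrite lt_min ltr01 divr_gt0.
have d1 : d <= 1 by rewrite ge_min lexx.
have dc : d * c <= e by rewrite -ler_pdivlMr // ge_min lexx orbT.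
have [u [Du xu x'u]] := closure_graph_approx cx d0.
have [v [Dv yv y'v]] := closure_graph_approx cy d0.
have -> : dot x' y - dot x y' = dot (x' - A u) y + dot (A u) (y - v)
    - dot x (y' - A v) - dot (x - u) (A v).
  rewrite !dot_lin (symA u v Du Dv); ring.
have nAu : nrm (A u) <= nrm x' + 1.
  have := nrmB_le x' (x' - A u); rewrite opprB addrCA subrr addr0; lra.
have nAv : nrm (A v) <= nrm y' + 1.
  have := nrmB_le y' (y' - A v); rewrite opprB addrCA subrr addr0; lra.
have h1 := dot_le dotE (x' - A u) y; have h2 := dot_le dotE (A u) (y - v).
have h3 := dot_le dotE x (y' - A v); have h4 := dot_le dotE (x - u) (A v).
have k1 : nrm (x' - A u) * nrm y <= d * nrm y.
  by rewrite ler_wpM2r ?nrm_ge0 // ltW.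
have k2 : nrm (A u) * nrm (y - v) <= (nrm x' + 1) * d.
  by rewrite ler_pM ?nrm_ge0 // ltW.
have k3 : nrm x * nrm (y' - A v) <= nrm x * d.
  by rewrite ler_wpM2l ?nrm_ge0 // ltW.
have k4 : nrm (x - u) * nrm (A v) <= d * (nrm y' + 1).
  by rewrite ler_pM ?nrm_ge0 // ltW.
apply: (le_trans (nrmB_le _ _)); apply: (@le_trans _ _ (d * c)) => //.
have t1 := nrmB_le (dot (x' - A u) y + dot (A u) (y - v)) (dot x (y' - A v)).
have t2 := nrmD_le (dot (x' - A u) y) (dot (A u) (y - v)).
apply: (le_trans (lerD t1 (le_trans h4 k4))).
apply: (le_trans (lerD (lerD t2 (le_trans h3 k3)) (lexx _))).
apply: (le_trans (lerD (lerD (lerD (le_trans h1 k1) (le_trans h2 k2)) (lexx _)) (lexx _))).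
rewrite /c; lra.
Qed.

Variables (H0 H1 : R -> operator H) (D0 D1 : set H) (eps t : R) (D : set H).
Hypothesis s0 : self_adjoint dot (H0 t).
Hypothesis s1 : self_adjoint dot (H1 t).
Hypothesis d0 : dom (H0 t) = D0.
Hypothesis d1 : dom (H1 t) = D1.
Hypothesis denseD : dense D.
Hypothesis subD : D `<=` D0 `&` D1.

Let symH u v : dom (Heps H0 H1 eps t) u -> dom (Heps H0 H1 eps t) v ->
  dot (Heps H0 H1 eps t u) v = dot u (Heps H0 H1 eps t v).
Proof.
move=> [Du0 Du1] [Dv0 Dv1] /=.
by rewrite !dot_lin conjc_real (sa_sym s0) // (sa_sym s1).
Qed.

Let Hbar_graph x : dom (Hbar H0 H1 eps t) x ->
  closure (graph (Heps H0 H1 eps t)) (x, Hbar H0 H1 eps t x).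
Proof.
rewrite /Hbar /op_closure /op_of_graph /= => -[y hy].
case: xgetP => [z -> //|/= h]; by have := h y.
Qed.

Lemma Hbar_sym x y : dom (Hbar H0 H1 eps t) x -> dom (Hbar H0 H1 eps t) y ->
  dot (Hbar H0 H1 eps t x) y = dot x (Hbar H0 H1 eps t y).
Proof.
by move=> Dx Dy; apply: (closure_graph_sym symH); exact: Hbar_graph.
Qed.

(** [Hbar] takes its values by choice from the closed graph; symmetry of that closure, tested on the
    dense core, leaves only one possible value. *)
Lemma Hbar_ext x : D0 x -> D1 x -> dom (Hbar H0 H1 eps t) x /\
  Hbar H0 H1 eps t x = H0 t x + eps%:C *: H1 t x.
Proof.
move=> D0x D1x.
have gr u : D0 u -> D1 u -> closure (graph (Heps H0 H1 eps t)) (u, H0 t u + eps%:C *: H1 t u).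
  by move=> D0u D1u; apply: subset_closure; split; rewrite //= d0 d1.
have Dx : dom (Hbar H0 H1 eps t) x by exists (H0 t x + eps%:C *: H1 t x); exact: gr.
split=> //; apply: (dense_dot_extl dotE denseD) => w Dw; rewrite dotC [RHS]dotC.
have [D0w D1w] := subD Dw; congr conjc.
rewrite -(closure_graph_sym symH (gr w D0w D1w) (Hbar_graph Dx)).
by rewrite -(closure_graph_sym symH (gr w D0w D1w) (gr x D0x D1x)).
Qed.

Lemma dense_Hbar : dense (dom (Hbar H0 H1 eps t)).
Proof.
move=> O O0 oO; have [x [Ox Dx]] := denseD O0 oO; exists x; split=> //.
by have [D0x D1x] := subD Dx; have [] := Hbar_ext D0x D1x.
Qed.

End ClosureOfSum.

Section Sandwich.
Variables (R : realType) (H : completeNormedModType R[i]).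
Variable dot : {dot H for Num.conj}.
Hypothesis dotE : forall x : H, `|x| ^+ 2 = dot x x.

(** A product rule that leaves the increment [T s - T t] untouched, since [T] is Lipschitz but
    perhaps not differentiable. *)
Lemma sandwich_expansion (T : R -> H -> H) (M : R) (v w : R -> H) (t : R) (v' w' : H) :
  lipfam (fun _ : unit => T) M -> I01 t -> is_deriv01 v t v' -> is_deriv01 w t w' ->
  forall e : R, 0 < e -> exists2 d : R, 0 < d & forall s, I01 s -> `|s - t| < d ->
    nrm (dot (T s (v s)) (w s) - dot (T t (v t)) (w t) -
      (dot (T s (v t) - T t (v t)) (w t) +
       (s - t)%:C * (dot (T t v') (w t) + dot (T t (v t)) w'))) <= e * `|s - t|.
Proof.
move=> [M0 lT bT kT] It /(is_deriv01P _ _ It) dv /(is_deriv01P _ _ It) dw e e0.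
pose a := nrm v' + 1; pose c := nrm w' + 1.
pose nv := nrm (v t); pose nw := nrm (w t).
have a0 : 0 <= a by rewrite addr_ge0 ?nrm_ge0.
have c0 : 0 <= c by rewrite addr_ge0 ?nrm_ge0.
have nv0 : 0 <= nv := nrm_ge0 _; have nw0 : 0 <= nw := nrm_ge0 _.
(* [q1] collects the terms with a first-order remainder of [v] or [w], and [q2] those with two
   increments; each group gets half of [e]. *)
pose q1 := M * (nw + nv) + 1.
pose q2 := M * (a * c + a * nw + nv * c) + 1.
have q10 : 0 < q1.
  have h : 0 <= M * (nw + nv) by rewrite mulr_ge0 // addr_ge0.
  by rewrite /q1; lra.
have q20 : 0 < q2.
  have h : 0 <= M * (a * c + a * nw + nv * c) by apply: mulr_ge0 => //; apply: addr_ge0; [apply: addr_ge0|]; exact: mulr_ge0.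
  by rewrite /q2; move: h; set z := M * _; lra.
pose eta := Num.min 1 (e / 2 / q1).
have e20 : 0 < e / 2 by lra.
have eta0 : 0 < eta by rewrite lt_min ltr01 divr_gt0.
have eta1 : eta <= 1 by rewrite ge_min lexx.
have etae : eta * q1 <= e / 2 by rewrite -ler_pdivlMr // ge_min lexx orbT.
have [dl1 dl10 h1] := dv eta eta0; have [dl2 dl20 h2] := dw eta eta0.
exists (Num.min (e / 2 / q2) (Num.min dl1 dl2)).
  by rewrite !lt_min divr_gt0 // dl10.
move=> s Is; rewrite !lt_min => /andP[sq /andP[sd1 sd2]].
have {}h1 := h1 s Is sd1; have {}h2 := h2 s Is sd2.
have {}sq : `|s - t| * q2 <= e / 2 by rewrite -ler_pdivlMr // ltW.
set dl := `|s - t| in h1 h2 sq *.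
have dl0 : 0 <= dl by exact: normr_ge0.
pose r := v s - v t - (s - t)%:C *: v'; pose q := w s - w t - (s - t)%:C *: w'.
have nvs : nrm (v s - v t) <= a * dl.
  have -> : v s - v t = r + (s - t)%:C *: v' by rewrite /r subrK.
  apply: (le_trans (nrmD_le _ _)); rewrite nrmZr /a -/dl.
  have := ler_wpM2r dl0 eta1; rewrite -/r in h1; lra.
have nws : nrm (w s - w t) <= c * dl.
  have -> : w s - w t = q + (s - t)%:C *: w' by rewrite /q subrK.
  apply: (le_trans (nrmD_le _ _)); rewrite nrmZr /c -/dl.
  have := ler_wpM2r dl0 eta1; rewrite -/q in h2; lra.
have [_ SD _ SB SZ] := linear_facts (lT tt s Is).
have [_ TD _ TB TZ] := linear_facts (lT tt t It).
have -> : dot (T s (v s)) (w s) - dot (T t (v t)) (w t) -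
      (dot (T s (v t) - T t (v t)) (w t) +
       (s - t)%:C * (dot (T t v') (w t) + dot (T t (v t)) w')) =
   dot (T s (v s - v t)) (w s - w t) + dot (T s (v s - v t) - T t (v s - v t)) (w t)
   + dot (T s (v t) - T t (v t)) (w s - w t) + dot (T t r) (w t) + dot (T t (v t)) q.
  rewrite /r /q !SB !TB TZ !dot_lin conjc_real; ring.
have cs (x y : H) (m n : R) : nrm x <= m -> nrm y <= n -> nrm (dot x y) <= m * n.
  by move=> xm yn; apply: (le_trans (dot_le dotE _ _)); rewrite ler_pM ?nrm_ge0.
have bs (x : H) (m : R) : nrm x <= m -> nrm (T s x) <= M * m.
  by move=> xm; apply: (le_trans (bT tt s x Is)); rewrite ler_wpM2l.
have bt (x : H) (m : R) : nrm x <= m -> nrm (T t x) <= M * m.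
  by move=> xm; apply: (le_trans (bT tt t x It)); rewrite ler_wpM2l.
have ks (x : H) (m : R) : nrm x <= m -> nrm (T s x - T t x) <= M * dl * m.
  by move=> xm; apply: (le_trans (kT tt s t x Is It)); rewrite ler_wpM2l // mulr_ge0.
have k1 := cs _ _ _ _ (bs _ _ nvs) nws.
have k2 := cs _ _ _ _ (ks _ _ nvs) (lexx nw).
have k3 := cs _ _ _ _ (ks _ _ (lexx nv)) nws.
have k4 := cs _ _ _ _ (bt _ _ h1) (lexx nw).
have k5 := cs _ _ _ _ (bt _ _ (lexx nv)) h2.
apply: (le_trans (nrmD_le _ _)); apply: (le_trans (lerD (nrmD_le _ _) k5)).
apply: (le_trans (lerD (lerD (nrmD_le _ _) k4) (lexx _))).
apply: (le_trans (lerD (lerD (lerD (nrmD_le _ _) k3) (lexx _)) (lexx _))).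
apply: (le_trans (lerD (lerD (lerD (lerD k1 k2) (lexx _)) (lexx _)) (lexx _))).
have f1 := ler_wpM2r dl0 etae; have f2 := ler_wpM2r dl0 sq.
have -> : e * dl = e / 2 * dl + e / 2 * dl by rewrite -mulrDl; congr (_ * _); lra.
apply: le_trans (lerD f1 f2).
rewrite -subr_ge0.
have -> : eta * q1 * dl + dl * q2 * dl - (M * (a * dl) * (c * dl) + M * dl * (a * dl) * nw +
    M * dl * nv * (c * dl) + M * (eta * dl) * nw + M * nv * (eta * dl)) = eta * dl + dl * dl.
  by rewrite /q1 /q2; ring.
by rewrite addr_ge0 ?mulr_ge0 // ltW.
Qed.

End Sandwich.

Section BoundedExtension.
Variables (R : realType) (H : completeNormedModType R[i]).

Lemma cont_extE (D : set H) (f T : H -> H) (C : R) (x : H) : dense D -> linear T ->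
  (forall y, nrm (T y) <= C * nrm y) -> (forall y, D y -> f y = T y) ->
  cont_ext D f x = T x.
Proof.
move=> dD lT bT fT; rewrite /cont_ext.
have PF : ProperFilter (within D (nbhs x)).
  apply: Build_ProperFilter_ex => N /nbhs_nrmP[e e0 h].
  by have [y Dy xy] := dense_nrm x dD e0; exists y; exact: h.
apply: cvg_lim; first exact: norm_hausdorff.
apply/cvg_nrmP => e e0; apply/nbhs_nrmP.
exists (e / (`|C| + 1)) => [|y xy Dy]; first exact: divr_gt0.
have [_ _ _ TB _] := linear_facts lT.
rewrite fT // -TB; apply: (le_lt_trans (bT _)).
rewrite ltr_pdivlMr // in xy; apply: le_lt_trans xy; rewrite mulrC ler_wpM2l ?nrm_ge0 //.
by have := ler_norm C; lra.
Qed.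

End BoundedExtension.

(** * The adiabatic estimate *)

Section Adiabatic.
Variables (R : realType) (H : completeNormedModType R[i]).
Variable dot : {dot H for Num.conj}.
Hypothesis dotE : forall x : H, `|x| ^+ 2 = dot x x.
Variables (A : R -> operator H) (D : set H) (gamma : R -> R[i]).
Hypothesis sA : forall t, I01 t -> self_adjoint dot (A t).
Hypothesis dA : forall t, I01 t -> dom (A t) = D.
Hypothesis C2A : forall x, D x -> Ck01 2 (fun t => A t x).
Hypothesis cpath : closed_path gamma.

(** [T (f s)] is only bounded, not assumed continuous in [s], so [T v] is not built as an integral.
    Instead [y |-> <T y, v>] is bounded, Riesz represents it, and [sa_max] concludes. *)
Lemma contour_range : exists2 K : R, 0 <= K &
  forall (T : operator H) (f : R -> H) (v : H) (b : R), 0 <= b -> self_adjoint dot T ->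
  (forall y, cont01 (fun s => dot (f s) y)) ->
  (forall y, dot v y = contour gamma (fun s => dot (f s) y)) ->
  (forall s, I01 s -> dom T (f s) /\ nrm (T (f s)) <= b) ->
  dom T v /\ nrm (T v) <= K * b.
Proof.
have [K K0 hK] := contour_le cpath; exists K => // T f v b b0 sT cf hv hf.
have key y : dom T y -> nrm (dot v (T y)) <= K * b * nrm y.
  move=> Dy; rewrite hv -mulrA; apply: hK => // s Is; have [Df bf] := hf s Is.
  rewrite -(sa_sym sT Df Dy); apply: (le_trans (dot_le dotE _ _)).
  by rewrite ler_wpM2r ?nrm_ge0.
have [||||w hw] := @riesz_subspace R H dot dotE (dom T) id (fun y => dot (T y) v) (K * b).
- exact: sa_dom0 sT.
- by move=> a x y Dx Dy; have [] := saP sT a Dx Dy.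
- by move=> a x y Dx Dy; have [_ ->] := saP sT a Dx Dy; rewrite dotDl dotZl.
- by move=> y Dy /=; rewrite dotC nrm_conj; exact: key.
have [Dv eTv] := sa_max sT hw; split=> //; rewrite eTv.
apply: (dense_nrm_le_dot dotE (sa_dense sT)); first by rewrite mulr_ge0.
move=> y Dy; rewrite dotC nrm_conj -[y]/(id y) -hw // dotC nrm_conj; exact: key.
Qed.

Hypothesis rA : forall t s, I01 t -> I01 s -> resolvent_set (A t) (gamma s).
Hypothesis wA : forall t (mu : R), I01 t -> ~ resolvent_set (A t) mu%:C ->
  winding gamma mu%:C = 0 \/ winding gamma mu%:C = 1.
Variables (P P1 : R -> H -> H).
Hypothesis PE : forall t x, P t x = P0 dot A gamma t x.
Hypothesis P1E : forall t x, P1 t x = dP0 dot A gamma t x.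
Variables (B : R -> operator H) (D1 : set H).
Hypothesis sB : forall t, I01 t -> self_adjoint dot (B t).
Hypothesis dB : forall t, I01 t -> dom (B t) = D1.
Hypothesis C1B : forall x, D1 x -> Ck01 1 (fun t => B t x).
Hypothesis rP : forall t x, I01 t -> D1 (P t x).
Hypothesis rP1 : forall t x, I01 t -> D1 (P1 t x).
Hypothesis cP1 : forall x, {within I01, continuous (fun t => B 0 (P1 t x))}.
Let Rs t s := R0 A t (gamma s).
Hypothesis rR : forall s t x, I01 s -> I01 t -> D1 (Rs t s (B t (P t x))).
Hypothesis rR1 : forall s t x, I01 s -> I01 t -> D1 (Rs t s (P1 t (P t x))).
Variable b : R.
Hypothesis b0 : 0 <= b.
Hypothesis bR : forall s t (x : H), I01 s -> I01 t ->
  nrm (B 0 (Rs t s (B t (P t x)))) <= b * nrm x.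
Hypothesis bR1 : forall s t (x : H), I01 s -> I01 t ->
  nrm (B 0 (Rs t s (P1 t (P t x)))) <= b * nrm x.

Let I0 := I01_0 R.
Let X t x := B t (P t x).
Let Z t x := X t x - P t (X t x) - 'i%C *: P1 t (P t x).

Lemma projector_family : exists2 M : R, 0 <= M &
  [/\ lipfam (fun _ : unit => P) M, lipfam (fun _ : unit => P1) M,
   lipfam (fun _ : unit => X) M,
   forall t (x : H), I01 t -> nrm (B 0 (P t x)) <= M * nrm x &
   forall t (x : H), I01 t -> D1 x -> nrm (B t x) <= M * (nrm (B 0 x) + nrm x)].
Proof.
have [M1 M10 [lP1 bP1 lipP lipP1 [dP _ _ _]]] :=
  dP0_facts dotE sA dA C2A cpath rA PE wA P1E.
have [C C0 bP] := P0_bound dotE sA dA C2A cpath rA PE.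
have lP t (It : I01 t) : linear (P t) := P0_linear dotE sA dA C2A cpath rA PE It.
pose M := M1 + C.
have M0 : 0 <= M by rewrite addr_ge0.
have up1 (x : H) : M1 * nrm x <= M * nrm x by rewrite ler_wpM2r ?nrm_ge0 // lerDl.
have up2 (x : H) (r : R) : M1 * `|r| * nrm x <= M * `|r| * nrm x.
  by rewrite ler_wpM2r ?nrm_ge0 // ler_wpM2r // lerDl.
have bP' t (x : H) : I01 t -> nrm (P t x) <= M * nrm x.
  by move=> It; apply: (le_trans (bP t x It)); rewrite ler_wpM2r ?nrm_ge0 // lerDr.
have bP1' t (x : H) : I01 t -> nrm (P1 t x) <= M * nrm x.
  by move=> It; exact: le_trans (bP1 t x It) (up1 x).
have lipP' t t' (x : H) : I01 t -> I01 t' -> nrm (P t x - P t' x) <= M * `|t - t'| * nrm x.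
  by move=> It It'; exact: le_trans (lipP t t' x It It') (up2 x _).
have [K K0 [lX bX lipX]] := comp_bounds dotE sB dB C1B M0 lP lP1 bP' bP1' lipP' dP rP rP1 cP1.
have [L L0 [gP _]] := comp_graph_bounds dotE sB dB M0 lP lP1 bP' bP1' lipP' dP rP rP1 cP1.
have [N N0 hN] := family_graph_bound dotE sB dB C1B.
have le_up (x : H) y c c' : y <= c * nrm x -> c <= c' -> y <= c' * nrm x.
  by move=> h cc; apply: (le_trans h); rewrite ler_wpM2r ?nrm_ge0.
have le_up2 (x : H) (r y c c' : R) : y <= c * `|r| * nrm x -> c <= c' -> y <= c' * `|r| * nrm x.
  by move=> h cc; apply: (le_up _ _ _ _ h); rewrite ler_wpM2r.
have ngB x : D1 x -> nrm (B 0 x) <= graph_nrm B x := fun Dx => nrm_A0_le_graph dotE sB dB Dx.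
exists (M + K + L + N); first by rewrite !addr_ge0.
have MM : M <= M + K + L + N by lra.
have KM : K <= M + K + L + N by lra.
have LM : L <= M + K + L + N by lra.
have NM : N <= M + K + L + N by lra.
split=> [|||t x It|t x It Dx].
- split=> [|_ t It|_ t x It|_ t t' x It It']; first by rewrite !addr_ge0.
  + exact: lP.
  + exact: le_up (bP' t x It) MM.
  + exact: le_up2 (lipP' t t' x It It') MM.
- split=> [|_ t It|_ t x It|_ t t' x It It']; first by rewrite !addr_ge0.
  + exact: lP1.
  + exact: le_up (bP1' t x It) MM.
  + by apply: (le_up2 _ _ _ _ _ (lipP1 t t' x It It')); apply: le_trans MM; rewrite lerDl.
- split=> [|_ t It|_ t x It|_ t t' x It It']; first by rewrite !addr_ge0.
  + exact: lX.
  + exact: le_up (bX t x It) KM.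
  + exact: le_up2 (lipX t t' x It It') KM.
- by apply: le_up LM; apply: le_trans (gP t x It); apply: ngB; exact: rP.
apply: (le_trans (hN t x It Dx)).
have h := graph_nrm_triangle B x; have g0 := graph_nrm_ge0 B x.
by apply: ler_pM.
Qed.

Lemma lipfam_Z : exists KZ, lipfam (fun _ : unit => Z) KZ.
Proof.
have [M M0 [fP fP1 fX _ _]] := projector_family.
exists (M + nrm (- 1 : R[i]) * (2 * M * M) + nrm (- 'i%C : R[i]) * (2 * M * M)).
have [K0 h1 h2 h3] := lipfam_lin dotE (- 'i%C) (lipfam_lin dotE (- 1) fX (lipfam_comp fP fX))
  (lipfam_comp fP1 fP).
have ZE t x : X t x + (-1) *: P t (X t x) + - 'i%C *: P1 t (P t x) = Z t x.
  by rewrite scaleN1r scaleNr.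
split=> [//|j t It a x y|j t x It|j t t' x It It'].
- by rewrite -!ZE; exact: (h1 j t It).
- by rewrite -ZE; exact: (h2 j t x It).
- by rewrite -!ZE; exact: (h3 j t t' x It It').
Qed.

(** The witness is [G = F - Fa], with [Fa] the adjoint of the solution of [[A, F] = Z]. Adding the
    commutator identity to its adjoint gives [Z + Z^*] on the right. *)
Lemma corrector : exists (F : R -> H -> H) (M : R),
  [/\ lipfam (fun _ : unit => F) M,
   forall t x, I01 t -> D (F t x) /\ D1 (F t x),
   forall t (x : H), I01 t -> nrm (B t (F t x)) <= M * nrm x,
   forall t x y, I01 t -> dot (F t x) y = - dot x (F t y) &
   forall t u v, I01 t -> dot (A t (F t v)) u + dot v (A t (F t u)) =
     dot (Z t v) u + dot v (Z t u)].
Proof.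
have [M M0 [fP fP1 fX bBP bB]] := projector_family.
have [_ _ [_ _ _ _ [dP _ PP1P _]]] := dP0_facts dotE sA dA C2A cpath rA PE wA P1E.
have PP t It := P0_projector dotE sA dA C2A cpath rA PE wA (t := t) It.
have [KZ famZ] := lipfam_Z.
have ZP t x : I01 t -> Z t (P t x) = Z t x.
  by move=> It; have [PPt _] := PP t It; rewrite /Z /X PPt.
have [_ lP bP lipP] := fP.
have PZ t x : I01 t -> P t (Z t x) = 0.
  move=> It; have [PPt _] := PP t It.
  have [_ PD PN PB PZ] := linear_facts (lP tt t It).
  by rewrite /Z !PB PZ PPt PP1P // subrr scaler0 subr0.
have [F [MF [fF FE DF FP adjF]]] :=
  commutator_solution dotE sA dA C2A cpath rA PE wA famZ ZP PZ.
have [MF0 lF bF lipF] := fF.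
have [Fa hFa] : exists Fa : R -> H -> H, forall t, I01 t -> forall x y, dot (F t x) y = dot x (Fa t y).
  have h (t : R) : exists Fat : H -> H, I01 t -> forall x y, dot (F t x) y = dot x (Fat y).
    have [It|nIt] := pselect (I01 t); last by exists id.
    have [Fat [_ h _]] := adjointP dotE (lF tt t It) MF0 (fun x => bF tt t x It).
    by exists Fat.
  by have [Fa hFa] := choice h; exists Fa.
have fFa : lipfam (fun _ : unit => Fa) MF.
  by apply: (lipfam_adj dotE fF) => _ t x y It; exact: hFa.
have [_ lFa bFa lipFa] := fFa.
have FaP t u : I01 t -> Fa t u = P t (Fa t u).
  by move=> It; have [] := adjF t (Fa t) It (hFa t It) u.
have [CP _ rangeP] := P0_range dotE sA dA C2A cpath rA PE.
have DFa t u : I01 t -> D (Fa t u).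
  by move=> It; rewrite FaP //; have [] := rangeP t (Fa t u) It.
have D1Fa t u : I01 t -> D1 (Fa t u) by move=> It; rewrite FaP //; exact: rP.
have [K K0 hK] := contour_range.
have [MR MR0 hR] := resolvent_lip dotE sA dA C2A cpath rA.
have [_ lX bX _] := fX.
pose bN := b * MR + M * (MR * (M * MR)) + b * MR.
have bN0 : 0 <= bN by rewrite !addr_ge0 ?mulr_ge0.
(* As [P] commutes with the resolvent, [R Z y] splits into [R X y], [P R X y] and [R P' P y]: the
   first and last are covered by $R_1$, the middle one lies in the range of [P]. *)
have NB t s x : I01 t -> I01 s -> D1 (Rs t s (Z t (Rs t s x))) /\
    nrm (B 0 (Rs t s (Z t (Rs t s x)))) <= bN * nrm x.
  move=> It Is; have [hRt _] := hR t It.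
  have [_ _ _ RB RZ] := linear_facts (res_lin dotE (sA It) (rA It Is)).
  set y := Rs t s x; have ny : nrm y <= MR * nrm x := hRt s x Is.
  have e : Rs t s (Z t y) = Rs t s (X t y) - P t (Rs t s (X t y)) - 'i%C *: Rs t s (P1 t (P t y)).
    rewrite /Rs /R0 (P0_resolvent dotE sA dA C2A cpath rA PE _ It (rA It Is)).
    by rewrite /Z !RB RZ.
  have d1 : dom (B 0) (Rs t s (X t y)) by rewrite dB //; exact: rR.
  have d2 : dom (B 0) (P t (Rs t s (X t y))) by rewrite dB //; exact: rP.
  have d3 : dom (B 0) (Rs t s (P1 t (P t y))) by rewrite dB //; exact: rR1.
  have [d4 e4] := saB (sB I0) d1 d2; have [d5 e5] := saZ (sB I0) 'i%C d3.
  have [d6 e6] := saB (sB I0) d4 d5.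
  rewrite e; split; first by rewrite -(dB I0).
  rewrite e6 e5 e4; apply: (le_trans (nrmB_le _ _)); rewrite mulrDl; apply: lerD.
    apply: (le_trans (nrmB_le _ _)); rewrite mulrDl; apply: lerD.
      by apply: (le_trans (bR y Is It)); rewrite -mulrA ler_wpM2l.
    apply: (le_trans (bBP t _ It)); rewrite -!mulrA ler_wpM2l //.
    apply: (le_trans (hRt s _ Is)); rewrite ler_wpM2l //.
    by apply: (le_trans (bX tt t y It)); rewrite ler_wpM2l.
  rewrite nrmZ nrm_i mul1r.
  by apply: (le_trans (bR1 y Is It)); rewrite -mulrA ler_wpM2l.
have BF t x : I01 t -> D1 (F t x) /\ nrm (B 0 (F t x)) <= K * bN * nrm x.
  move=> It; rewrite -(dB I0) -mulrA.
  apply: (hK _ (fun s => Rs t s (Z t (Rs t s x)))).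
  - by rewrite mulr_ge0 ?nrm_ge0.
  - exact: sB.
  - by move=> y; exact: (cont01_sandwich dotE sA dA C2A cpath rA famZ).
  - by move=> y; exact: FE.
  - by move=> s Is; rewrite (dB I0); exact: NB.
(* Bounds [B t (G t x)] by [bB]: [B 0 F] through the contour, [B 0 Fa] through [Fa = P Fa], and
   [MF + MF] for the norm of [G]. *)
pose N := M * (K * bN + M * MF + (MF + MF)).
have N0 : 0 <= N by rewrite !(mulr_ge0, addr_ge0).
pose G t x := F t x - Fa t x.
have fG : lipfam (fun _ : unit => G) (MF + nrm (- 1 : R[i]) * MF + N).
  have := lipfam_weaken _ (lipfam_lin dotE (- 1) fF fFa).
  move=> /(_ (MF + nrm (- 1 : R[i]) * MF + N)); rewrite lerDl => /(_ N0).
  have GE t x : F t x + (-1) *: Fa t x = G t x by rewrite scaleN1r.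
  move=> [G0 h1 h2 h3]; split=> [//|j t It a x y|j t x It|j t t' x It It'].
  - by rewrite -!GE; exact: (h1 j t It).
  - by rewrite -GE; exact: (h2 j t x It).
  - by rewrite -!GE; exact: (h3 j t t' x It It').
have DG t x : I01 t -> D (G t x) /\ A t (G t x) = A t (F t x) - A t (Fa t x).
  move=> It; have d1 := DF t x It; have d2 := DFa t x It.
  by rewrite -!(dA It) in d1 d2 *; exact: (saB (sA It) d1 d2).
have D1G t x : I01 t -> D1 (G t x) /\ B 0 (G t x) = B 0 (F t x) - B 0 (Fa t x).
  move=> It; have [d1 _] := BF t x It; have d2 := D1Fa t x It.
  by rewrite -!(dB I0) in d1 d2 *; exact: (saB (sB I0) d1 d2).
have FaF t x y : I01 t -> dot (Fa t x) y = dot x (F t y).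
  by move=> It; rewrite dotC -hFa // -dotC.
exists G, (MF + nrm (- 1 : R[i]) * MF + N); split=> //.
- by move=> t x It; have [? _] := DG t x It; have [? _] := D1G t x It.
- move=> t x It; have [d e] := D1G t x It.
  apply: (le_trans (bB t _ It d)).
  apply: (@le_trans _ _ (N * nrm x)); last first.
    by rewrite ler_wpM2r ?nrm_ge0 // lerDr addr_ge0 // mulr_ge0 ?nrm_ge0.
  rewrite /N -mulrA ler_wpM2l // mulrDl; apply: lerD.
    rewrite e mulrDl; apply: (le_trans (nrmB_le _ _)); apply: lerD.
      by have [] := BF t x It.
    rewrite FaP // -mulrA; apply: (le_trans (bBP t _ It)).
    by rewrite ler_wpM2l //; exact: (bFa tt).
  rewrite mulrDl; apply: (le_trans (nrmB_le _ _)).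
  by apply: lerD; [exact: (bF tt) | exact: (bFa tt)].
- move=> t x y It; rewrite dotBl dotBr hFa // FaF //; ring.
move=> t u v It; have [_ ->] := DG t v It; have [_ ->] := DG t u It.
have [_ /(_ v) h1] := adjF t (Fa t) It (hFa t It) u.
have [_ /(_ u) h2] := adjF t (Fa t) It (hFa t It) v.
have h3 : dot v (Z t u) = dot v (A t (F t u)) - dot (A t (Fa t v)) u.
  by rewrite dotC -h2 conjcB -!dotC.
rewrite -h1 h3 dotBl dotBr; ring.
Qed.

(** The extension [P0H1] is the adjoint [Xa] of the bounded operator [X], so both off-diagonal
    blocks of $H_1$ appear as [Z] and its adjoint, and $-K_0$ splits likewise into $-iP'P$ and its
    adjoint. *)
Lemma off_diagonal_dot t x y : I01 t ->
  dot (H1a dot A B gamma t x - K0 dot A gamma t x) y = dot (Z t x) y + dot x (Z t y).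
Proof.
move=> It.
have [M M0 [fP fP1 [_ lX bX _] _ _]] := projector_family.
have [PP symP] := P0_projector dotE sA dA C2A cpath rA PE wA It.
have [_ _ [_ _ _ _ [_ _ _ symP1]]] := dP0_facts dotE sA dA C2A cpath rA PE wA P1E.
have {}symP1 u v := symP1 t u v It.
have [Xa [lXa adjX bXa]] := adjointP dotE (lX tt t It) M0 (fun x => bX tt t x It).
have ext u : P0H1 dot A B gamma t u = Xa u.
  apply: (cont_extE (C := M)) => //; first exact: sa_dense (sB It).
  move=> w; rewrite dB // => Dw; apply: (dot_extl dotE) => z; rewrite -PE symP.
  have DPz : dom (B t) (P t z) by rewrite dB //; exact: rP.
  have Dw' : dom (B t) w by rewrite dB.
  by rewrite (sa_sym (sB It) Dw' DPz) [RHS]dotC -adjX -dotC.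
rewrite /H1a /Q0 /K0 ext -?complexiE -!P1E -!PE /Z.
have XaE u v : dot (Xa u) v = dot u (X t v) by rewrite dotC -adjX -dotC.
rewrite !dot_lin !XaE !dot_lin conjc_i (symP x) (symP (P1 t x)) (symP1 x); ring.
Qed.

(** Stands for $H_1^a-K_0$, which enters below only through this quadratic form. *)
Variable BB : R -> H -> H.
Hypothesis BBE : forall t x y, I01 t ->
  dot (BB t x) y = dot (Z t x) y + dot x (Z t y).

(** * Trajectories at a fixed [eps] *)

Section Evolution.
Variables (eps : R) (De : set H).
Hypothesis eps0 : 0 < eps.
Hypothesis core : exists2 Dc : set H, dense Dc & Dc `<=` D `&` D1.
Hypothesis domHbar : forall t, I01 t -> dom (Hbar A B eps t) = De.
Let HB t := Hbar A B eps t.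

Lemma sum_ext t x : I01 t -> D x -> D1 x ->
  De x /\ HB t x = A t x + eps%:C *: B t x.
Proof.
move=> It Dx D1x; have [Dc dDc sDc] := core.
rewrite -(domHbar It).
exact: (Hbar_ext dotE eps (sA It) (sB It) (dA It) (dB It) dDc sDc Dx D1x).
Qed.

Lemma sum_sym t x y : I01 t -> De x -> De y -> dot (HB t x) y = dot x (HB t y).
Proof.
by move=> It; rewrite -(domHbar It); exact: (Hbar_sym dotE (sA It) (sB It)).
Qed.

(* [G] is [0] for [U_eps] and [H_1^a - K_0] for [V]. *)
Definition trajectory (G : R -> H -> H) (v : R -> H) (nv : R) : Prop :=
  forall t, I01 t -> [/\ De (v t), nrm (v t) = nv &
    exists2 v', is_deriv01 v t v' & ('i%C * eps%:C) *: v' = HB t (v t) - eps%:C *: G t (v t)].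

Lemma intertwining (v w : R -> H) (nv nw : R) :
  trajectory BB v nv -> trajectory BB w nw ->
  forall t, I01 t -> dot (P t (v t)) (w t) = dot (P 0 (v 0)) (w 0).
Proof.
move=> tv tw.
have [M M0 [fP fP1 [_ lX bX _] _ _]] := projector_family.
have [N N0 [_ _ _ _ [dP PP1 PP1P symP1]]] := dP0_facts dotE sA dA C2A cpath rA PE wA P1E.
have [_ lP bP _] := fP; have [_ lP1 _ _] := fP1.
have [CP _ rangeP] := P0_range dotE sA dA C2A cpath rA PE.
have ie0 : 'i%C * eps%:C != 0 :> R[i].
  apply/eqP => /(congr1 nrm); rewrite nrmM nrm_i nrm_real nrm0 mul1r.
  by move/eqP; rewrite normr_eq0 gt_eqF.
(* The derivative of [<P v, w>] vanishes. Two trajectories are kept so that the conclusion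
   determines [V^* P V] and not just a norm. *)
have key t v' w' : I01 t ->
    ('i%C * eps%:C) *: v' = HB t (v t) - eps%:C *: BB t (v t) ->
    ('i%C * eps%:C) *: w' = HB t (w t) - eps%:C *: BB t (w t) ->
    dot (P1 t (v t)) (w t) + (dot (P t v') (w t) + dot (P t (v t)) w') = 0.
  move=> It ev ew; have [Dv _ _] := tv t It; have [Dw _ _] := tw t It.
  move: (v t) (w t) Dv Dw ev ew => x y Dx Dy ev ew.
  have [PP symP] := P0_projector dotE sA dA C2A cpath rA PE wA It.
  have commP := P0_comm dotE sA dA C2A cpath rA PE It.
  have DP z : D (P t z) by have [] := rangeP t z It.
  have DAP z : dom (A t) (P t z) by rewrite dA.
  have DBP z : dom (B t) (P t z) by rewrite dB //; exact: rP.
  have symAP : dot x (A t (P t y)) = dot (A t (P t x)) y.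
    have e z : A t (P t z) = P t (A t (P t z)) by rewrite -commP // PP.
    by rewrite e -symP -(sa_sym (sA It) (DAP x) (DAP y)) -symP -e.
  have symX : dot x (P t (X t y)) = dot (P t (X t x)) y.
    by rewrite -symP -(sa_sym (sB It) (DBP x) (DBP y)) -symP.
  have [Dex HPx] := sum_ext It (DP x) (rP x It).
  have [Dey HPy] := sum_ext It (DP y) (rP y It).
  apply: (mulfI ie0); rewrite mulr0.
  have e1 : ('i%C * eps%:C) * dot (P t v') y = dot (HB t x - eps%:C *: BB t x) (P t y).
    by rewrite -ev dotZl -symP.
  have e2 : ('i%C * eps%:C) * dot (P t x) w' = - dot (P t x) (HB t y - eps%:C *: BB t y).
    by rewrite -ew dotZr conjcM conjc_i conjc_real; ring.
  have e3 : dot (HB t x) (P t y) = dot (A t (P t x)) y + eps%:C * dot x (X t y).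
    by rewrite (sum_sym It Dx Dey) HPy dotDr dotZr conjc_real symAP.
  have e4 : dot (P t x) (HB t y) = dot (A t (P t x)) y + eps%:C * dot (X t x) y.
    by rewrite -(sum_sym It Dex Dy) HPx dotDl dotZl.
  have [_ PD PN PB PZ] := linear_facts (lP tt t It).
  have PZ0 z : P t (Z t z) = 0.
    by rewrite /Z !PB PZ PP PP1P // subrr scaler0 subr0.
  have ZPP z : Z t (P t z) = Z t z by rewrite /Z /X PP.
  have e5 : dot (BB t x) (P t y) = dot x (Z t y).
    by rewrite BBE // -symP PZ0 dot0l add0r ZPP.
  have e6 : dot (P t x) (BB t y) = dot (Z t x) y.
    by rewrite dotC BBE // ZPP -symP PZ0 dot0l add0r -dotC.
  rewrite !mulrDr e1 e2 dotBl dotBr dotZl dotZr conjc_real e3 e4 e5 e6.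
  (* After the $H_1$ blocks cancel, [Z] and its adjoint leave [P' P] and [P P'], whose sum is
     [P']. *)
  have e7 := PP1 t x It.
  have e8 : dot (P1 t x) y = dot (P1 t (P t x)) y + dot x (P1 t (P t y)).
    by rewrite -{1}e7 dotDl symP (symP1 t x _ It).
  rewrite e8 /Z !dot_lin conjc_i symX; ring.
move=> t It; apply: subr0_eq; apply: nrm_eq0; apply/eqP; rewrite eq_le nrm_ge0 andbT.
move: (It) => /I01E/andP[t0 t1].
rewrite -[leRHS](mul0r (t - 0)).
apply: (@mean_value_ineq R R[i]^o (fun s => dot (P s (v s)) (w s)) 0 0 t t0).
move=> u e u0 ut e0; have Iu : I01 u by apply/I01E/andP; split; lra.
have [Dv nvE [v' dv ev]] := tv u Iu; have [Dw nwE [w' dw ew]] := tw u Iu.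
have e20 : 0 < e / 2 by lra.
have [d1 d10 h1] := sandwich_expansion dotE fP Iu dv dw e20.
have c0 : 0 < nw + 1 by rewrite -nwE; have := nrm_ge0 (w u); lra.
have e30 : 0 < e / 2 / (nw + 1) by rewrite divr_gt0.
have [d2 d20 h2] := (is_deriv01P _ _ Iu).1 (dP u (v u) Iu) _ e30.
exists (Num.min d1 d2); first by rewrite lt_min d10.
move=> s s0 st; rewrite lt_min => /andP[su1 su2].
have Is : I01 s by apply/I01E/andP; split; lra.
have k1 := h1 s Is su1; have k2 := h2 s Is su2; rewrite add0r.
have k3 := key u v' w' Iu ev ew.
set a := dot (P s (v s)) (w s) - dot (P u (v u)) (w u) in k1 *.
have -> : a = (a - (dot (P s (v u) - P u (v u)) (w u) +
       (s - u)%:C * (dot (P u v') (w u) + dot (P u (v u)) w'))) +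
    dot (P s (v u) - P u (v u) - (s - u)%:C *: P1 u (v u)) (w u).
  have -> : dot (P u v') (w u) + dot (P u (v u)) w' = - dot (P1 u (v u)) (w u).
    by apply/eqP; rewrite -addr_eq0 addrC k3.
  rewrite !dot_lin; ring.
apply: (le_trans (nrmD_le _ _)).
have -> : e * `|s - u| = e / 2 * `|s - u| + e / 2 * `|s - u| by rewrite -mulrDl; congr (_ * _); lra.
apply: lerD => //; apply: (le_trans (dot_le dotE _ _)); rewrite nwE.
apply: (@le_trans _ _ (e / 2 / (nw + 1) * `|s - u| * (nw + 1))).
  apply: ler_pM => //; [exact: nrm_ge0 | by rewrite -nwE nrm_ge0 | by rewrite lerDl].
by rewrite mulrAC divfK // gt_eqF.
Qed.

(** In the constant, [2 M + 2 M KZ] comes from the terms that survive in the derivative, [M] from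
    the Lipschitz bound of [F], and [2 M] from undoing the correction at the times [t] and [0]. *)
Lemma comparison (F : R -> H -> H) (M KZ : R) (v w : R -> H) (nv nw : R) :
  0 <= KZ -> (forall t (x : H), I01 t -> nrm (Z t x) <= KZ * nrm x) ->
  lipfam (fun _ : unit => F) M ->
  (forall t x, I01 t -> D (F t x) /\ D1 (F t x)) ->
  (forall t (x : H), I01 t -> nrm (B t (F t x)) <= M * nrm x) ->
  (forall t x y, I01 t -> dot (F t x) y = - dot x (F t y)) ->
  (forall t u v, I01 t -> dot (A t (F t v)) u + dot v (A t (F t u)) =
     dot (Z t v) u + dot v (Z t u)) ->
  trajectory BB v nv -> trajectory (fun _ _ => 0) w nw ->
  forall t, I01 t -> nrm (dot (v t) (w t) - dot (v 0) (w 0)) <=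
    eps * ((5 * M + 2 * M * KZ) * nv * nw).
Proof.
move=> KZ0 bZ fF DF bBF aF idF tv tw.
have [M0 lF bF lipF] := fF.
have nie : nrm ('i%C * eps%:C : R[i]) = eps.
  by rewrite nrmM nrm_i nrm_real mul1r gtr0_norm.
have nv0 : 0 <= nv by have [_ <- _] := tv 0 I0; exact: nrm_ge0.
have nw0 : 0 <= nw by have [_ <- _] := tw 0 I0; exact: nrm_ge0.
pose K := 2 * M + 2 * M * KZ.
have K0 : 0 <= K by rewrite addr_ge0 ?mulr_ge0 // mulr_ge0.
pose T t x := x + (- eps%:C) *: F t x.
have [N fT] : exists N, lipfam (fun _ : unit => T) N.
  have f1 : lipfam (fun _ : unit => fun (_ : R) (x : H) => x) 1.
    split=> // [_ t x _|_ t t' x _ _]; first by rewrite mul1r.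
    by rewrite subrr nrm0 mul1r mulr_ge0 ?nrm_ge0.
  by eexists; exact: (lipfam_lin dotE (- eps%:C) f1 fF).
have key t v' w' : I01 t ->
    ('i%C * eps%:C) *: v' = HB t (v t) - eps%:C *: BB t (v t) ->
    ('i%C * eps%:C) *: w' = HB t (w t) - eps%:C *: 0 ->
    nrm (dot (T t v') (w t) + dot (T t (v t)) w') <= eps * (K * nv * nw).
  move=> It ev ew; have [Dv nvE _] := tv t It; have [Dw nwE _] := tw t It.
  rewrite -nvE -nwE; move: (v t) (w t) Dv Dw ev ew => x y Dx Dy ev ew {nvE nwE}.
  rewrite scaler0 subr0 in ew.
  rewrite -(ler_pM2l eps0) -{1}nie -nrmM [leRHS]mulrA -[eps * eps]expr2 mulrDr.
  have [DFx D1Fx] := DF t x It; have [DFy D1Fy] := DF t y It.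
  have [Dex HFx] := sum_ext It DFx D1Fx; have [Dey HFy] := sum_ext It DFy D1Fy.
  have e1 : ('i%C * eps%:C) * dot (T t v') y =
      dot (HB t x - eps%:C *: BB t x) y + eps%:C * dot (HB t x - eps%:C *: BB t x) (F t y).
    rewrite -ev /T !dot_lin aF //; ring.
  have e2 : ('i%C * eps%:C) * dot (T t x) w' = - dot x (HB t y) + eps%:C * dot (F t x) (HB t y).
    rewrite -ew /T !dot_lin conjcM conjc_i conjc_real; ring.
  have e3 : dot (HB t x) (F t y) = dot x (A t (F t y)) + eps%:C * dot x (B t (F t y)).
    by rewrite (sum_sym It Dx Dey) HFy dotDr dotZr conjc_real.
  have e4 : dot (F t x) (HB t y) = dot (A t (F t x)) y + eps%:C * dot (B t (F t x)) y.
    by rewrite -(sum_sym It Dex Dy) HFx dotDl dotZl.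
  (* Order 0 in [eps] cancels by symmetry of [HB], and order 1 because the commutator [idF] equals
     the form of [BB]. Only [eps ^ 2] remains, one power of which is divided out. *)
  have -> : ('i%C * eps%:C) * dot (T t v') y + ('i%C * eps%:C) * dot (T t x) w' =
     (eps ^+ 2)%:C * (dot x (B t (F t y)) + dot (B t (F t x)) y - dot (BB t x) (F t y)).
    have e5 := idF t y x It; rewrite -BBE // in e5.
    rewrite e1 e2 dotBl dotBl !dotZl e3 e4 -e5 (sum_sym It Dx Dy) rmorphXn /=; ring.
  rewrite nrmM nrm_real ger0_norm ?sqr_ge0 // ler_wpM2l ?sqr_ge0 //.
  have cs (a c : H) (m n : R) : nrm a <= m -> nrm c <= n -> nrm (dot a c) <= m * n.
    by move=> am cn; apply: (le_trans (dot_le dotE _ _)); rewrite ler_pM ?nrm_ge0.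
  have bBB : nrm (BB t x) <= 2 * KZ * nrm x.
    apply: (nrm_le_dot dotE) => [|z]; first by rewrite !mulr_ge0 ?nrm_ge0.
    rewrite BBE //; apply: (le_trans (nrmD_le _ _)).
    have c1 := cs _ _ _ _ (bZ t x It) (lexx (nrm z)).
    have c2 := cs _ _ _ _ (lexx (nrm x)) (bZ t z It).
    apply: (le_trans (lerD c1 c2)).
    by rewrite le_eqVlt; apply/orP; left; apply/eqP; ring.
  have k1 := cs _ _ _ _ (lexx (nrm x)) (bBF t y It).
  have k2 := cs _ _ _ _ (bBF t x It) (lexx (nrm y)).
  have k3 := cs _ _ _ _ bBB (bF tt t y It).
  apply: (le_trans (nrmB_le _ _)); apply: (le_trans (lerD (nrmD_le _ _) k3)).
  apply: (le_trans (lerD (lerD k1 k2) (lexx _))).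
  by rewrite le_eqVlt; apply/orP; left; apply/eqP; rewrite /K; ring.
have Fdot t : I01 t -> nrm (dot (F t (v t)) (w t)) <= M * nv * nw.
  move=> It; have [_ nvE _] := tv t It; have [_ nwE _] := tw t It.
  by apply: (le_trans (dot_le dotE _ _)); rewrite nwE ler_wpM2r // -nvE (bF tt).
move=> t It; move: (It) => /I01E/andP[t0 t1].
pose f s := dot (T s (v s)) (w s).
have main : nrm (f t - f 0) <= eps * ((M + K) * nv * nw).
  have C0 : 0 <= eps * ((M + K) * nv * nw).
    have MK0 : 0 <= M + K by exact: addr_ge0.
    by apply: mulr_ge0; [exact: ltW | apply: mulr_ge0 => //; exact: mulr_ge0].
  apply: (@le_trans _ _ (eps * ((M + K) * nv * nw) * (t - 0))); last first.
    by rewrite subr0 -[leRHS]mulr1 ler_wpM2l.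
  apply: (@mean_value_ineq R R[i]^o f _ 0 t t0).
  move=> u e u0 ut e0; have Iu : I01 u by apply/I01E/andP; split; lra.
  have [Dv nvE [v' dv ev]] := tv u Iu; have [Dw nwE [w' dw ew]] := tw u Iu.
  have [d d0 hd] := sandwich_expansion dotE fT Iu dv dw e0.
  exists d => // s s0 st su; have Is : I01 s by apply/I01E/andP; split; lra.
  have k1 := hd s Is su; have k2 := key u v' w' Iu ev ew.
  set a := f s - f u; set c := dot (T s (v u) - T u (v u)) (w u) +
    (s - u)%:C * (dot (T u v') (w u) + dot (T u (v u)) w') in k1.
  have -> : a = (a - c) + c by rewrite subrK.
  apply: (le_trans (nrmD_le _ _)); rewrite mulrDl addrC; apply: lerD => //.
  apply: (le_trans (nrmD_le _ _)); rewrite nrmM nrm_real.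
  have -> : eps * ((M + K) * nv * nw) * `|s - u| =
    eps * (M * `|s - u| * nv) * nw + `|s - u| * (eps * (K * nv * nw)) by ring.
  apply: lerD; last by rewrite ler_wpM2l.
  have -> : T s (v u) - T u (v u) = - (eps%:C *: (F s (v u) - F u (v u))).
    rewrite /T; apply: (dot_extl dotE) => z; rewrite !dot_lin; ring.
  apply: (le_trans (dot_le dotE _ _)); rewrite nrmN nrmZr gtr0_norm // nwE.
  by rewrite ler_wpM2r // ler_wpM2l ?(ltW eps0) // -nvE (lipF tt).
have -> : dot (v t) (w t) - dot (v 0) (w 0) = (f t - f 0) +
    (eps%:C * dot (F t (v t)) (w t) - eps%:C * dot (F 0 (v 0)) (w 0)).
  rewrite /f /T !dot_lin; ring.
apply: (le_trans (nrmD_le _ _)); apply: (le_trans (lerD main (nrmB_le _ _))).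
rewrite !nrmM nrm_real gtr0_norm //.
have h1 := ler_wpM2l (ltW eps0) (Fdot t It).
have h2 := ler_wpM2l (ltW eps0) (Fdot 0 I0).
apply: (le_trans (lerD (lexx _) (lerD h1 h2))).
by rewrite le_eqVlt; apply/orP; left; apply/eqP; rewrite /K; ring.
Qed.

End Evolution.

Lemma dense_bounded (De : set H) (T : H -> H) (c C : R) : dense De -> linear T ->
  0 <= c -> (forall x, nrm (T x) <= C * nrm x) ->
  (forall x, De x -> nrm (T x) <= c * nrm x) -> forall x, nrm (T x) <= c * nrm x.
Proof.
move=> dDe lT c0 bT h x; apply/ler_addgt0Pl => e e0.
have [_ _ _ TB _] := linear_facts lT.
pose q := c + `|C| + 1; have q0 : 0 < q by have := normr_ge0 C; rewrite /q; lra.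
have [y Dy xy] := dense_nrm x dDe (divr_gt0 e0 q0).
rewrite ltr_pdivlMr // in xy.
have h1 : nrm (T x) <= nrm (T y) + nrm (T (x - y)).
  by rewrite TB addrC -lerBlDr; exact: nrm_leB.
have h2 : nrm y <= nrm x + nrm (x - y).
  by rewrite addrC -lerBlDr nrmB; exact: nrm_leB.
have h3 := ler_wpM2l c0 h2; have h4 := h y Dy.
have h5 : nrm (T (x - y)) <= `|C| * nrm (x - y).
  by apply: (le_trans (bT _)); rewrite ler_wpM2r ?nrm_ge0 ?ler_norm.
have n0 := nrm_ge0 (x - y).
move: xy h1 h3 h4 h5; rewrite /q !mulrDr mulr1 [nrm (x - y) * c]mulrC.
rewrite [nrm (x - y) * `|C|]mulrC; lra.
Qed.

(** [C] is chosen before [eps] and the evolutions; this order of quantifiers is the uniformity in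
    [eps]. *)
Lemma adiabatic_estimate : exists2 C : R, 0 <= C &
  forall (eps : R) (De : set H) (U V : R -> H -> H), 0 < eps ->
  (exists2 Dc : set H, dense Dc & Dc `<=` D `&` D1) ->
  (forall t, I01 t -> dom (Hbar A B eps t) = De) ->
  (forall t, I01 t -> unitary dot (U t)) -> (forall t, I01 t -> unitary dot (V t)) ->
  (forall t x, I01 t -> De (U t x) <-> De x) -> (forall t x, I01 t -> De (V t x) <-> De x) ->
  (forall x, U 0 x = x) -> (forall x, V 0 x = x) ->
  (forall x, De x -> trajectory eps De (fun _ _ => 0) (U^~ x) (nrm x)) ->
  (forall x, De x -> trajectory eps De BB (V^~ x) (nrm x)) ->
  (forall t x, I01 t -> V t (P 0 x) = P t (V t x)) /\
  (forall t (x : H), I01 t -> nrm (U t x - V t x) <= C * eps * nrm x).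
Proof.
have [F [M [fF DF bBF aF idF]]] := corrector.
have [M' M'0 [fP _ _ _ _]] := projector_family.
have [KZ [KZ0 _ bZ _]] := lipfam_Z.
have [M0 _ _ _] := fF; have [_ lP bP _] := fP.
exists (5 * M + 2 * M * KZ) => [|eps De U V eps0 hcore hdom uU uV DU DV U0 V0 tU tV].
  by rewrite addr_ge0 ?mulr_ge0 // mulr_ge0.
have dDe : dense De.
  have [Dc dDc sDc] := hcore; rewrite -(hdom 0 I0).
  exact: (dense_Hbar dotE eps (sA I0) (sB I0) (dA I0) (dB I0) dDc sDc).
split=> t x It; have [lV dV sV] := uV t It; have [lU dU sU] := uU t It;
  have isoV y := unitary_nrm dotE y (uV t It); have isoU y := unitary_nrm dotE y (uU t It).
  pose T y := P t (V t y) - V t (P 0 y).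
  have lT : linear T.
    move=> a y z; rewrite /T lV (lP tt t It) (lP tt 0 I0) lV.
    apply: (dot_extl dotE) => w; rewrite !dot_lin; ring.
  have bT y : nrm (T y) <= (M' + M') * nrm y.
    apply: (le_trans (nrmB_le _ _)); rewrite mulrDl; apply: lerD.
      by apply: (le_trans (bP tt t _ It)); rewrite isoV.
    by rewrite isoV; exact: (bP tt).
  suff : T x = 0 by move/eqP; rewrite subr_eq0 eq_sym => /eqP.
  apply: nrm_eq0; apply/eqP; rewrite eq_le nrm_ge0 andbT -[leRHS](mul0r (nrm x)).
  move: (x); apply: (dense_bounded dDe lT (lexx 0) bT) => y Dy; rewrite mul0r.
  suff -> : T y = 0 by rewrite nrm0.
  apply: subr0_eq; rewrite subr0; apply/eqP; rewrite subr_eq0; apply/eqP.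
  (* Test vectors are taken of the form [V t z]: [<P(t) V y, V z> = <P(0) y, z> = <V P(0) y, V
     z>]. *)
  apply: (dense_dot_extl dotE dDe) => _z; have [z <-] := sV _z => /(DV t z It) Dz.
  rewrite (intertwining eps0 hcore hdom (tV y Dy) (tV z Dz) It) !V0.
  by rewrite dV.
pose T y := U t y - V t y.
have lT : linear T.
  move=> a y z; rewrite /T lV lU.
  apply: (dot_extl dotE) => w; rewrite !dot_lin; ring.
have bT y : nrm (T y) <= 2 * nrm y.
  by apply: (le_trans (nrmB_le _ _)); rewrite isoU isoV; have := nrm_ge0 y; lra.
have c0 : 0 <= (5 * M + 2 * M * KZ) * eps.
  by apply: mulr_ge0; [rewrite addr_ge0 ?mulr_ge0 // mulr_ge0 | exact: ltW].
move: (x); apply: (dense_bounded dDe lT c0 bT) => y Dy.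
apply: (dense_nrm_le_dot dotE dDe); first by rewrite mulr_ge0 ?nrm_ge0.
move=> _z; have [z <-] := sU _z => /(DU t z It) Dz.
have := comparison eps0 hcore hdom KZ0 (bZ tt) fF DF bBF aF idF (tV y Dy) (tU z Dz) It.
(* Unitarity of [U t] turns [<V y, U z> - <y, z>] into [<V y - U y, U z>], and the vectors [U t z]
   cover the domain. *)
rewrite U0 V0 -(dU y z) -dotBl => h.
rewrite isoU /T -opprB dotNl nrmN; apply: (le_trans h).
by rewrite le_eqVlt; apply/orP; left; apply/eqP; ring.
Qed.

End Adiabatic.

(** * Operator norms and conclusion *)

Section OperatorNorm.
Variables (R : realType) (H : completeNormedModType R[i]).

Lemma opnorm_bound (T : H -> H) (b : R) :
  (forall a x, T (a *: x) = a *: T x) -> (opnorm T <= b%:E)%E ->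
  forall x, nrm (T x) <= b * nrm x.
Proof.
move=> TZ hb x; have [->|x0] := eqVneq x 0.
  have := TZ 0 0; rewrite !scale0r => ->; by rewrite !nrm0 mulr0.
have nx := nrm_gt0 x0.
rewrite -ler_pdivrMr // mulrC.
suff : ((nrm (T ((nrm x)^-1%:C *: x)))%:E <= b%:E)%E.
  by rewrite lee_fin TZ nrmZr ger0_norm // invr_ge0 ltW.
apply: le_trans hb; apply: ereal_sup_ubound; exists ((nrm x)^-1%:C *: x) => //=.
by rewrite nrmE nrmZr ger0_norm ?invr_ge0 ?(ltW nx) // mulVf // gt_eqF.
Qed.

Lemma opnorm_le (T : H -> H) (b : R) : 0 <= b ->
  (forall x, nrm (T x) <= b * nrm x) -> (opnorm T <= b%:E)%E.
Proof.
move=> b0 hb; apply: ge_ereal_sup => _ [x /= x1 <-]; rewrite lee_fin.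
apply: (le_trans (hb x)); rewrite -[leRHS]mulr1 ler_wpM2l //.
by rewrite -lecR -nrmE.
Qed.

End OperatorNorm.

Unset Implicit Arguments.
Set Strict Implicit.

Theorem proposition2p1 (R : realType) (H : completeNormedModType R[i])
    (dot : {dot H for Num.conj})
    (H0 H1 : R -> operator H) (D0 D1 : set H) (D' : R -> set H)
    (sigma_a sigma_b : R -> set R[i]) (gamma : R -> R[i])
    (hH : separable_hilbert dot)
    (hD : hypothesis_D dot H0 H1 D0 D1 D')
    (hR0 : hypothesis_R0 dot H0 gamma D0 D1 sigma_a sigma_b)
    (hR1 : hypothesis_R1 dot H0 H1 gamma D1)
    (hRbar : hypothesis_Rbar dot H0 H1 D')
    (U V : R -> R -> H -> H)
    (hU : forall eps : R, 0 < eps ->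
      evolution dot eps (D' eps) (fun t => Hbar H0 H1 eps t) (U eps))
    (hV : forall eps : R, 0 < eps ->
      evolution dot eps (D' eps)
        (fun t x => Hbar H0 H1 eps t x - eps%:C *: H1a dot H0 H1 gamma t x
                    + eps%:C *: K0 dot H0 gamma t x)
        (V eps)) :
  (forall (eps t : R) (x : H), 0 < eps -> I01 t ->
     V eps t (P0 dot H0 gamma 0 x) = P0 dot H0 gamma t (V eps t x)) /\
  (exists C : R, \forall eps \near 0^'+,
     (ereal_sup [set opnorm (fun x => (U eps t x - V eps t x)%R)
        | t in I01] <= (C * eps)%:E)%E).
Proof.
have [dotE _] := hH.
have I0 := I01_0 R.
have sA t (It : I01 t) : self_adjoint dot (H0 t) := (hD_H0 hD It).1.
have dA t (It : I01 t) : dom (H0 t) = D0 := (hD_H0 hD It).2.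
have sB t (It : I01 t) : self_adjoint dot (H1 t) := (hD_H1 hD It).1.
have dB t (It : I01 t) : dom (H1 t) = D1 := (hD_H1 hD It).2.
have C2A := hR0_C2 hR0.
have cpath := hR0_path hR0.
have rA := hR0_path_resolvent hR0.
have wA t (mu : R) : I01 t -> ~ resolvent_set (H0 t) mu%:C ->
    winding gamma mu%:C = 0 \/ winding gamma mu%:C = 1.
  move=> It nr; have : spectrum (H0 t) mu%:C by [].
  rewrite (hR0_spec hR0 It) => -[sa|sb]; [left | right].
    exact: hR0_encircles_a hR0 _ _ It sa.
  exact: hR0_encircles_b hR0 _ _ It sb.
have C1B := hR1_C1 hR1.
have rP := hR0_ran hR0; have rP1 := hR0_ran' hR0; have cP1 := hR1_C0 hR1.
have rR := hR1_ran hR1; have rR1 := hR1_ran' hR1.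
have [b [hb hb1]] := hR1_bound hR1.
pose P : R -> H -> H := P0 dot H0 gamma; pose P1 : R -> H -> H := dP0 dot H0 gamma.
have PE t x : P t x = P0 dot H0 gamma t x by [].
have P1E t x : P1 t x = dP0 dot H0 gamma t x by [].
have lP t (It : I01 t) : linear (P t) := P0_linear dotE sA dA C2A cpath rA PE It.
have [M _ [lP1 _ _ _ _]] := dP0_facts dotE sA dA C2A cpath rA PE wA P1E.
(* Turns the suprema of $R_1$ into vector bounds. Homogeneity of the compositions needs the range
   hypotheses, since [H1] is linear only on its domain; the absolute value of [b] supplies the sign
   required above. *)
have opb (T : R[i] -> R -> H -> H) :
    (ereal_sup [set opnorm (T p.1 p.2) | p in (gamma @` I01) `*` I01] < b%:E)%E ->
    (forall s t a x, I01 s -> I01 t -> T (gamma s) t (a *: x) = a *: T (gamma s) t x) ->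
    forall s t (x : H), I01 s -> I01 t -> nrm (T (gamma s) t x) <= `|b| * nrm x.
  move=> hT TZ s t x Is It.
  apply: opnorm_bound => [a y|]; first exact: TZ.
  apply: (@le_trans _ _ b%:E); last by rewrite lee_fin ler_norm.
  apply: le_trans (ltW hT); apply: ereal_sup_ubound; exists (gamma s, t) => //.
  by split=> //; exists s.
have RZ s t a x : I01 s -> I01 t ->
    R0 H0 t (gamma s) (a *: x) = a *: R0 H0 t (gamma s) x.
  move=> Is It; have lR : linear (R0 H0 t (gamma s)) := res_lin dotE (sA t It) (rA t s It Is).
  by have [_ _ _ _ h] := linear_facts lR; exact: h.
have BZ t a x : I01 t -> D1 x -> H1 t (a *: x) = a *: H1 t x.
  by move=> It; rewrite -(dB t It) => Dx; have [] := saZ (sB t It) a Dx.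
have PZ t a x : I01 t -> P t (a *: x) = a *: P t x.
  by move=> It; have [_ _ _ _ h] := linear_facts (lP t It); exact: h.
have P1Z t a x : I01 t -> P1 t (a *: x) = a *: P1 t x.
  by move=> It; have [_ _ _ _ h] := linear_facts (lP1 t It); exact: h.
have bR := opb (fun z t x => H1 0 (R0 H0 t z (H1 t (P t x)))) hb.
have {}bR : forall s t (x : H), I01 s -> I01 t ->
    nrm (H1 0 (R0 H0 t (gamma s) (H1 t (P t x)))) <= `|b| * nrm x.
  apply: bR => s t a x Is It; rewrite PZ // BZ //; last exact: rP.
  by rewrite RZ // BZ //; exact: rR.
have bR1 := opb (fun z t x => H1 0 (R0 H0 t z (P1 t (P t x)))) hb1.
have {}bR1 : forall s t (x : H), I01 s -> I01 t ->
    nrm (H1 0 (R0 H0 t (gamma s) (P1 t (P t x)))) <= `|b| * nrm x.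
  by apply: bR1 => s t a x Is It; rewrite PZ // P1Z // RZ // BZ //; exact: rR1.
pose BB t x := H1a dot H0 H1 gamma t x - K0 dot H0 gamma t x.
have BBE t x y (It : I01 t) := off_diagonal_dot dotE sA dA C2A cpath rA wA PE P1E sB dB C1B
  rP rP1 cP1 x y It.
have [C C0 est] := adiabatic_estimate dotE sA dA C2A cpath rA wA PE P1E sB dB C1B
  rP rP1 cP1 rR rR1 (normr_ge0 b) bR bR1 (BB := BB) BBE.
have main eps : 0 < eps ->
   (forall t x, I01 t -> V eps t (P 0 x) = P t (V eps t x)) /\
   (forall t (x : H), I01 t -> nrm (U eps t x - V eps t x) <= C * eps * nrm x).
  move=> eps0; have [uU dU iU eU] := hU eps eps0; have [uV dV iV eV] := hV eps eps0.
  apply: (est eps (D' eps)) => //.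
  - have [Dc [dDc sDc _]] := hD_esa hD eps0 I0; by exists Dc.
  - by move=> t It; exact: hD_dom hD _ _ eps0 It.
  - move=> x Dx t It; split; [by apply/dU | exact: (unitary_nrm dotE x (uU t It))|].
    have [v dv ev] := eU t x It Dx; exists v => //.
    by rewrite scaler0 subr0 complexiE.
  - move=> x Dx t It; split; [by apply/dV | exact: (unitary_nrm dotE x (uV t It))|].
    have [v dv ev] := eV t x It Dx; exists v => //.
    by rewrite complexiE ev /BB scalerBr opprB addrA addrAC.
split=> [eps t x eps0 It|]; first by have [h _] := main eps eps0; exact: h.
exists C; near=> eps; have eps0 : 0 < eps by near: eps; exact: nbhs_right_gt.
have [_ h] := main eps eps0.
apply: ge_ereal_sup => _ [t It <-]; apply: opnorm_le => [|x]; last exact: h.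
by rewrite mulr_ge0 // ltW.
Unshelve. all: by end_near. Qed.
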